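(* Let $I=(a,b)\subseteq\mathbb{R}$ be an open interval, let $(F_1,g_1),\dots,(F_n,g_n)$ be weakly convex Riemannian manifolds, and let $f_1,\dots,f_n:I\to(0,\infty)$ be smooth. Consider the multiwarped spacetime $(I\times F_1\times\cdots\times F_n,\ g=-d\tau^2+\sum_{i=1}^n f_i^2 g_i)$. Suppose that any point $z$ of the spacetime can be joined with any line $L[x]$, $x\in F_1\times\cdots\times F_n$, both by a future directed causal curve and by a past directed causal curve (starting at $z$ and ending at some point of $L[x]$). Then the spacetime is geodesically connected.
   Context: The metric $g=-d\tau^2+\sum_i f_i(\tau)^2 g_i$ is the Lorentzian metric on the product manifold $I\times F_1\times\cdots\times F_n$, with $\tau$ the coordinate of $I$ (pullbacks by the projections omitted). A Riemannian manifold is weakly convex if any two of its points can be joined by a geodesic which minimizes the Riemannian distance (not necessarily unique). A tangent vector $X$ is timelike if $g(X,X)<0$, lightlike if $g(X,X)=0$ and $X\neq 0$; a causal curve is a piecewise smooth curve with timelike or lightlike velocity. The future time orientation is given by $\partial/\partial\tau$. For $x\in F_1\times\cdots\times F_n$ the line at $x$ is $L[x]=\{(t,x): t\in I\}$. A semi-Riemannian manifold is geodesically connected if each pair of its points can be joined by a geodesic. *)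

(* Defs.v *)
From HB Require Import structures.
From mathcomp Require Import all_boot all_order all_algebra.
From mathcomp Require Import all_classical all_reals all_analysis.

Set Implicit Arguments.
Unset Strict Implicit.
Unset Printing Implicit Defensive.

Import Order.TTheory GRing.Theory Num.Theory.
Import numFieldNormedType.Exports.

Local Open Scope classical_set_scope.
Local Open Scope ring_scope.

Section Smoothness.
Context {R : realType} {V W : normedModType R}.

(* Meant for U open and V finite-dimensional, where it is the usual C^k. *)
Fixpoint Ck_on (k : nat) (U : set V) (f : V -> W) : Prop :=
  (forall x, U x -> {for x, continuous f}) /\
  if k is k'.+1 then
    forall v, (forall x, U x -> derivable f x v) /\ Ck_on k' U ('D_v f)
  else True.

Definition smooth_on (U : set V) (f : V -> W) : Prop :=
  forall k, Ck_on k U f.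

End Smoothness.

(* The data of an atlas and of a metric tensor in coordinates; the axioms are
   in [manifold] and [riemannian] below.  Coordinate maps are total functions,
   meaningful on the chart domain only; likewise [gram c] is meaningful on the
   image of the domain of c only.  A tangent vector at p is represented by its
   components in the preferred chart [chart_at p]. *)
Record metric_manifold (R : realType) := MetricManifold {
  carrier :> topologicalType ;
  mdim : nat ;
  chart : Type ;
  chart_at : carrier -> chart ;
  chart_dom : chart -> set carrier ;
  chart_coord : chart -> carrier -> 'rV[R]_mdim ;
  gram : chart -> 'rV[R]_mdim -> 'M[R]_mdim }.

Section MetricManifoldTheory.
Context {R : realType}.
Variable M : metric_manifold R.

Local Notation chart := (chart M).
Local Notation vec := 'rV[R]_(mdim M).

(* psi is the transition map [chart_coord d \o (chart_coord c)^-1] *)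
Definition transition (c d : chart) (psi : vec -> vec) : Prop :=
  smooth_on (chart_coord c @` (chart_dom c `&` chart_dom d)) psi /\
  forall p, chart_dom c p -> chart_dom d p -> psi (chart_coord c p) = chart_coord d p.

Definition chart_homeo (c : chart) : Prop :=
  [/\ open (chart_dom c),
      forall p, chart_dom c p -> {for p, continuous (chart_coord c)},
      forall p q, chart_dom c p -> chart_dom c q -> chart_coord c p = chart_coord c q -> p = q
    & forall O : set M, open O -> O `<=` chart_dom c -> open (chart_coord c @` O)].

Definition manifold : Prop :=
  [/\ hausdorff_space M, @second_countable M,
      forall p : M, chart_dom (chart_at p) p,
      forall c : chart, chart_homeo c
    & forall c d : chart, exists psi, transition c d psi].

Definition bilin m (G : 'M[R]_m) (v w : 'rV[R]_m) : R := (v *m G *m w^T) 0 0.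

Definition riemannian : Prop :=
  [/\ manifold,
      forall (c : chart) i j,
        smooth_on (chart_coord c @` chart_dom c) (fun u => gram c u i j),
      forall (c : chart) p, chart_dom c p -> (gram c (chart_coord c p))^T = gram c (chart_coord c p),
      forall (c : chart) p v, chart_dom c p -> v != 0 ->
        0 < bilin (gram c (chart_coord c p)) v v
    & forall (c d : chart) psi p v w, transition c d psi -> chart_dom c p -> chart_dom d p ->
        bilin (gram c (chart_coord c p)) v w =
        bilin (gram d (chart_coord d p)) ('D_v psi (chart_coord c p)) ('D_w psi (chart_coord c p))].

Definition metric (p : M) (v w : vec) : R :=
  bilin (gram (chart_at p) (chart_coord (chart_at p) p)) v w.

(* Curves are total functions on R, constrained on a set J of parameters only,
   with J open. *)
Definition smooth_curve (J : set R) (gamma : R -> M) : Prop :=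
  (forall t, J t -> {for t, continuous gamma}) /\
  forall c : chart,
    smooth_on (J `&` gamma @^-1` chart_dom c) (chart_coord c \o gamma).

Definition velocity (gamma : R -> M) (t : R) : vec :=
  derive1 (chart_coord (chart_at (gamma t)) \o gamma) t.

(* On each of the closed subintervals of some partition of [0, 1], gamma is the
   restriction of a smooth curve sigma defined on a larger open interval, and
   the (one-sided at the end points) velocity satisfies P there. *)
Definition piecewise_smooth (P : M -> vec -> Prop) (gamma : R -> M) :
    Prop :=
  exists2 s : seq R, itv_partition 0 1 s &
  forall k, (k < size s)%N ->
  let t0 := nth 0 (0 :: s) k in let t1 := nth 0 s k in
  exists2 e : R, 0 < e &
  exists2 sigma : R -> M, smooth_curve `]t0 - e, t1 + e[ sigma &
    forall t, t \in `[t0, t1] -> gamma t = sigma t /\ P (sigma t) (velocity sigma t).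

(* The velocity of gamma at the finitely many break points is irrelevant. *)
Definition curve_length (gamma : R -> M) : \bar R :=
  (\int[lebesgue_measure]_(t in `[0%R, 1%R])
     (Num.sqrt (metric (gamma t) (velocity gamma t) (velocity gamma t)))%:E)%E.

Definition riemannian_dist (p q : M) : \bar R :=
  ereal_inf [set curve_length gamma | gamma in
    [set gamma | [/\ piecewise_smooth (fun _ _ => True) gamma,
                     gamma 0 = p & gamma 1 = q]]].

Definition christoffel (c : chart) (u : vec) (i j k : 'I_(mdim M)) : R :=
  2^-1 * \sum_l invmx (gram c u) k l *
    ('D_(delta_mx 0 i) (fun x => gram c x j l) u
     + 'D_(delta_mx 0 j) (fun x => gram c x i l) u
     - 'D_(delta_mx 0 l) (fun x => gram c x i j) u).

Definition geodesic (J : set R) (gamma : R -> M) : Prop :=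
  smooth_curve J gamma /\
  forall (c : chart) t, J t -> chart_dom c (gamma t) ->
  let x := chart_coord c \o gamma in
  forall k, derive1n 2 x t 0 k
    + \sum_i \sum_j christoffel c (x t) i j k * derive1 x t 0 i * derive1 x t 0 j = 0.

(* A geodesic on the closed interval [0, 1] is the restriction of one on a
   larger open interval; constant geodesics are allowed. *)
Definition joining_geodesic (p q : M) (gamma : R -> M) : Prop :=
  [/\ exists2 e : R, 0 < e & geodesic `]- e, 1 + e[ gamma,
      gamma 0 = p & gamma 1 = q].

Definition weakly_convex : Prop :=
  forall p q : M, exists2 gamma, joining_geodesic p q gamma &
    curve_length gamma = riemannian_dist p q.

Definition geodesically_connected : Prop :=
  forall p q : M, exists gamma, joining_geodesic p q gamma.

Definition causal (p : M) (v : vec) : Prop :=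
  metric p v v < 0 \/ (metric p v v = 0 /\ v <> 0).

(* T is a timelike vector field, defining the future time orientation. *)
Definition future_causal_curve (T : M -> vec) : (R -> M) -> Prop :=
  piecewise_smooth (fun p v => causal p v /\ metric p (T p) v < 0).

Definition past_causal_curve (T : M -> vec) : (R -> M) -> Prop :=
  piecewise_smooth (fun p v => causal p v /\ 0 < metric p (T p) v).

End MetricManifoldTheory.

Definition open_interval (R : realType) (a b : \bar R) : set R :=
  [set t | (a < t%:E)%E /\ (t%:E < b)%E].

Section Multiwarped.
Context {R : realType} (n : nat).
Variables (a b : \bar R) (F : 'I_n -> metric_manifold R) (f : 'I_n -> R -> R).

Definition fibers : topologicalType :=
  prod_topology (fun i => F i : topologicalType).

Definition multiwarped_dim : nat := (1 + \sum_i mdim (F i))%N.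

(* A chart is a family of charts of the fibers, the coordinates being
   (tau, x_1, ..., x_n). *)
Definition multiwarped_coord (c : forall i, chart (F i))
    (z : open_interval a b * fibers) : 'rV[R]_multiwarped_dim :=
  row_mx (val z.1)%:M (\mxrow_i chart_coord (c i) (z.2 i)).

Definition multiwarped_gram (c : forall i, chart (F i))
    (u : 'rV[R]_multiwarped_dim) : 'M[R]_multiwarped_dim :=
  let tau := lsubmx u 0 0 in
  block_mx (- 1%:M) 0
    0 (\mxdiag_i (f i tau ^+ 2 *: gram (c i) (submxrow (rsubmx u) i))).

Definition multiwarped : metric_manifold R := {|
  carrier := (open_interval a b * fibers)%type ;
  mdim := multiwarped_dim ;
  chart := forall i, chart (F i) ;
  chart_at := fun z i => chart_at (z.2 i) ;
  chart_dom := fun c => [set z | forall i, chart_dom (c i) (z.2 i)] ;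
  chart_coord := multiwarped_coord ;
  gram := multiwarped_gram |}.

Definition partial_tau (z : multiwarped) : 'rV[R]_(mdim multiwarped) :=
  row_mx 1%:M 0.

Definition line (x : fibers) : set multiwarped :=
  [set (t, x) | t in [set: open_interval a b]].

End Multiwarped.

Arguments multiwarped {R n} a b F f.
Arguments partial_tau {R n} a b F f z.
Arguments line {R n} a b F f x.

Lemma multiwarped_metricE (R : realType) (n : nat) (a b : \bar R)
    (F : 'I_n -> metric_manifold R) (f : 'I_n -> R -> R)
    (z : multiwarped a b F f) (v w : 'rV[R]_(1 + \sum_i mdim (F i))) :
  metric z v w = - (lsubmx v 0 0 * lsubmx w 0 0)
    + \sum_i f i (val z.1) ^+ 2 *
        metric (z.2 i) (submxrow (rsubmx v) i) (submxrow (rsubmx w) i) :> R.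
Proof.
rewrite /metric /bilin /= /multiwarped_gram /multiwarped_coord.
rewrite -[in LHS](hsubmxK v) -[in LHS](hsubmxK w) tr_row_mx mul_row_block.
rewrite !mulmx0 !addr0 add0r mul_row_col row_mxKl row_mxKr mulmxN mulmx1 mulNmx.
rewrite mxE; congr (_ + _); first by rewrite !mxE big_ord1 !mxE.
have E (A : 'rV[R]_(\sum_i mdim (F i))) : A = \mxrow_i submxrow A i.
  by rewrite submxrowK.
rewrite [in LHS](E (rsubmx v)) [in LHS](E (rsubmx w)) mul_mxrow_mxdiag.
rewrite tr_mxrow mul_mxrow_mxcol summxE; apply: eq_bigr => i _.
by rewrite mxrowK -scalemxAr -scalemxAl !mxE eqxx mulr1n.
Qed.

Lemma metric_partial_tau (R : realType) (n : nat) (a b : \bar R)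
    (F : 'I_n -> metric_manifold R) (f : 'I_n -> R -> R)
    (z : multiwarped a b F f) (v : 'rV[R]_(1 + \sum_i mdim (F i))) :
  metric z (partial_tau a b F f z) v = - lsubmx v 0 0 :> R.
Proof.
rewrite multiwarped_metricE /partial_tau row_mxKl row_mxKr mxE eqxx mul1r.
rewrite [X in _ + X]big1 ?addr0 // => i _.
by rewrite submxrow0 /metric /bilin !mul0mx mxE mulr0.
Qed.

(* Main.v *)
Require Import Defs.
From HB Require Import structures.
From mathcomp Require Import all_boot all_order all_algebra.
From mathcomp Require Import all_classical all_reals all_analysis.
From mathcomp Require Import measurable_realfun ring lra.
Set Implicit Arguments.
Unset Strict Implicit.
Unset Printing Implicit Defensive.
Import Order.TTheory GRing.Theory Num.Theory.
Import numFieldNormedType.Exports.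
Local Open Scope classical_set_scope.
Local Open Scope ring_scope.

(* Let gamma_i be a minimizing geodesic of F_i, of length d_i, between the i-th
   components of the two points.  The curve (tau(t), gamma_i(u_i(t))) is a geodesic
   as soon as u_i' = q_i / f_i(tau)^2 for constants q_i and
   tau'' = 1/2 sum_i d_i^2 q_i^2 (f_i^(-2))'(tau), and it remains to solve this
   system with tau, u_i prescribed at 0 and 1.  When the functions f_i^(-2) are
   replaced by bounded ones (cut off outside a compact interval of I) this
   boundary value problem is variational: a discretized action is minimized, and
   the minimizers converge along an ultrafilter as the mesh goes to 0.
   The solution does not leave the region where nothing was modified.  Its energy
   tau'^2 - sum_i (d_i q_i)^2 f_i^(-2)(tau) is constant.  If it is nonnegative,
   tau is monotone.  If it is negative, consider an antiderivative G of
   sqrt(sum_i c_i^2 f_i^(-2)), with c_i = d_i q_i.  Reaching the level beta would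
   give G(beta) - G(tau(0)) < sum_i d_i c_i, whereas a future directed causal curve
   from the first point to the line of the second, whose fiber components have
   length at least d_i, forces the opposite inequality by Cauchy-Schwarz if beta
   lies above its end point.  Past directed curves bound tau from below. *)

(** * Limits of Euler schemes *)

(** A Lorentzian action is indefinite, so geodesics are not minimizers. For a fixed path tau,
    however, the best fiber parameters are explicit: with total increment 1, q_i is the inverse of
    the integral of f_i^(-2) along tau, and the i-th fiber energy becomes d_i^2 q_i. Up to sign,
    what remains is the integral of tau'^2 minus a sum that is bounded as soon as the f_i^(-2) are
    bounded below; this functional of tau alone is coercive. An upper bound on f_i^(-2) keeps q_i
    away from 0 in the limit. On a grid, minimization requires only the compactness of a box. Along
    an ultrafilter all bounded sequences converge at once, so neither function spaces nor extraction
    of subsequences enter. The cut-off has a price: its size must be fixed before the momenta of the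
    solution are known, so the barriers are established for all nonnegative c_i simultaneously. *)

Section DeriveLe.
Context {R : realType} {V : normedModType R}.

(** This form of the derivative has no quotient and only a non-strict inequality, so it can be
    obtained as a limit of discrete estimates. *)
Lemma is_derive1_le (Y : R -> V) (s : R) (rho : V) :
  (forall e : R, 0 < e -> \forall t \near s, `|Y t - Y s - (t - s) *: rho| <= e * `|t - s|) ->
  is_derive s (1 : R) Y rho.
Proof.
move=> H.
have Hs : h + s @[h --> (0:R)] --> s.
  by rewrite -[X in _ --> X]add0r; apply: cvgD; [exact: cvg_id|exact: cvg_cst].
have H2 : h^-1 *: (Y (h *: 1 + s) - Y s) @[h --> (0:R)^'] --> rho.
  apply/cvgrPdist_le => e e0; near=> h.
  have h0 : h != 0 by near: h; exact: nbhs_dnbhs_neq.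
  have -> : rho - h^-1 *: (Y (h *: 1 + s) - Y s) =
     - (h^-1 *: (Y (h *: 1 + s) - Y s - ((h *: 1 + s) - s) *: rho)).
    rewrite addrK -[h *: 1]/(h * 1) mulr1 [in RHS]scalerBr scalerA mulVf// scale1r opprB.
    by [].
  rewrite normrN normrZ normfV ler_pdivrMl ?normr_gt0//.
  have -> : `|h| * e = e * `|(h *: 1 + s) - s|.
    by rewrite addrK -[h *: 1]/(h * 1) mulr1 mulrC.
  rewrite -[h *: 1]/(h * 1) mulr1.
  by near: h; apply: nbhs_dnbhs; exact: (Hs _ (H e e0)).
apply: DeriveDef; first by apply/cvg_ex; exists rho.
exact: cvg_lim H2.
Unshelve. all: by end_near. Qed.

End DeriveLe.

Section EulerLimit.
Context {R : realType} (U : set_system nat) {UU : UltraFilter U} (Uoo : \oo `<=` U).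

(** The boundary values sit at the indices 0 and N+1; the other integers extend the limit functions
    beyond [0, 1]. *)
Definition node (N : nat) (k : int) : R := k%:~R / N.+1%:R.

Definition node_below (t : R) (N : nat) : int := Num.floor (t * N.+1%:R).

Lemma dist_node_below (t : R) N : `|node N (node_below t N) - t| <= N.+1%:R^-1.
Proof.
have N0 : 0 < N.+1%:R :> R by [].
have := floor_itv (t * N.+1%:R) => /andP[l u].
rewrite -/(node_below t N) in l u; rewrite /node.
rewrite intrD1 in u.
have E : t = t * N.+1%:R / N.+1%:R by rewrite mulfK ?gt_eqF.
rewrite {2}E -mulrBl normrM [X in _ * X]ger0_norm ?invr_ge0 ?(ltW N0)//.
rewrite ler_piMl ?invr_ge0 ?(ltW N0)// ler_norml; apply/andP; split; lra.
Qed.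

Lemma nearU_inv_lt (e : R) : 0 < e -> \forall N \near U, N.+1%:R^-1 < e.
Proof.
move=> e0; apply: Uoo; exact: near_infty_natSinv_lt (PosNum e0).
Qed.

Lemma cvg_node_below (t : R) : node N (node_below t N) @[N --> U] --> t.
Proof.
apply/cvgrPdist_le => e e0; near=> N.
rewrite distrC (le_trans (dist_node_below _ _))// ltW//.
near: N; exact: nearU_inv_lt.
Unshelve. all: by end_near. Qed.

(* The filter of the grid points close to s, as the mesh goes to 0. *)
Definition cell (s : R) : set_system (nat * int) :=
  [set A | exists2 d : R, 0 < d &
    \forall N \near U, forall k, `|node N k - s| < d -> A (N, k)].

Global Instance cell_filter s : Filter (cell s).
Proof.
split.
- by exists 1 => //; near=> N.
- move=> A B [d d0 HA] [e e0 HB]; exists (Num.min d e).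
    by rewrite lt_min d0.
  near=> N => k; rewrite lt_min => /andP[kd ke]; split.
  + by move: k kd {ke}; near: N.
  + by move: k ke {kd}; near: N.
- move=> A B AB [d d0 HA]; exists d => //; near=> N => k kd; apply: AB.
  by move: k kd; near: N.
Unshelve. all: by end_near. Qed.

Lemma cvg_cell_fst (T : topologicalType) (q : nat -> T) (l : T) s :
  q @ U --> l -> q nk.1 @[nk --> cell s] --> l.
Proof.
move=> ql A /ql UA; exists 1 => //; near=> N => k _ /=.
by near: N.
Unshelve. all: by end_near. Qed.

(** Compactness of a segment gives a cluster point, and a cluster point of an ultrafilter is a
    limit. *)
Lemma ultra_cvg_bounded (u : nat -> R) (B : R) :
  (forall N, `|u N| <= B) -> exists l : R, u @ U --> l.
Proof.
move=> uB.
have FB : (u @ U) [set` `[- B, B]%R].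
  by apply: nearW => N /=; rewrite in_itv/= -ler_norml.
have [l [_ ul]] := @segment_compact R (- B) B (u @ U) _ FB.
exists l => A Al; have [//|UA] := in_ultra_setVsetC (u @^-1` A) UU.
by have [x [/= ? ?]] := ul (~` A) A UA Al.
Unshelve. all: by end_near. Qed.

Section Scheme.
Variables (y r : nat -> int -> R).
Hypothesis yr : forall N k, y N (k + 1) = y N k + r N k / N.+1%:R.

(** A discrete mean value inequality, by telescoping; the disjunction covers both orders of [j] and
    [k]. With [rho = 0] it becomes a Lipschitz estimate. *)
Lemma euler_dist N (j k : int) (rho e : R) : 0 <= e ->
  (forall i, (j <= i < k) || (k <= i < j) -> `|r N i - rho| <= e) ->
  `|y N k - y N j - (node N k - node N j) * rho| <= e * `|node N k - node N j|.
Proof.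
move=> e0; have N0 : 0 < N.+1%:R :> R by [].
have H (l : int) (m : nat) :
    (forall i, (l <= i < l + m%:Z) -> `|r N i - rho| <= e) ->
  `|y N (l + m%:Z) - y N l - (node N (l + m%:Z) - node N l) * rho| <=
     e * `|node N (l + m%:Z) - node N l|.
  move=> H; rewrite [X in _ <= _ * X]ger0_norm; last first.
    by rewrite subr_ge0 ler_pM2r ?invr_gt0// ler_int lerDl.
  elim: m H => [|m IH] H; first by rewrite addr0 !subrr mul0r mulr0 subr0 normr0.
  have -> : l + m.+1%:Z = l + m%:Z + 1 by rewrite -addn1 PoszD addrA.
  have Hm : `|r N (l + m) - rho| <= e.
    by apply: H; rewrite lerDl ltrD2l ltz_nat leqnn andbT.
  have {H} HI : forall i : int, l <= i < l + m -> `|r N i - rho| <= e.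
    by move=> i /andP[li im]; apply: H; rewrite li (lt_trans im)// ltrD2l ltz_nat//.
  move: {IH HI}(IH HI).
  rewrite yr /node !intrD1.
  set A := y N (l + m%:Z) - y N l - _; set B := e * _ => AB.
  have -> : y N (l + m) + r N (l + m) / N.+1%:R - y N l -
    (((l + m)%:~R + 1) / N.+1%:R - l%:~R / N.+1%:R) * rho =
    A + (r N (l + m%:Z) - rho) / N.+1%:R.
    rewrite /A; set x := (l + m)%:~R; set z := N.+1%:R; ring.
  have -> : e * (((l + m)%:~R + 1) / N.+1%:R - l%:~R / N.+1%:R) = B + e / N.+1%:R.
    rewrite /B; set x := (l + m)%:~R; set z := N.+1%:R; ring.
  rewrite (le_trans (ler_normD _ _))// lerD// normrM.
  by rewrite [X in _ * X]ger0_norm ?invr_ge0 ?(ltW N0)// ler_wpM2r ?invr_ge0 ?(ltW N0).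
have exm (l h : int) : l <= h -> exists m : nat, h = l + m%:Z.
  by move=> lh; exists `|h - l|%N; rewrite gez0_abs ?subr_ge0// [RHS]addrC subrK.
move=> Hjk; have [/exm[m Em]|/ltW/exm[m Em]] := lerP j k.
  by rewrite Em in Hjk *; apply: H => i ij; apply: Hjk; rewrite ij.
rewrite [X in e * X]distrC -[X in X <= _]normrN.
rewrite Em in Hjk *; rewrite (le_trans _ (H k m _))//; last first.
  by move=> i ij; apply: Hjk; rewrite ij orbT.
by rewrite le_eqVlt; apply/orP; left; apply/eqP; congr `|_|; ring.
Qed.

Hypothesis r_bounded : forall T : R, exists2 L : R, 0 <= L &
  forall N k, `|node N k| <= T -> `|r N k| <= L.

Lemma node_le_bound (T : R) N (j k i : int) : `|node N j| <= T -> `|node N k| <= T ->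
  (j <= i < k) || (k <= i < j) -> `|node N i| <= T.
Proof.
have mono (x z : int) : x <= z -> node N x <= node N z.
  by move=> xz; rewrite /node ler_pM2r ?invr_gt0// ler_int.
rewrite !ler_norml => /andP[j1 j2] /andP[k1 k2] /orP[/andP[/mono a /ltW/mono b]|/andP[/mono a /ltW/mono b]];
  apply/andP; split; lra.
Qed.

Lemma euler_lipschitz (T : R) : exists2 L : R, 0 <= L &
  forall N j k, `|node N j| <= T -> `|node N k| <= T ->
    `|y N k - y N j| <= L * `|node N k - node N j|.
Proof.
have [L L0 rL] := r_bounded T; exists L => // N j k jT kT.
have := @euler_dist N j k 0 L L0; rewrite mulr0 subr0; apply => i ijk.
rewrite subr0; apply: rL; exact: node_le_bound ijk.
Qed.

Hypothesis y0 : exists B : R, forall N, `|y N 0| <= B.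

Lemma euler_ultra_cvg (t : R) : exists l : R, y N (node_below t N) @[N --> U] --> l.
Proof.
have [B yB] := y0.
have [L L0 yL] := euler_lipschitz (`|t| + 1).
have nb N : `|node N (node_below t N)| <= `|t| + 1.
  rewrite -[node _ _](subrK t) (le_trans (ler_normD _ _))// addrC lerD//.
  by rewrite (le_trans (dist_node_below _ _))// invf_le1// ler1n.
apply: (@ultra_cvg_bounded _ (B + L * (`|t| + 1))) => N.
have n0 : node N 0 = 0 by rewrite /node mul0r.
rewrite -(subrK (y N 0) (y N _)) (le_trans (ler_normD _ _))// addrC lerD//.
rewrite (le_trans (yL _ _ _ _ _))// ?n0 ?normr0 ?addr_ge0// subr0.
by rewrite ler_wpM2l.
Qed.

Variable Y : R -> R.
Hypothesis yY : forall t, y N (node_below t N) @[N --> U] --> Y t.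

(** The grid functions share a local Lipschitz constant, so convergence at the node below [s]
    controls all nearby nodes. This takes the place of the Arzela-Ascoli theorem. *)
Lemma euler_cvg_cell s : y nk.1 nk.2 @[nk --> cell s] --> Y s.
Proof.
have [L L0 yL] := euler_lipschitz (`|s| + 1).
apply/cvgrPdist_le => e e0.
(* Nodes within [d] of [s] are at most [2 * d] from the node below [s], which costs at most e/2, in
   addition to e/4 for the convergence at that node. [L + 1] avoids a division by 0. *)
pose d := Num.min 1 (e / (4 * (L + 1))).
have L1 : 0 < L + 1 by lra.
have d0 : 0 < d by rewrite lt_min ltr01 divr_gt0// mulr_gt0.
have dL : (L + 1) * d <= e / 4.
  have : d <= e / (4 * (L + 1)) by rewrite /d ge_min lexx orbT.
  rewrite -(ler_pM2l L1) => /le_trans; apply.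
  by rewrite le_eqVlt; apply/orP; left; apply/eqP; field; rewrite gt_eqF.
have d1 : d <= 1 by rewrite /d ge_min lexx.
have ev : \forall N \near U, `|Y s - y N (node_below s N)| <= e / 4.
  by have := (cvgrPdist_le _ _).1 (@yY s); apply; rewrite divr_gt0.
exists d => //; near=> N => k ks /=.
have Nd : N.+1%:R^-1 < d by near: N; exact: nearU_inv_lt.
have nbs := le_trans (dist_node_below s N) (ltW Nd).
have bnd x : `|x - s| <= d -> `|x| <= `|s| + 1.
  by move=> xs; rewrite -[x](subrK s) (le_trans (ler_normD _ _))// addrC lerD// (le_trans xs).
have := yL N (node_below s N) k (bnd _ nbs) (bnd _ (ltW ks)).
have H1 : `|node N k - node N (node_below s N)| <= 2 * d.
  move: nbs ks; rewrite ler_norml ltr_norml ler_norml => /andP[? ?] /andP[? ?].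
  by apply/andP; split; lra.
have H2 : `|Y s - y N (node_below s N)| <= e / 4.
  by near: N.
move=> H3.
have H4 : `|y N k - y N (node_below s N)| <= e / 2.
  apply: (le_trans H3).
  have : L * `|node N k - node N (node_below s N)| <= (L + 1) * (2 * d).
    by rewrite ler_pM// lerDl.
  lra.
move: H2 H4; rewrite !ler_norml => /andP[? ?] /andP[? ?].
by apply/andP; split; lra.
Unshelve. all: by end_near. Qed.

(** The discrete mean value inequality between the nodes below [s] and [t] passes to the limit.
    Taking [t] and the mesh within [d / 2] keeps all nodes in between within [d] of [s]. *)
Lemma euler_is_derive s (rho : R) : r nk.1 nk.2 @[nk --> cell s] --> rho ->
  is_derive s (1 : R) Y rho.
Proof.
move=> rs.
have key (e : R) : 0 < e -> \forall t \near s, `|Y t - Y s - (t - s) * rho| <= e * `|t - s|.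
  move=> e0.
  have [d d0 Hd] := (cvgrPdist_le _ _).1 rs e e0.
  near=> t.
  have td : `|t - s| < d / 2.
    rewrite distrC; near: t; apply: nbhsx_ballx; by rewrite divr_gt0.
  have nt := @cvg_node_below t; have ns := @cvg_node_below s.
  have c1 : `|y N (node_below t N) - y N (node_below s N) -
     (node N (node_below t N) - node N (node_below s N)) * rho| @[N --> U] -->
      `|Y t - Y s - (t - s) * rho|.
    apply: cvg_norm; apply: cvgB; first by apply: cvgB; exact: yY.
    by apply: cvgMl; apply: cvgB.
  have c2 : e * `|node N (node_below t N) - node N (node_below s N)| @[N --> U] -->
      e * `|t - s|.
    by apply: cvgMr; apply: cvg_norm; apply: cvgB.
  apply: (ler_cvg_to c1 c2); near=> N.
  have Nd : N.+1%:R^-1 < d / 2 by near: N; apply: nearU_inv_lt; rewrite divr_gt0.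
  apply: euler_dist; first exact: ltW.
  move=> i Hi; rewrite distrC.
  have : `|node N i - s| < d.
    have mono (x z : int) : x <= z -> node N x <= node N z.
      by move=> xz; rewrite /node ler_pM2r ?invr_gt0// ler_int.
    have := dist_node_below s N; have := dist_node_below t N.
    move: Nd; set iN := N.+1%:R^-1 => Nd.
    move: td; rewrite !ltr_norml !ler_norml => /andP[? ?] /andP[? ?] /andP[? ?].
    by move: Hi => /orP[/andP[/mono a /ltW/mono b]|/andP[/mono a /ltW/mono b]];
      apply/andP; split; lra.
  by move: i {Hi}; near: N.
exact: is_derive1_le.
Unshelve. all: by end_near. Qed.
End Scheme.
End EulerLimit.

(** * The discretized boundary value problem *)

Section PointwiseDerive.
Context {R : realType} {V : normedModType R}.
Implicit Types (x v : V) (f g : V -> R).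

Lemma is_deriveD_pt {W : normedModType R} (f g : V -> W) x v df dg :
  is_derive x v f df -> is_derive x v g dg -> is_derive x v (fun y => f y + g y) (df + dg).
Proof. exact: is_deriveD. Qed.

Lemma is_deriveB_pt {W : normedModType R} (f g : V -> W) x v df dg :
  is_derive x v f df -> is_derive x v g dg -> is_derive x v (fun y => f y - g y) (df - dg).
Proof. exact: is_deriveB. Qed.

Lemma is_deriveN_pt {W : normedModType R} (f : V -> W) x v df :
  is_derive x v f df -> is_derive x v (fun y => - f y) (- df).
Proof. exact: is_deriveN. Qed.

Lemma is_deriveM_pt f g x v (df dg : R) :
  is_derive x v f df -> is_derive x v g dg ->
  is_derive x v (fun y => f y * g y) (df * g x + f x * dg).
Proof.
move=> hf hg; apply: is_derive_eq (is_deriveM hf hg) _.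
by rewrite addrC; congr (_ + _); rewrite -[LHS]/(_ * _) mulrC.
Qed.

Lemma is_deriveMl_pt f x v (c df : R) :
  is_derive x v f df -> is_derive x v (fun y => c * f y) (c * df).
Proof. exact: (@is_deriveZ _ _ R). Qed.

Lemma is_derive_sqr_pt f x v (df : R) :
  is_derive x v f df -> is_derive x v (fun y => f y ^+ 2) (2 * f x * df).
Proof.
move=> hf; apply: is_derive_eq (is_deriveM_pt hf hf) _.
by rewrite mulrC -mulr2n mulr_natl mulrnAl.
Qed.

Lemma is_deriveV_pt f x v (df : R) : f x != 0 ->
  is_derive x v f df -> is_derive x v (fun y => (f y)^-1) (- (df / f x ^+ 2)).
Proof.
move=> fx0 [hf <-]; apply: DeriveDef; first exact: derivableV.
by rewrite deriveV// scaleNr mulrC.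
Qed.

Lemma is_derive_sum_pt {W : normedModType R} n (h : 'I_n -> V -> W) x v (dh : 'I_n -> W) :
  (forall i, is_derive x v (h i) (dh i)) ->
  is_derive x v (fun y => \sum_(i < n) h i y) (\sum_(i < n) dh i).
Proof.
move=> H; have -> : (fun y => \sum_(i < n) h i y) = \sum_(i < n) h i.
  by apply/funext => y; rewrite fct_sumE.
exact: is_derive_sum.
Qed.

End PointwiseDerive.

Lemma is_derive_continuous {R : realType} {W : normedModType R} (f : R -> W) (x : R) df :
  is_derive x (1 : R) f df -> {for x, continuous f}.
Proof. by move=> [/derivable1_diffP hf _]; exact: differentiable_continuous. Qed.

Lemma cvg_sum {R : realType} {W : normedModType R} (T : Type)
    (F : set_system T) (FF : Filter F) (I : Type) (r : seq I)
    (P : pred I) (h : I -> T -> W) (l : I -> W) :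
  (forall i, P i -> h i t @[t --> F] --> l i) ->
  \sum_(i <- r | P i) h i t @[t --> F] --> \sum_(i <- r | P i) l i.
Proof.
by move=> H; apply: cvg_big => //; exact: add_continuous.
Qed.

Lemma sum_delta {R : pzRingType} m (g : nat -> R) k : (k < m)%N ->
  \sum_(j < m) g j * (j == k :> nat)%:R = g k.
Proof.
move=> km; rewrite (bigD1 (Ordinal km))//= eqxx mulr1 big1 ?addr0// => j jk.
by rewrite (_ : _ == _ = false) ?mulr0//; apply/negbTE; exact: jk.
Qed.

Section DiscreteCritical.
Context {R : realType} (n : nat) (D : 'I_n -> R) (w w' : 'I_n -> R -> R) (lo : R).
Hypothesis D0 : forall i, 0 <= D i.
Hypothesis lo0 : 0 < lo.
Hypothesis wlo : forall i x, lo <= w i x.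
Hypothesis dw : forall i x, is_derive x (1 : R) (w i) (w' i x).

Definition mean m (x : nat -> R) i : R := m%:R^-1 * \sum_(j < m) w i (x j).

(* The Lagrangian is x'^2 minus the terms D_i / (mean of w_i): the conserved
   momenta q_i = 1 / (mean of w_i) have been eliminated, which turns the boundary
   conditions on the u_i into an unconstrained problem for x alone. *)
Definition discrete_action m (x : nat -> R) : R :=
  m%:R * (\sum_(j < m) (x j.+1 - x j) ^+ 2) - \sum_i D i * (mean m x i)^-1.

Lemma mean_ge m x i : (0 < m)%N -> lo <= mean m x i.
Proof.
move=> m0; have m0' : 0 < m%:R :> R by rewrite ltr0n.
rewrite /mean ler_pdivlMl// (le_trans (_ : _ <= \sum_(j < m) lo))//.
  by rewrite sumr_const card_ord mulr_natl.
by apply: ler_sum => j _.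
Qed.

Lemma eq_action m (x y : nat -> R) : (forall j, (j <= m)%N -> x j = y j) ->
  discrete_action m x = discrete_action m y.
Proof.
move=> xy; rewrite /discrete_action; congr (_ * _ - _).
  by apply: eq_bigr => j _; rewrite !xy// ltnW.
apply: eq_bigr => i _; congr (_ * (_ * _)^-1).
by apply: eq_bigr => j _; rewrite xy// ltnW.
Qed.

Lemma is_derive_action m (X : R -> nat -> R) (X' : nat -> R) (t : R) : (0 < m)%N ->
  (forall j, is_derive t (1 : R) (X^~ j) (X' j)) ->
  is_derive t (1 : R) (fun s => discrete_action m (X s))
    (m%:R * (\sum_(j < m) 2 * (X t j.+1 - X t j) * (X' j.+1 - X' j)) +
     \sum_i D i * (mean m (X t) i)^-1 ^+ 2 * (m%:R^-1 * \sum_(j < m) w' i (X t j) * X' j)).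
Proof.
move=> m0 dX; rewrite /discrete_action.
have d1 : is_derive t (1 : R) (fun s => m%:R * \sum_(j < m) (X s j.+1 - X s j) ^+ 2)
    (m%:R * (\sum_(j < m) 2 * (X t j.+1 - X t j) * (X' j.+1 - X' j))).
  apply: is_deriveMl_pt; apply: is_derive_sum_pt => j.
  by apply: is_derive_sqr_pt; exact: is_deriveB_pt.
have d2 i : is_derive t (1 : R) (fun s => mean m (X s) i)
    (m%:R^-1 * \sum_(j < m) w' i (X t j) * X' j).
  by apply: is_deriveMl_pt; exact: is_derive_sum_pt.
have d3 : is_derive t (1 : R) (fun s => \sum_i D i * (mean m (X s) i)^-1)
    (\sum_i D i * - ((m%:R^-1 * \sum_(j < m) w' i (X t j) * X' j) / mean m (X t) i ^+ 2)).
  apply: is_derive_sum_pt => i; apply: is_deriveMl_pt; apply: is_deriveV_pt => //.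
  by rewrite gt_eqF// (lt_le_trans lo0)// mean_ge.
apply: is_derive_eq (is_deriveB_pt d1 d3) _.
congr (_ + _); rewrite -sumrN; apply: eq_bigr => i _.
by rewrite mulrN opprK exprVn; ring.
Qed.

Lemma cvg_action (T : Type) (F : set_system T) (FF : Filter F) m (X : T -> nat -> R) (x : nat -> R) :
  (0 < m)%N -> (forall j, X t j @[t --> F] --> x j) ->
  discrete_action m (X t) @[t --> F] --> discrete_action m x.
Proof.
move=> m0 cc; apply: cvgB.
  apply: cvgMr; apply: cvg_sum => j _.
  by apply: (@cvgM _ _ F); apply: cvgB; exact: cc.
apply: cvg_sum => i _; apply: cvgMr; apply: cvgV.
  by rewrite gt_eqF// (lt_le_trans lo0)// mean_ge.
apply: cvgMr; apply: cvg_sum => j _.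
apply: continuous_cvg; first exact: is_derive_continuous (dw i _).
exact: cc.
Qed.

Lemma continuous_action m : (0 < m)%N ->
  continuous (fun v : 'rV[R]_m.+1 => discrete_action m (fun j => v 0 (inord j))).
Proof. by move=> m0 v; apply: (@cvg_action _ (nbhs v)) => // j; exact: coord_continuous. Qed.

(** The subtracted terms of the action lie between 0 and [C], so a minimizer over a box with pinned
    end points has increments bounded in advance. The box is chosen wide enough for the minimizer to
    be interior in the free coordinates, where the derivative vanishes. *)
Lemma discrete_critical m (a b : R) : (0 < m)%N -> exists x : nat -> R,
  [/\ x 0%N = a, x m = b & forall k, (0 < k < m)%N ->
    m%:R ^+ 2 * (x k.+1 - 2 * x k + x k.-1) =
    2^-1 * \sum_i D i * (mean m x i)^-1 ^+ 2 * w' i (x k)].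
Proof.
move=> m0; have m0' : 0 < m%:R :> R by rewrite ltr0n.
pose C := \sum_i D i / lo; pose E := (b - a) ^+ 2 + C.
have C0 : 0 <= C by apply: sumr_ge0 => i _; rewrite divr_ge0// ltW.
have E0 : 0 <= E by rewrite addr_ge0// sqr_ge0.
(* The first three terms dominate every coordinate of a minimizer; the final 1 leaves room for
   perturbations of size at most 1. *)
pose B : R := `|a| + `|b| + m%:R * (E + 1) + 1.
pose l (j : 'I_m.+1) := if j == 0 :> nat then a else if j == m :> nat then b else - B.
pose h (j : 'I_m.+1) := if j == 0 :> nat then a else if j == m :> nat then b else B.
pose A := [set v : 'rV[R]_m.+1 | forall j, [set` `[l j, h j]%R] (v 0 j)].
have cA : compact A.
  by apply: (@rV_compact R m.+1 (fun j => [set` `[l j, h j]%R])) => j; exact: segment_compact.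
(* The competitor makes the whole jump from [a] to [b] in its first step, so its kinetic term is
   [m%:R * (b - a) ^+ 2]. *)
pose v0 : 'rV[R]_m.+1 := \row_j (if j == 0 :> nat then a else b).
have B0 : 0 <= m%:R * (E + 1) by rewrite mulr_ge0 ?ltW// ltr_wpDl.
have Av0 : A v0.
  move=> j; rewrite /= in_itv/= /l /h mxE; case: ifP => _; first by rewrite lexx.
  case: ifP => _; first by rewrite lexx.
  by rewrite -ler_norml /B; have := normr_ge0 a; lra.
have [c /set_mem Ac cmin] := EVT_min_rV (ex_intro _ _ Av0) cA
  (continuous_subspaceT (continuous_action m0)).
pose x j := c 0 (inord j).
have x0 : x 0%N = a.
  have := Ac (inord 0); rewrite /= in_itv/= /l /h inordK//= => /andP[? ?].
  by apply/eqP; rewrite eq_le; apply/andP.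
have xm : x m = b.
  have := Ac (inord m); rewrite /= in_itv/= /l /h inordK//= eqxx gtn_eqF// => /andP[? ?].
  by apply/eqP; rewrite eq_le; apply/andP.
have dx2 j : (j < m)%N -> (x j.+1 - x j) ^+ 2 <= E.
  move=> jm; have := cmin v0 (mem_set Av0).
  rewrite /discrete_action.
  have : \sum_i D i * (mean m (fun j => c 0 (inord j)) i)^-1 <= C.
    apply: ler_sum => i _; rewrite ler_wpM2l// lef_pV2 ?posrE ?mean_ge//.
    by rewrite (lt_le_trans lo0)// mean_ge.
  have : 0 <= \sum_i D i * (mean m (fun j => v0 0 (inord j)) i)^-1.
    apply: sumr_ge0 => i _; rewrite mulr_ge0// invr_ge0.
    by rewrite (le_trans (ltW lo0))// mean_ge.
  have -> : \sum_(j0 < m) (v0 0 (inord j0.+1) - v0 0 (inord j0)) ^+ 2 = (b - a) ^+ 2.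
    rewrite (bigD1 (Ordinal m0))//= big1 ?addr0 ?mxE ?inordK//= => i i0.
    rewrite !mxE !inordK ?ltnS ?(ltnW (ltn_ord i))//= ?(ltn_ord i)//.
    by rewrite ifF ?subrr ?expr0n//; apply/negbTE; exact: i0.
  rewrite (bigD1 (Ordinal jm))//=.
  set S := \sum_(_ < m | _) _; have S0 : 0 <= S by apply: sumr_ge0 => i _; exact: sqr_ge0.
  rewrite -!/(x _); set d2 := (x j.+1 - x j) ^+ 2.
  set X := \sum_i _; set Y := \sum_i _ => Y0 XC H.
  have : m%:R * d2 <= m%:R * (b - a) ^+ 2 + C.
    have : 0 <= m%:R * S by rewrite mulr_ge0// ltW.
    rewrite mulrDr in H; lra.
  have : C <= m%:R * C by rewrite ler_peMl// ler1n.
  by move=> H1 H2; rewrite -(ler_pM2l m0') /E mulrDr; lra.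
(* [E + 1] dominates the square root of [E], so no root has to be introduced. *)
have dx j : (j < m)%N -> `|x j.+1 - x j| <= E + 1.
  move=> /dx2; rewrite -real_normK ?num_real// => H.
  have := normr_ge0 (x j.+1 - x j); nra.
have xB j : (j <= m)%N -> `|x j| <= `|a| + j%:R * (E + 1).
  elim: j => [|j IH] jm; first by rewrite x0 mul0r addr0.
  rewrite -(subrK (x j) (x j.+1)) (le_trans (ler_normD _ _))//.
  have := IH (ltnW jm); have := dx _ jm; rewrite -natr1 mulrDl mul1r; lra.
exists x; split => // k /andP[k0 km].
(* Only the interior coordinate [k] is varied; the vanishing derivative at [t = 0] is the
   Euler-Lagrange equation at that node. *)
pose X (t : R) j := x j + t * (j == k)%:R.
have dX (t : R) j : is_derive t (1 : R) (X^~ j) (j == k)%:R.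
  rewrite /X; apply: is_derive_eq.
  by rewrite add0r mul1r scaler0 add0r [_%:A]mulr1.
have crit := is_derive_action m0 (dX 0).
have dphi := fun t => is_derive_action m0 (dX t).
have /(_ _)[] := @derive1_at_min R (fun s => discrete_action m (X s)) (- 1) 1 0.
- lra.
- by move=> t _; case: (dphi t).
- by rewrite in_itv/=; apply/andP; split; lra.
- have X0 : X 0 = x by apply/funext => j; rewrite /X mul0r addr0.
  move=> t; rewrite in_itv/= X0 => /andP[t1 t2].
  have := cmin (\row_j X t j); rewrite -/x.
  rewrite (@eq_action m (fun j => (\row_j X t j) 0 (inord j)) (X t)); last first.
    by move=> j jm; rewrite mxE inordK.
  apply; apply/mem_set => j; rewrite /= in_itv/= mxE /l /h /X.
  case: ifPn => [/eqP->|j0].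
    by rewrite x0 ltn_eqF// mulr0 addr0 lexx.
  case: ifPn => [/eqP->|jm].
    by rewrite xm gtn_eqF// mulr0 addr0 lexx.
  rewrite -ler_norml (le_trans (ler_normD _ _))//.
  have jm' : (j <= m)%N by rewrite -ltnS.
  have H1 := xB _ jm'.
  have H2 : `|t * (j == k :> nat)%:R| <= 1.
    case: (_ == _); rewrite ?mulr1 ?mulr0 ?normr0// ler_norml; lra.
  have H3 : j%:R * (E + 1) <= m%:R * (E + 1) by rewrite ler_pM2r ?ler_nat// ltr_wpDl.
  by have := normr_ge0 b; rewrite /B; lra.
case: crit => _ -> _.
have X0 : X 0 = x by apply/funext => j; rewrite /X mul0r addr0.
rewrite X0 => H.
have k1m : (k.-1 < m)%N by rewrite (leq_ltn_trans (leq_pred k)).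
have S1 : \sum_(j < m) 2 * (x j.+1 - x j) * ((j.+1 == k)%:R - (j == k :> nat)%:R) =
  2 * (x k - x k.-1) - 2 * (x k.+1 - x k).
  under eq_bigr do rewrite mulrBr.
  rewrite sumrB (sum_delta (fun j => 2 * (x j.+1 - x j)))//.
  have -> : \sum_(j < m) 2 * (x j.+1 - x j) * (j.+1 == k)%:R =
     \sum_(j < m) 2 * (x j.+1 - x j) * (j == k.-1 :> nat)%:R.
    by apply: eq_bigr => j _; rewrite -[in RHS]eqSS prednK.
  by rewrite (sum_delta (fun j => 2 * (x j.+1 - x j)))// prednK.
have S2 : \sum_i D i * (mean m x i)^-1 ^+ 2 * (m%:R^-1 * \sum_(j < m) w' i (x j) * (j == k :> nat)%:R)
   = m%:R^-1 * \sum_i D i * (mean m x i)^-1 ^+ 2 * w' i (x k).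
  rewrite mulr_sumr; apply: eq_bigr => i _.
  by rewrite (sum_delta (fun j => w' i (x j)))//; ring.
rewrite S1 S2 in H.
set S := \sum_i _ in H *.
have SE : S = m%:R * (m%:R^-1 * S) by rewrite mulrA divff ?mul1r// gt_eqF.
rewrite SE; have -> : m%:R^-1 * S = - (m%:R * (2 * (x k - x k.-1) - 2 * (x k.+1 - x k))) by lra.
by field.
Qed.

End DiscreteCritical.

Section TwoSidedIteration.
Variables (T : Type) (next prev : T -> T) (s0 : T).
Hypothesis prevK : cancel prev next.

Definition orbit_int (k : int) : T :=
  match k with Posz j => iter j next s0 | Negz j => iter j.+1 prev s0 end.

Lemma orbit_intS k : orbit_int (k + 1) = next (orbit_int k).
Proof.
case: k => [j|[|j]]; first by rewrite -PoszD addn1.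
  by rewrite (_ : Negz 0 + 1 = 0)//= prevK.
by rewrite (_ : Negz j.+1 + 1 = Negz j) ?[RHS]prevK// !NegzE -addn1 PoszD opprD subrK.
Qed.

End TwoSidedIteration.

Section BoundaryValueProblem.
Context {R : realType} (n : nat) (D : 'I_n -> R) (w w' : 'I_n -> R -> R) (lo hi M : R).
Hypothesis D0 : forall i, 0 <= D i.
Hypothesis lo0 : 0 < lo.
Hypothesis wlo : forall i x, lo <= w i x.
Hypothesis whi : forall i x, w i x <= hi.
Hypothesis dw : forall i x, is_derive x (1 : R) (w i) (w' i x).
Hypothesis w'M : forall i x, `|w' i x| <= M.
Hypotheses (hi0 : 0 < hi) (M0 : 0 <= M).
Hypothesis w'c : forall i, continuous (w' i).

(* tau-component of the geodesic equation: D_i is the squared length of the i-th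
   geodesic, w_i = f_i^(-2) and q_i = f_i^2 u_i' is the conserved momentum. *)
Definition force (q : 'I_n -> R) (x : R) : R :=
  2^-1 * \sum_i D i * q i ^+ 2 * w' i x.

Let B := 2^-1 * \sum_i D i * lo^-1 ^+ 2 * M.

Lemma force_le q x : (forall i, 0 <= q i <= lo^-1) -> `|force q x| <= B.
Proof.
move=> ql; rewrite /force normrM ger0_norm ?invr_ge0// ler_wpM2l ?invr_ge0//.
rewrite (le_trans (ler_norm_sum _ _ _))//; apply: ler_sum => i _.
have /andP[q0 q1] := ql i.
rewrite normrM ger0_norm ?mulr_ge0 ?exprn_ge0//.
apply: ler_pM => //; first by rewrite mulr_ge0// exprn_ge0.
by rewrite ler_wpM2l// lerXn2r// nnegrE invr_ge0 ltW.
Qed.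

Section Step.
Variables (m : nat) (q : 'I_n -> R).

(* A semi-implicit Euler step: being invertible, it extends the discrete
   solution to all integers, so that the limit is defined near 0 and 1. *)
Definition step_next (s : R * R * ('I_n -> R)) : R * R * ('I_n -> R) :=
  let x := s.1.1 + s.1.2 / m%:R in
  (x, s.1.2 + force q x / m%:R, fun i => s.2 i + q i * w i s.1.1 / m%:R).

Definition step_prev (s : R * R * ('I_n -> R)) : R * R * ('I_n -> R) :=
  let p := s.1.2 - force q s.1.1 / m%:R in
  let x := s.1.1 - p / m%:R in
  (x, p, fun i => s.2 i - q i * w i x / m%:R).

Lemma step_prevK : cancel step_prev step_next.
Proof.
case=> [[x p] u]; rewrite /step_prev /step_next/= !subrK; congr (_, _).
by apply/funext => i; rewrite subrK.
Qed.

End Step.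

(** The Euler-Lagrange equation of the minimizer is the recursion of [step_next], so the orbit with
    the right initial velocity runs through the minimizer. The choice of [q] as the inverse of the
    mean makes each u_i grow by exactly 1. *)
Lemma discrete_solution (a b : R) : exists (y1 y2 : nat -> int -> R)
    (y3 : 'I_n -> nat -> int -> R) (q : nat -> 'I_n -> R),
  [/\ (forall N, y1 N 0 = a /\ y1 N N.+1 = b),
      (forall N i, y3 i N 0 = 0 /\ y3 i N N.+1 = 1),
      (forall N i, hi^-1 <= q N i <= lo^-1),
      (exists C, forall N, `|y2 N 0| <= C) &
   [/\ (forall N k, y1 N (k + 1) = y1 N k + y2 N k / N.+1%:R),
      (forall N k, y2 N (k + 1) = y2 N k + force (q N) (y1 N (k + 1)) / N.+1%:R) &
      (forall i N k, y3 i N (k + 1) = y3 i N k + q N i * w i (y1 N k) / N.+1%:R)]].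
Proof.
have [xs Hxs] := choice (fun N => @discrete_critical R n D w w' lo D0 lo0 wlo dw N.+1 a b isT).
pose q N i := (mean w N.+1 (xs N) i)^-1.
(* The initial velocity is the first difference quotient of the minimizer. *)
pose s0 N : R * R * ('I_n -> R) := (a, N.+1%:R * (xs N 1%N - a), fun=> 0).
pose S N := orbit_int (step_next N.+1 (q N)) (step_prev N.+1 (q N)) (s0 N).
have SS N k : S N (k + 1) = step_next N.+1 (q N) (S N k).
  by apply: orbit_intS; exact: step_prevK.
have qb N i : hi^-1 <= q N i <= lo^-1.
  have l1 : lo <= mean w N.+1 (xs N) i by exact: mean_ge.
  have l2 : mean w N.+1 (xs N) i <= hi.
    rewrite /mean ler_pdivrMl// (le_trans (_ : _ <= \sum_(j < N.+1) hi))//.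
      by apply: ler_sum => j _.
    by rewrite sumr_const card_ord mulr_natl.
  have l3 := lt_le_trans lo0 l1.
  by rewrite /q !lef_pV2 ?posrE// l1 l2.
have qb0 N i : 0 <= q N i <= lo^-1.
  by have /andP[l ->] := qb N i; rewrite andbT (le_trans _ l)// invr_ge0 ltW.
(* The equation holds at interior nodes only, so the induction stops at node [N]; one further step
   for position and u_i, in [bwd], reaches node [N.+1]. *)
have fwd N (j : nat) : (j < N.+1)%N -> [/\ (S N j).1.1 = xs N j,
    (S N j).1.2 = N.+1%:R * (xs N j.+1 - xs N j) &
    forall i, (S N j).2 i = q N i * (N.+1%:R^-1 * \sum_(l < j) w i (xs N l))].
  have [x0 xm xk] := Hxs N.
  elim: j => [|j IH] jm.
    by rewrite /S/= x0; split => // i; rewrite big_ord0 !mulr0.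
  have {IH}[I1 I2 I3] := IH (ltnW jm).
  have -> : (j.+1 : int) = j%:Z + 1 by rewrite -addn1 PoszD.
  have E1 : (S N (j%:Z + 1)).1.1 = xs N j.+1.
    by rewrite SS/= I1 I2 mulrAC divff// mul1r addrC subrK.
  rewrite SS in E1 *; split => //.
    move: E1; rewrite /step_next/= => ->; rewrite I2.
    have := xk j.+1; rewrite jm/= => /(_ isT) H.
    rewrite -[force _ _]H.
    by have : N.+1%:R != 0 :> R; [|move: (N.+1%:R) => z z0; field].
  by move=> i; rewrite /step_next/= I3 I1 big_ord_recr/= !mulrDr; congr (_ + _); ring.
have bwd N : [/\ (S N 0).1.1 = a, (S N N.+1).1.1 = b &
    forall i, (S N 0).2 i = 0 /\ (S N N.+1).2 i = 1].
  have [x0 xm xk] := Hxs N.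
  have [I1 I2 I3] := fwd N N (leqnn _).
  have -> : (N.+1 : int) = N%:Z + 1 by rewrite -addn1 PoszD.
  rewrite SS; split => //.
    by rewrite /step_next/= I1 I2 -xm mulrAC divff// mul1r addrC subrK.
  move=> i; split => //; rewrite /step_next/= I3 I1 /q.
  have -> : (mean w N.+1 (xs N) i)^-1 * (N.+1%:R^-1 * \sum_(l < N) w i (xs N l)) +
     (mean w N.+1 (xs N) i)^-1 * w i (xs N N) / N.+1%:R =
     (mean w N.+1 (xs N) i)^-1 * mean w N.+1 (xs N) i.
    by rewrite {4}/mean big_ord_recr/= !mulrDr; congr (_ + _); ring.
  by rewrite mulVf// gt_eqF// (lt_le_trans lo0)// mean_ge.
exists (fun N k => (S N k).1.1), (fun N k => (S N k).1.2), (fun i N k => (S N k).2 i), q.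
have st2 : forall N k, (S N (k + 1)).1.2 = (S N k).1.2 + force (q N) (S N (k + 1)).1.1 / N.+1%:R.
  by move=> N k; rewrite SS.
have st1 : forall N k, (S N (k + 1)).1.1 = (S N k).1.1 + (S N k).1.2 / N.+1%:R.
  by move=> N k; rewrite SS.
split => //.
- by move=> N; have [] := bwd N.
- by move=> N i; have [_ _] := bwd N; exact.
(* The velocity varies by at most [B] over [0, 1] while its average is [b - a]; this bounds the
   initial velocity independently of the mesh. *)
- have B0 : 0 <= B.
    rewrite /B mulr_ge0 ?invr_ge0// sumr_ge0// => i _.
    by rewrite !mulr_ge0 ?exprn_ge0 ?invr_ge0// ltW.
  exists (`|b - a| + B) => N.
  have n0 : node N 0 = 0 :> R by rewrite /node mul0r.
  have n1 : node N N.+1 = 1 :> R by rewrite /node -[(N.+1 : int)%:~R]/(N.+1%:R : R) divff ?pnatr_eq0.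
  have H2 (k : int) : 0 <= k < N.+1 -> `|(S N k).1.2 - (S N 0).1.2| <= B.
    move=> /andP[k0 k1].
    have nk : `|node N k| <= 1 :> R.
      rewrite /node normrM ger0_norm ?ler0z// [X in _ * X]ger0_norm ?invr_ge0//.
      by rewrite ler_pdivrMr// mul1r -[leRHS]/((N.+1 : int)%:~R) ler_int ltW.
    have := @euler_dist R _ _ st2 N 0 k 0 B B0.
    rewrite n0 !subr0 mulr0 subr0 => /(_ _)/le_trans -> //.
      by move=> i _; rewrite subr0 force_le.
    by rewrite ler_piMr.
  have := @euler_dist R _ _ st1 N 0 N.+1 (S N 0).1.2 B B0.
  have [-> -> _] := bwd N.
  rewrite n0 n1 subr0 mul1r normr1 mulr1 => /(_ _) H.
  rewrite -[X in `|X|](subKr (b - a)) (le_trans (ler_normB _ _))// lerD2l H//.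
  by move=> i /orP[//|/andP[Ni i0]]; [apply: H2|have := le_lt_trans Ni i0].
- by split => // i N k; rewrite SS.
Qed.

(** All three recursions are Euler schemes with locally bounded rates, and the rates converge along
    [cell] because they are continuous in quantities that do. *)
Lemma bvp_exists (a b : R) : exists (tau p : R -> R) (u : 'I_n -> R -> R) (q : 'I_n -> R),
  [/\ forall i, 0 < q i,
      [/\ tau 0 = a, tau 1 = b & forall i, u i 0 = 0 /\ u i 1 = 1],
      forall t, is_derive t (1 : R) tau (p t),
      forall t, is_derive t (1 : R) p (force q (tau t)) &
      forall i t, is_derive t (1 : R) (u i) (q i * w i (tau t))].
Proof.
have [y1 [y2 [y3 [q [y1b y3b qb [C y2C] [st1 st2 st3]]]]]] := discrete_solution a b.
have [U [UU Uoo]] := ultraFilterLemma eventually_filter.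
have qb0 N i : 0 <= q N i <= lo^-1.
  by have /andP[l ->] := qb N i; rewrite andbT (le_trans _ l)// invr_ge0 ltW.
have B0 : 0 <= B.
  rewrite /B mulr_ge0 ?invr_ge0// sumr_ge0// => i _.
  by rewrite !mulr_ge0 ?exprn_ge0 ?invr_ge0// ltW.
have r2b (T : R) : exists2 L : R, 0 <= L & forall N k, `|node N k| <= T ->
    `|force (q N) (y1 N (k + 1))| <= L.
  by exists B => // N k _; apply: force_le.
have n0 N : node N 0 = 0 :> R by rewrite /node mul0r.
have r1b (T : R) : exists2 L : R, 0 <= L & forall N k, `|node N k| <= T -> `|y2 N k| <= L.
  exists (`|C| + B * `|T|) => [|N k kT]; first by rewrite addr_ge0// mulr_ge0.
  have := @euler_dist R _ _ st2 N 0 k 0 B B0.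
  rewrite mulr0 subr0 n0 subr0 => /(_ _) H.
  rewrite -[y2 N k](subrK (y2 N 0)) (le_trans (ler_normD _ _))// addrC lerD//.
    by rewrite (le_trans (y2C N))// ler_norm.
  rewrite (le_trans (H _))//.
    by move=> i _; rewrite subr0 force_le.
  by rewrite ler_wpM2l// (le_trans kT)// ler_norm.
have r3b i (T : R) : exists2 L : R, 0 <= L & forall N k, `|node N k| <= T ->
    `|q N i * w i (y1 N k)| <= L.
  exists (lo^-1 * hi) => [|N k _]; first by rewrite mulr_ge0 ?invr_ge0// ltW.
  have /andP[q0 q1] := qb0 N i; have w0 := le_trans (ltW lo0) (wlo i (y1 N k)).
  by rewrite normrM !ger0_norm// ler_pM.
have b1 : exists B : R, forall N, `|y1 N 0| <= B by exists `|a| => N; have [-> _] := y1b N.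
have b2 : exists B : R, forall N, `|y2 N 0| <= B by exists C.
have b3 i : exists B : R, forall N, `|y3 i N 0| <= B.
  by exists 0 => N; have [-> _] := y3b N i; rewrite normr0.
have [tau Htau] := choice (euler_ultra_cvg st1 r1b b1).
have [p Hp] := choice (euler_ultra_cvg st2 r2b b2).
have Hu' i : exists ui : R -> R, forall t, y3 i N (node_below t N) @[N --> U] --> ui t.
  by have [ui H] := choice (euler_ultra_cvg (st3 i) (r3b i) (b3 i)); exists ui.
have [u Hu] := choice Hu'.
have qu i : exists l : R, q N i @[N --> U] --> l.
  apply: (@ultra_cvg_bounded R U UU _ lo^-1) => N.
  by have /andP[q0 q1] := qb0 N i; rewrite ger0_norm.
have [ql Hq] := choice qu.
have c1 s : y1 nk.1 nk.2 @[nk --> cell U s] --> tau s.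
  exact: (euler_cvg_cell Uoo st1 r1b Htau).
have c2 s : y2 nk.1 nk.2 @[nk --> cell U s] --> p s.
  exact: (euler_cvg_cell Uoo st2 r2b Hp).
(* The force is evaluated at the next node; the shift is the velocity times the mesh and disappears
   in the limit. *)
have c1' s : y1 nk.1 (nk.2 + 1) @[nk --> cell U s] --> tau s.
  have H : y1 nk.1 nk.2 + y2 nk.1 nk.2 / nk.1.+1%:R @[nk --> cell U s] --> tau s + p s * 0.
    apply: cvgD; first exact: c1.
    apply: cvgM; first exact: c2.
    apply: (cvg_cell_fst (q := fun N : nat => N.+1%:R^-1 : R)).
    apply/cvgrPdist_le => e e0; apply: filterS (nearU_inv_lt Uoo e0) => N Ne.
    by rewrite sub0r normrN ger0_norm ?invr_ge0// ltW.
  by rewrite mulr0 addr0 in H; under eq_cvg do rewrite st1.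
(* Positivity survives the limit thanks to the uniform lower bound [hi^-1]. *)
have q0 i : 0 < ql i.
  have h1 : 0 < hi^-1 by rewrite invr_gt0.
  apply: (lt_le_trans h1); apply: (cvgr_to_ge (Hq i)).
  by apply: nearW => N; have /andP[] := qb N i.
exists tau, p, u, ql; split => //.
(* The nodes below 0 and 1 are exactly 0 and 1 for every mesh, so the boundary values are constant
   sequences. *)
- have nb0 N : node_below (0 : R) N = 0 by rewrite /node_below mul0r floor0.
  have nb1 N : node_below (1 : R) N = N.+1.
    by rewrite /node_below mul1r -[X in Num.floor X]/((N.+1 : int)%:~R) intrKfloor.
  have lim_cst (y : nat -> R) (l c : R) : y N @[N --> U] --> l -> (forall N, y N = c) -> l = c.
    move=> yl yc; apply/eqP; rewrite eq_le; apply/andP; split.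
      by apply: (cvgr_to_le yl); apply: nearW => N; rewrite yc.
    by apply: (cvgr_to_ge yl); apply: nearW => N; rewrite yc.
  split.
  + by apply: (lim_cst _ _ _ (Htau 0)) => N; rewrite nb0; have [] := y1b N.
  + by apply: (lim_cst _ _ _ (Htau 1)) => N; rewrite nb1; have [] := y1b N.
  + move=> i; split.
      by apply: (lim_cst _ _ _ (Hu i 0)) => N; rewrite nb0; have [] := y3b N i.
    by apply: (lim_cst _ _ _ (Hu i 1)) => N; rewrite nb1; have [] := y3b N i.
- by move=> t; apply: (euler_is_derive Uoo st1 Htau (@c2 t)).
- move=> t; apply: (euler_is_derive Uoo st2 Hp).
  rewrite /force; apply: cvgMr; apply: cvg_sum => i _.
  apply: cvgM.
    by apply: cvgMr; apply: (@cvgM _ _ (cell U t)); apply: cvg_cell_fst (Hq i).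
  apply: continuous_cvg; first exact: w'c.
  exact: c1'.
- move=> i t; apply: (euler_is_derive Uoo (st3 i) (Hu i)).
  apply: cvgM; first by apply: cvg_cell_fst (Hq i).
  apply: continuous_cvg; first exact: is_derive_continuous (dw i _).
  exact: c1.
Qed.

End BoundaryValueProblem.

(** * Confinement *)

Section MeanValue.
Context {R : realType}.

Lemma derive_mvt (f df : R -> R) (a b : R) : a < b ->
  (forall t, a <= t <= b -> is_derive t (1 : R) f (df t)) ->
  exists2 c, a < c < b & f b - f a = df c * (b - a).
Proof.
move=> ab H.
have [||c /itvP cab E] := @MVT R f df a b ab.
- by move=> x /itvP xab; apply: H; rewrite !xab.
- apply: derivable_within_continuous => x /itvP xab.
  by have [] := H x; rewrite ?xab.
by exists c => //; rewrite !cab.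
Qed.

Lemma derive_ge0_le (f df : R -> R) (a b : R) : a <= b ->
  (forall t, a <= t <= b -> is_derive t (1 : R) f (df t)) ->
  (forall t, a <= t <= b -> 0 <= df t) -> f a <= f b.
Proof.
rewrite le_eqVlt => /predU1P[->//|ab] H H0.
have [c /andP[ac cb] E] := derive_mvt ab H.
by rewrite -subr_ge0 E mulr_ge0 ?H0 ?(ltW ac) ?(ltW cb)// subr_ge0 ltW.
Qed.

Lemma derive_lt0_lt (f df : R -> R) (a b : R) : a < b ->
  (forall t, a <= t <= b -> is_derive t (1 : R) f (df t)) ->
  (forall t, a <= t <= b -> df t < 0) -> f b < f a.
Proof.
move=> ab H H0; have [c /andP[ac cb] E] := derive_mvt ab H.
by rewrite -subr_lt0 E nmulr_rlt0 ?subr_gt0// H0// (ltW ac) (ltW cb).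
Qed.

Lemma derive_ivt (f df : R -> R) (a b v : R) :
  (forall t, is_derive t (1 : R) f (df t)) ->
  (f a <= v <= f b) || (f b <= v <= f a) -> a <= b ->
  exists2 c, a <= c <= b & f c = v.
Proof.
move=> H Hv ab.
have cf : {within `[a, b], continuous f}.
  by apply: derivable_within_continuous => x _; case: (H x).
have [|c /itvP cab E] := @IVT R f a b v ab cf.
  by rewrite ge_min le_max; case/orP: Hv => /andP[-> ->]; rewrite ?orbT.
by exists c => //; rewrite !cab.
Qed.

Lemma antiderivative_exists (g : R -> R) (a b : R) :
  (forall x, a <= x <= b -> {for x, continuous g}) ->
  exists G : R -> R, forall x, a < x < b -> is_derive x (1 : R) G (g x).
Proof.
move=> cg.
exists (fun x => \int[lebesgue_measure]_(t in [set` `[a, x]]) g t)%R => x /andP[ax xb].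
have ig : lebesgue_measure.-integrable `[a, b] (EFin \o g).
  apply: continuous_compact_integrable; first exact: segment_compact.
  by apply: continuous_in_subspaceT => y /set_mem /= /itvP yab; apply: cg; rewrite !yab.
have [dG EG] := @continuous_FTC1_closed R g a x b xb ig ax
  (cg x (introT andP (conj (ltW ax) (ltW xb)))).
by apply: DeriveDef; [exact: dG|rewrite -EG derive1E].
Qed.

Lemma compact_itv_bounded (n : nat) (g : 'I_n -> R -> R) (a b : R) :
  (forall i x, a <= x <= b -> {for x, continuous (g i)}) ->
  exists2 K : R, 0 < K & forall i x, a <= x <= b -> `|g i x| <= K.
Proof.
move=> cg.
have Hi i : exists K : R, 0 <= K /\ forall x, a <= x <= b -> `|g i x| <= K.
  have [ba|ab] := ltP b a.
    by exists 0; split => // x /andP[ax xb]; have := le_lt_trans (le_trans ax xb) ba; rewrite ltxx.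
  have [|c _ Hc] := @EVT_max R (fun x => `|g i x|) a b ab.
    apply: continuous_in_subspaceT => x /set_mem /= /itvP xab.
    by apply: cvg_norm; apply: cg; rewrite !xab.
  by exists `|g i c|; split => // x xab; apply: Hc; rewrite in_itv.
have [K HK] := choice Hi.
exists (1 + \sum_i K i).
  by rewrite ltr_wpDr// sumr_ge0// => i _; have [] := HK i.
move=> i x xab; have [_ /(_ x xab)/le_trans] := HK i; apply.
rewrite (bigD1 i)//= addrCA lerDl addr_ge0// sumr_ge0// => j _.
by have [] := HK j.
Qed.

End MeanValue.

(** * A C^1 cut-off of the real line *)

Section Cutoff.
Context {R : realType}.

(** A convex building block that is C^1 but piecewise quadratic, so that its estimates reduce to
    polynomial arithmetic. *)
Definition sqr_pos (x : R) : R := Num.max 0 x ^+ 2.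

Lemma is_derive_sqr_pos (x : R) : is_derive x (1 : R) sqr_pos (2 * Num.max 0 x).
Proof.
apply: is_derive1_le => e e0; near=> t.
have te : `|t - x| <= e by apply: ltW; rewrite distrC; near: t; exact: nbhsx_ballx.
apply: (@le_trans _ _ (`|t - x| * `|t - x|)); last by rewrite ler_wpM2r.
rewrite -expr2 real_normK ?num_real// /sqr_pos.
rewrite -[_ *: _]/(_ * _) /Num.max; move: (sqr_ge0 t) (sqr_ge0 x) => t2 x2.
case: (ltP 0 t) => ht; case: (ltP 0 x) => hx; rewrite ler_norml; apply/andP; split.
- have -> : t ^+ 2 - x ^+ 2 - (t - x) * (2 * x) = (t - x) ^+ 2 by ring.
  by rewrite lerNl (le_trans _ (sqr_ge0 _))// oppr_le0 sqr_ge0.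
- lra.
- nra.
- have := mulr_ge0_le0 (ltW ht) hx; nra.
- have := mulr_le0_ge0 ht (ltW hx); nra.
- nra.
- by rewrite expr0n/= !subr0 mulr0 mulr0 subr0 oppr_le0 sqr_ge0.
- by rewrite expr0n/= !subr0 mulr0 mulr0 subr0 sqr_ge0.
Unshelve. all: by end_near. Qed.

Variables (a b e : R).

(* A C^1 function equal to the identity on [a, b], with values in [a - e, b + e]. *)
Definition cutoff (x : R) : R := x - (2 * e)^-1 *
  ((sqr_pos (x - b) - sqr_pos (x - (b + e))) - (sqr_pos (a - x) - sqr_pos (a - e - x))).

(** Piecewise linear: the slope is 1 on [a, b], falls linearly to 0 over a distance [e] on either
    side and stays 0 beyond. *)
Definition cutoff' (x : R) : R := 1 - e^-1 *
  ((Num.max 0 (x - b) - Num.max 0 (x - (b + e))) + (Num.max 0 (a - x) - Num.max 0 (a - e - x))).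

Hypotheses (ab : a <= b) (e0 : 0 < e).

Lemma is_derive_cutoff x : is_derive x (1 : R) cutoff (cutoff' x).
Proof.
have dr c : is_derive x (1 : R) (fun y => sqr_pos (y - c)) (2 * Num.max 0 (x - c)).
  have := @is_derive1_comp _ sqr_pos (fun y => y - c) x _ _ (is_derive_sqr_pos _)
    (is_deriveB_pt (is_derive_id _ _) (is_derive_cst _ _ _)).
  by rewrite subr0 mulr1.
have dl c : is_derive x (1 : R) (fun y => sqr_pos (c - y)) (- (2 * Num.max 0 (c - x))).
  have := @is_derive1_comp _ sqr_pos (fun y => c - y) x _ _ (is_derive_sqr_pos _)
    (is_deriveB_pt (is_derive_cst _ _ _) (is_derive_id _ _)).
  by rewrite sub0r mulrN1.
apply: is_derive_eq (is_deriveB_pt (is_derive_id _ _) (is_deriveMl_pt _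
  (is_deriveB_pt (is_deriveB_pt (dr b) (dr (b + e))) (is_deriveB_pt (dl a) (dl (a - e)))))) _.
by rewrite /cutoff'; field; rewrite gt_eqF.
Qed.

Lemma cutoff_id x : a <= x <= b -> cutoff x = x.
Proof.
move=> /andP[ax xb]; have e0' := e0; rewrite /cutoff /sqr_pos !max_l ?subrr ?mulr0 ?subr0//; lra.
Qed.

Lemma cutoff'_id x : a <= x <= b -> cutoff' x = 1.
Proof.
move=> /andP[ax xb]; have e0' := e0; rewrite /cutoff' !max_l ?subrr ?addr0 ?mulr0 ?subr0//; lra.
Qed.

Lemma cutoff_bounds x : a - e <= cutoff x <= b + e.
Proof.
rewrite /cutoff.
set S := (_ - _) - _; have [e0' ab'] := (e0, ab); have e2 : 0 < 2 * e by lra.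
have -> : x - (2 * e)^-1 * S = (2 * e)^-1 * (2 * e * x - S) by field; rewrite gt_eqF.
rewrite ler_pdivlMl// ler_pdivrMl// /S /sqr_pos /Num.max.
by repeat (case: ifPn; rewrite -?leNgt => ?); apply/andP; split; nra.
Qed.

Lemma cutoff'_bounds x : `|cutoff' x| <= 1.
Proof.
have -> : cutoff' x = e^-1 * (e -
    ((Num.max 0 (x - b) - Num.max 0 (x - (b + e))) + (Num.max 0 (a - x) - Num.max 0 (a - e - x)))).
  by rewrite /cutoff'; field; rewrite gt_eqF.
have [e0' ab'] := (e0, ab).
rewrite normrM ger0_norm ?invr_ge0 ?(ltW e0)// ler_pdivrMl// mulr1 /Num.max.
by repeat (case: ifPn; rewrite -?leNgt => ?); rewrite ler_norml; apply/andP; split; lra.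
Qed.

Lemma continuous_cutoff' : continuous cutoff'.
Proof.
move=> x; rewrite /cutoff'.
have cm (g : R -> R) : {for x, continuous g} -> (Num.max 0 (g y)) @[y --> x] --> Num.max 0 (g x).
  by move=> cg; apply: continuous_max => //; exact: cvg_cst.
apply: cvgB; first exact: cvg_cst.
apply: cvgMr; apply: cvgD; apply: cvgB; apply: cm; apply: cvgB; (exact: cvg_cst || exact: cvg_id).
Qed.

End Cutoff.

(** * Conservation of energy and barriers *)

Section Confinement.
Context {R : realType} (n : nat) (d : 'I_n -> R) (w w' : 'I_n -> R -> R).
Variables (tau p : R -> R) (u : 'I_n -> R -> R) (q : 'I_n -> R) (t0 t1 : R).
Hypothesis d0 : forall i, 0 <= d i.
Hypothesis w0 : forall i x, 0 < w i x.
Hypothesis dw : forall i x, is_derive x (1 : R) (w i) (w' i x).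
Hypothesis q0 : forall i, 0 < q i.
Hypotheses (tau0 : tau 0 = t0) (tau1 : tau 1 = t1).
Hypothesis u01 : forall i, u i 0 = 0 /\ u i 1 = 1.
Hypothesis dtau : forall t, is_derive t (1 : R) tau (p t).
Hypothesis dp : forall t, is_derive t (1 : R) p (force (fun i => d i ^+ 2) w' q (tau t)).
Hypothesis du : forall i t, is_derive t (1 : R) (u i) (q i * w i (tau t)).

Let W x := \sum_i (d i * q i) ^+ 2 * w i x.

Lemma potential_ge0 x : 0 <= W x.
Proof. by apply: sumr_ge0 => i _; rewrite mulr_ge0 ?sqr_ge0// ltW. Qed.

(** [force] is half the derivative of the potential [W]. *)
Lemma energy_cst s t : p s ^+ 2 - W (tau s) = p t ^+ 2 - W (tau t).
Proof.
apply: (@is_derive_0_is_cst _ (fun t => p t ^+ 2 - W (tau t))) => x.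
have dW : is_derive x (1 : R) (fun t => W (tau t)) (\sum_i (d i * q i) ^+ 2 * (p x * w' i (tau x))).
  apply: is_derive_sum_pt => i; apply: is_deriveMl_pt.
  by apply: is_derive_eq (@is_derive1_comp _ (w i) tau x _ _ _ _) _; rewrite mulrC.
apply: is_derive_eq (is_deriveB_pt (is_derive_sqr_pt (dp x)) dW) _.
rewrite /force; apply/eqP; rewrite subr_eq0; apply/eqP.
rewrite mulrA [X in X * _](_ : _ = p x); last by field.
by rewrite mulr_sumr; apply: eq_bigr => i _; rewrite exprMn; ring.
Qed.

(** If the velocity has a zero, nonnegative energy forces [W] to vanish there. Since all w_i are
    positive, every d_i q_i is then 0, so [W] vanishes identically and the velocity is 0 throughout.
    Without a zero the intermediate value theorem applies. *)
Lemma same_sign : 0 <= p 0 ^+ 2 - W (tau 0) ->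
  (forall t, 0 <= t <= 1 -> 0 <= p t) \/ (forall t, 0 <= t <= 1 -> p t <= 0).
Proof.
move=> E0.
have [z|nz] := pselect (exists z, p z = 0); last first.
  have [p0|p0] := leP 0 (p 0).
    left=> t /andP[t0' _]; rewrite leNgt; apply/negP => pt; apply: nz.
    have [|c _ pc] := derive_ivt (v := 0) dp _ t0'; last by exists c.
    by rewrite (ltW pt) p0 orbT.
  right=> t /andP[t0' _]; rewrite leNgt; apply/negP => pt; apply: nz.
  have [|c _ pc] := derive_ivt (v := 0) dp _ t0'; last by exists c.
  by rewrite (ltW pt) (ltW p0).
have [z0 pz] := z.
have := energy_cst 0 z0; rewrite pz expr0n/= sub0r => Ez.
have Wz : W (tau z0) = 0.
  by have := potential_ge0 (tau z0); move: E0; rewrite Ez; lra.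
have dq i : (d i * q i) ^+ 2 = 0.
  have := Wz; rewrite /W => /eqP; rewrite psumr_eq0; last first.
    by move=> j _; rewrite mulr_ge0 ?sqr_ge0// ltW.
  by move=> /allP/(_ i (mem_index_enum i)); rewrite mulf_eq0 (gt_eqF (w0 _ _)) orbF => /eqP.
have W00 x : W x = 0 by apply: big1 => i _; rewrite dq mul0r.
left => t _; have := energy_cst t z0; rewrite !W00 pz expr0n/= !subr0 => /eqP.
by rewrite expf_eq0/= => /eqP->.
Qed.

Lemma monotone_confined (al be : R) : 0 <= p 0 ^+ 2 - W (tau 0) ->
  al < t0 < be -> al < t1 < be -> forall t, 0 <= t <= 1 -> al < tau t < be.
Proof.
move=> E0 /andP[a0 b0] /andP[a1 b1] t /andP[t0' t1'].
have [P|P] := same_sign E0.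
  have H1 : tau 0 <= tau t.
    apply: (derive_ge0_le t0' (fun x _ => dtau x)) => x /andP[x0 x1].
    by apply: P; rewrite x0 (le_trans x1).
  have H2 : tau t <= tau 1.
    apply: (derive_ge0_le t1' (fun x _ => dtau x)) => x /andP[x0 x1].
    by apply: P; rewrite x1 (le_trans _ x0).
  by rewrite tau0 in H1; rewrite tau1 in H2; apply/andP; split; lra.
have H1 : - tau 0 <= - tau t.
  apply: (derive_ge0_le t0' (fun x _ => is_deriveN_pt (dtau x))) => x /andP[x0 x1].
  by rewrite oppr_ge0; apply: P; rewrite x0 (le_trans x1).
have H2 : - tau t <= - tau 1.
  apply: (derive_ge0_le t1' (fun x _ => is_deriveN_pt (dtau x))) => x /andP[x0 x1].
  by rewrite oppr_ge0; apply: P; rewrite x1 (le_trans _ x0).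
by rewrite tau0 in H1; rewrite tau1 in H2; apply/andP; split; lra.
Qed.

Lemma u_le1 i t : 0 <= t <= 1 -> u i t <= 1.
Proof.
move=> /andP[_ t1']; have [_ <-] := u01 i.
by apply: (derive_ge0_le t1' (fun x _ => du i x)) => x _; rewrite mulr_ge0// ltW.
Qed.

(* When the energy is negative, |tau'| < sqrt (W tau), so that the path needs
   more than its total budget sum_i d_i c_i to travel from t0 to v. *)
Lemma barrier (s v : R) (t : R) : `|s| = 1 -> p 0 ^+ 2 - W (tau 0) < 0 -> v != t0 ->
  (forall G : R -> R,
    (forall x, (t0 <= x <= v) || (v <= x <= t0) -> is_derive x (1 : R) G (Num.sqrt (W x))) ->
    \sum_i d i * (d i * q i) <= s * (G v - G t0)) ->
  0 <= t <= 1 -> tau t <> v.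
Proof.
move=> s1 E0 v0 HG /andP[t0' t1'] tv.
have tgt0 : 0 < t.
  rewrite lt_neqAle t0' andbT; apply/eqP => t00; move: v0.
  by rewrite -tv -t00 tau0 eqxx.
have cW : continuous (fun x => Num.sqrt (W x)).
  move=> x; apply: (@continuous_comp _ _ _ W Num.sqrt); last exact: sqrt_continuous.
  apply: cvg_sum => i _; apply: cvgMr; exact: is_derive_continuous (dw i x).
(* The path may leave the segment between [t0] and [v] before time [t], so the antiderivative is
   taken on an interval containing the whole path. *)
have [|A A0 HA] := @compact_itv_bounded R 1 (fun=> tau) 0 1.
  by move=> _ x _; exact: is_derive_continuous (dtau x).
have {}HA x : 0 <= x <= 1 -> - (A + 1) < tau x < A + 1.
  by move=> /(HA ord0); rewrite ler_norml => /andP[? ?]; apply/andP; split; lra.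
have [G dG] := antiderivative_exists (a := - (A + 1)) (b := A + 1) (fun x _ => cW x).
have /andP[A1 A2] := HA 0 (introT andP (conj (lexx 0) ler01)).
have /andP[A3 A4] := HA t (introT andP (conj t0' t1')).
rewrite tau0 in A1 A2; rewrite tv in A3 A4.
have {}HG : \sum_i d i * (d i * q i) <= s * (G v - G t0).
  by apply: HG => x /orP[|] /andP[? ?]; apply: dG; apply/andP; split; lra.
(* This derivative equals sqrt(W) (s p - sqrt(W)), which is negative because negative energy means
   |p| < sqrt(W). *)
have dH x : 0 <= x <= t -> is_derive x (1 : R)
    (fun x => s * G (tau x) - \sum_i d i * (d i * q i) * u i x)
    (s * (p x * Num.sqrt (W (tau x))) - W (tau x)).
  move=> /andP[x0 xt].
  have dGx := dG _ (HA x (introT andP (conj x0 (le_trans xt t1')))).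
  have dGt : is_derive x (1 : R) (fun x => G (tau x)) (p x * Num.sqrt (W (tau x))).
    by apply: is_derive_eq (@is_derive1_comp _ G tau x _ _ _ _) _; rewrite mulrC.
  apply: (is_deriveB_pt (is_deriveMl_pt s dGt)).
  rewrite /W; have -> : \sum_i (d i * q i) ^+ 2 * w i (tau x) =
     \sum_i d i * (d i * q i) * (q i * w i (tau x)) by apply: eq_bigr => i _; ring.
  by apply: is_derive_sum_pt => i; apply: is_deriveMl_pt.
have : s * G (tau t) - \sum_i d i * (d i * q i) * u i t <
       s * G (tau 0) - \sum_i d i * (d i * q i) * u i 0.
  apply: (derive_lt0_lt tgt0 dH) => x _.
  have Wx := potential_ge0 (tau x).
  have Ex : p x ^+ 2 < W (tau x) by rewrite -subr_lt0 (energy_cst x 0).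
  have Wp : 0 < W (tau x) by rewrite (le_lt_trans _ Ex)// sqr_ge0.
  have sW : 0 < Num.sqrt (W (tau x)) by rewrite sqrtr_gt0.
  have -> : s * (p x * Num.sqrt (W (tau x))) - W (tau x) =
     Num.sqrt (W (tau x)) * (s * p x - Num.sqrt (W (tau x))).
    by rewrite mulrBr -expr2 sqr_sqrtr//; ring.
  rewrite pmulr_rlt0// subr_lt0 (le_lt_trans (ler_norm _))// normrM s1 mul1r.
  by rewrite -sqrtr_sqr ltr_sqrt.
rewrite tau0 tv [X in _ < _ - X]big1; last by move=> i _; have [-> _] := u01 i; rewrite mulr0.
have : \sum_i d i * (d i * q i) * u i t <= \sum_i d i * (d i * q i).
  apply: ler_sum => i _; rewrite ler_piMr ?u_le1 ?t0' ?t1'//.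
  by rewrite !mulr_ge0// ltW.
rewrite mulrBr in HG; lra.
Qed.

Lemma confined (al be : R) :
  al < t0 < be -> al < t1 < be ->
  (forall G : R -> R, (forall x, t0 <= x <= be -> is_derive x (1 : R) G (Num.sqrt (W x))) ->
    \sum_i d i * (d i * q i) <= G be - G t0) ->
  (forall G : R -> R, (forall x, al <= x <= t0 -> is_derive x (1 : R) G (Num.sqrt (W x))) ->
    \sum_i d i * (d i * q i) <= G t0 - G al) ->
  forall t, 0 <= t <= 1 -> al < tau t < be.
Proof.
move=> /andP[a0 b0] /andP[a1 b1] Hbe Hal.
have [E0|E0] := leP 0 (p 0 ^+ 2 - W (tau 0)).
  by apply: monotone_confined E0 _ _; rewrite ?a0 ?a1.
have Nbe t : 0 <= t <= 1 -> tau t <> be.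
  apply: (@barrier 1) => //; [exact: normr1|by rewrite gt_eqF|].
  move=> G HG; rewrite mul1r; apply: Hbe => x xb; apply: HG; by rewrite xb.
have Nal t : 0 <= t <= 1 -> tau t <> al.
  apply: (@barrier (- 1)) => //; [by rewrite normrN1|by rewrite lt_eqF|].
  move=> G HG; rewrite mulN1r opprB; apply: Hal => x xb; apply: HG; by rewrite xb orbT.
move=> t /andP[t0' t1']; apply/andP; split; rewrite ltNge; apply/negP => H.
  have [|c /andP[c0 ct]] := derive_ivt (v := al) dtau _ t0'.
    by rewrite tau0 H (ltW a0) orbT.
  by apply: Nal; rewrite c0 (le_trans ct).
have [|c /andP[c0 ct]] := derive_ivt (v := be) dtau _ t0'.
  by rewrite tau0 H (ltW b0).
by apply: Nbe; rewrite c0 (le_trans ct).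
Qed.

End Confinement.

(** * Solving the original problem through the cut-off one *)

Section ConfinedBVP.
Context {R : realType} (n : nat) (d : 'I_n -> R) (phi phi' : 'I_n -> R -> R).
Variables (al be e t0 t1 : R).
Hypothesis d0 : forall i, 0 <= d i.
Hypotheses (e0 : 0 < e) (t0ab : al < t0 < be) (t1ab : al < t1 < be).
Hypothesis phi0 : forall i x, al - e <= x <= be + e -> 0 < phi i x.
Hypothesis dphi : forall i x, al - e <= x <= be + e -> is_derive x (1 : R) (phi i) (phi' i x).
Hypothesis cphi' : forall i x, al - e <= x <= be + e -> {for x, continuous (phi' i)}.
Hypothesis barrier_be : forall c : 'I_n -> R, (forall i, 0 <= c i) -> forall G : R -> R,
  (forall x, t0 <= x <= be -> is_derive x (1 : R) G (Num.sqrt (\sum_i c i ^+ 2 * phi i x))) ->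
  \sum_i d i * c i <= G be - G t0.
Hypothesis barrier_al : forall c : 'I_n -> R, (forall i, 0 <= c i) -> forall G : R -> R,
  (forall x, al <= x <= t0 -> is_derive x (1 : R) G (Num.sqrt (\sum_i c i ^+ 2 * phi i x))) ->
  \sum_i d i * c i <= G t0 - G al.

(** Composing with the cut-off makes the coefficients globally bounded; the equations agree with the
    original ones wherever [tau] lies in [al, be]. They are stated for all such [t], not only in
    [0, 1], because a geodesic has to extend past both end points. *)
Lemma confined_bvp : exists (tau p : R -> R) (u : 'I_n -> R -> R) (q : 'I_n -> R),
  [/\ (forall i, 0 < q i),
      [/\ tau 0 = t0, tau 1 = t1 & forall i, u i 0 = 0 /\ u i 1 = 1],
      (forall t, 0 <= t <= 1 -> al < tau t < be),
      (forall t, is_derive t (1 : R) tau (p t)) &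
      forall t, al <= tau t <= be ->
        is_derive t (1 : R) p (force (fun i => d i ^+ 2) phi' q (tau t)) /\
        forall i, is_derive t (1 : R) (u i) (q i * phi i (tau t))].
Proof.
have abl : al <= be by move: t0ab => /andP[? ?]; lra.
pose th := cutoff al be e; pose th' := cutoff' al be e.
have thb x : al - e <= th x <= be + e by apply: cutoff_bounds.
pose w i x := phi i (th x); pose w' i x := phi' i (th x) * th' x.
have dth x : is_derive x (1 : R) th (th' x) by apply: is_derive_cutoff.
have dw i x : is_derive x (1 : R) (w i) (w' i x).
  have h := dphi i (thb x).
  by apply: is_derive_eq (@is_derive1_comp _ (phi i) th x _ _ _ _) _.
have w0 i x : 0 < w i x by apply: phi0.
have [K1 K10 HK1] := @compact_itv_bounded R n phi (al - e) (be + e)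
  (fun i x h => is_derive_continuous (dphi i h)).
(* A bound on the inverses turns pointwise positivity into a uniform positive lower bound. *)
have [K2 K20 HK2] := @compact_itv_bounded R n (fun i x => (phi i x)^-1) (al - e) (be + e)
  (fun i x h => cvgV (lt0r_neq0 (phi0 i h)) (is_derive_continuous (dphi i h))).
have [K3 K30 HK3] := @compact_itv_bounded R n phi' (al - e) (be + e) cphi'.
have wlo i x : K2^-1 <= w i x.
  have := HK2 i _ (thb x); rewrite ger0_norm ?invr_ge0 ?(ltW (w0 i x))// => h.
  by rewrite -[w i x]invrK lef_pV2 ?posrE ?invr_gt0//.
have whi i x : w i x <= K1 by have := HK1 i _ (thb x); apply: le_trans; exact: ler_norm.
have w'M i x : `|w' i x| <= K3.
  rewrite /w' normrM -[leRHS]mulr1 ler_pM ?HK3//; exact: cutoff'_bounds.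
have w'c i : continuous (w' i).
  move=> x; apply: cvgM; last exact: continuous_cutoff'.
  apply: (@continuous_comp _ _ _ th (phi' i)); first exact: is_derive_continuous (dth x).
  exact: cphi'.
have K2V : 0 < K2^-1 by rewrite invr_gt0.
have [tau [p [u [q [q0 [tau0 tau1 u01] dtau dp du]]]]] :=
  @bvp_exists R n (fun i => d i ^+ 2) w w' K2^-1 K1 K3 (fun i => sqr_ge0 (d i))
    K2V wlo whi dw w'M K10 (ltW K30) w'c t0 t1.
have wE i x : al <= x <= be -> w i x = phi i x by move=> xab; rewrite /w /th cutoff_id.
have conf : forall t, 0 <= t <= 1 -> al < tau t < be.
  apply: (confined d0 w0 dw q0 tau0 tau1 u01 dtau dp du t0ab t1ab) => G HG.
    apply: barrier_be => [i|x /andP[x1 x2]]; first by rewrite mulr_ge0// ltW.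
    rewrite (eq_bigr (fun i => (d i * q i) ^+ 2 * w i x)).
      by apply: HG; rewrite x1.
    by move=> i _; rewrite wE// x2 andbT (le_trans _ x1)//; move: t0ab => /andP[? ?]; lra.
  apply: barrier_al => [i|x /andP[x1 x2]]; first by rewrite mulr_ge0// ltW.
  rewrite (eq_bigr (fun i => (d i * q i) ^+ 2 * w i x)).
    by apply: HG; rewrite x1.
  by move=> i _; rewrite wE// x1 (le_trans x2)//; move: t0ab => /andP[? ?]; lra.
exists tau, p, u, q; split => // t tab; split.
  have := dp t; rewrite /force; congr is_derive; congr (_ * _); apply: eq_bigr => i _.
  by rewrite /w' /th /th' cutoff_id// cutoff'_id// mulr1.
by move=> i; have := du i t; rewrite wE.
Qed.

End ConfinedBVP.

(** * Smooth functions *)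

Section MatrixNorm.
Context {R : realType} {m n : nat}.
Implicit Types A : 'M[R]_(m, n).

Lemma coord_le_norm A i j : `|A i j| <= `|A|.
Proof. by rewrite [leRHS]/Num.norm/= mx_normrE; exact: (le_bigmax _ _ (i, j)). Qed.

Lemma norm_le_coord A e : 0 <= e -> (forall i j, `|A i j| <= e) -> `|A| <= e.
Proof.
by move=> e0 H; rewrite [leLHS]/Num.norm/= mx_normrE; apply: bigmax_le => // -[i j] _.
Qed.

Lemma cvg_mx (T : Type) (F : set_system T) (FF : Filter F) (M : T -> 'M[R]_(m, n)) (L : 'M[R]_(m, n)) :
  (forall i j, M x i j @[x --> F] --> L i j) -> M @ F --> L.
Proof.
move=> H; apply/cvgrPdist_le => e e0; near=> x.
apply: norm_le_coord => [|i j]; first exact: ltW.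
rewrite !mxE/=; move: i j; near: x.
apply: filter_forall => i; apply: filter_forall => j.
by have /cvgrPdist_le/(_ e e0) := H i j.
Unshelve. all: by end_near. Qed.

Lemma cvg_coord (T : Type) (F : set_system T) (FF : Filter F) (M : T -> 'M[R]_(m, n)) (L : 'M[R]_(m, n)) i j :
  M @ F --> L -> M x i j @[x --> F] --> L i j.
Proof.
move=> ML; apply/cvgrPdist_le => e e0; have /cvgrPdist_le/(_ e e0) := ML.
apply: filterS => x; apply: le_trans.
by have := coord_le_norm (L - M x) i j; rewrite !mxE.
Qed.

End MatrixNorm.

Section IsDeriveMatrix.
Context {R : realType} {V : normedModType R} {m n : nat}.

Lemma is_derive_mxP (M : V -> 'M[R]_(m, n)) x v (dM : 'M[R]_(m, n)) :
  is_derive x v M dM <-> forall i j, is_derive x v (fun y => M y i j) (dM i j).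
Proof.
split=> [[dx <-] i j|H].
  by apply: DeriveDef; [exact: (derivable_mxP _ _ _).1|rewrite derive_mx// mxE].
have dx : derivable M x v by apply/derivable_mxP => i j; case: (H i j).
apply: DeriveDef => //; rewrite derive_mx//; apply/matrixP => i j; rewrite mxE.
by case: (H i j).
Qed.

End IsDeriveMatrix.

Section TotalDerivative.
Context {R : realType} {m : nat} (U : set 'rV[R]_m) (f : 'rV[R]_m -> R).
Hypothesis Uo : open U.
Hypothesis df : forall v x, U x -> derivable f x v.
Hypothesis cdf : forall v x, U x -> {for x, continuous ('D_v f)}.

Lemma mvt_le (phi dphi : R -> R) (h rho e : R) :
  (forall s, `|s| <= `|h| -> is_derive s (1 : R) phi (dphi s)) ->
  (forall s, `|s| <= `|h| -> `|dphi s - rho| <= e) ->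
  `|phi h - phi 0 - h * rho| <= e * `|h|.
Proof.
move=> H1 H2; case: (ltrgt0P h) => [h0|h0|->].
- have [||c /andP[c0 c1]] := @derive_mvt R phi dphi 0 h.
  + by [].
  + by move=> s /andP[s0 s1]; apply: H1; rewrite !ger0_norm// (le_trans s0).
  rewrite subr0 => ->; rewrite [h * _]mulrC -mulrBl normrM [X in _ * X]gtr0_norm// ler_wpM2r ?(ltW h0)//.
  by apply: H2; rewrite !gtr0_norm// ltW.
- have [||c /andP[c0 c1]] := @derive_mvt R phi dphi h 0.
  + by [].
  + by move=> s /andP[s0 s1]; apply: H1; rewrite !ler0_norm ?lerN2// ltW.
  rewrite sub0r => E.
  have -> : phi h - phi 0 - h * rho = (dphi c - rho) * h.
    by rewrite -[phi h - phi 0]opprB E; ring.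
  rewrite normrM (ltr0_norm h0) ler_wpM2r ?oppr_ge0 ?(ltW h0)//.
  by apply: H2; rewrite !ltr0_norm// lerN2 ltW.
- by rewrite !subrr mul0r subrr normr0 mulr0.
Qed.

Lemma is_derive_line (x v : 'rV[R]_m) (s : R) : U (x + s *: v) ->
  is_derive s (1 : R) (fun r => f (x + r *: v)) ('D_v f (x + s *: v)).
Proof.
move=> Uxs; have := @df v _ Uxs.
have E : (fun h : R => h^-1 *: (((fun r => f (x + r *: v)) \o shift s) (h *: 1) - f (x + s *: v)))
   = (fun h : R => h^-1 *: ((f \o shift (x + s *: v)) (h *: v) - f (x + s *: v))).
  apply/funext => h; congr (_ *: (f _ - _)).
  by rewrite /= -[h *: 1]/(h * 1) mulr1 scalerDl addrCA.
by move=> d; apply: DeriveDef; rewrite /derivable /derive E.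
Qed.

(** Continuous partial derivatives give the Frechet estimate. It is required because [Ck_on] speaks
    of directional derivatives only, which do not suffice for the chain rule along curves. *)
Lemma partial_approx (x : 'rV[R]_m) : U x -> forall e : R, 0 < e -> \forall y \near x,
  `|f y - f x - \sum_j (y - x) 0 j * 'D_(delta_mx 0 j) f x| <= e * `|y - x|.
Proof.
move=> Ux e e0.
have e1 : 0 < e / (m%:R + 1) by rewrite divr_gt0// ltr_wpDl.
have : \forall y \near x, U y /\ forall j, `|'D_(delta_mx 0 j) f y - 'D_(delta_mx 0 j) f x| <= e / (m%:R + 1).
  apply: filterI; first exact: open_nbhs_nbhs.
  apply: (filter_forall (F := nbhs x)) => j.
  have /cvgrPdist_le/(_ _ e1) := @cdf (delta_mx 0 j) _ Ux.
  by apply: filterS => y; rewrite distrC.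
move=> /nbhs_ballP[r /= r0 Hr].
have nyr : \forall y \near x, ball x r y by exact: nbhsx_ballx.
near=> y.
have yr : `|y - x| < r.
  have : ball x r y by near: y.
  by rewrite -ball_normE /= distrC.
(* The path from [x] to [y] changes one coordinate at a time; in the sup norm it stays in the ball,
   and each of its [m] edges contributes an error of at most [e / (m%:R + 1)] times the distance. *)
pose z (k : nat) : 'rV[R]_m := \row_j (if (j < k)%N then y 0 j else x 0 j).
have zx : z 0%N = x by apply/rowP => j; rewrite mxE ltn0.
have zy : z m = y by apply/rowP => j; rewrite mxE ltn_ord.
have -> : f y - f x = \sum_(k < m) (f (z k.+1) - f (z k)).
  by rewrite -zx -[in LHS]zy -(telescope_sumr (fun k => f (z k))) ?leq0n// big_mkord.
rewrite -sumrB (le_trans (ler_norm_sum _ _ _))//.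
apply: (@le_trans _ _ (\sum_(k < m) e / (m%:R + 1) * `|y - x|)); last first.
  rewrite sumr_const card_ord -[leLHS]mulr_natl mulrA ler_wpM2r//.
  by rewrite mulrA ler_pdivrMr ?ltr_wpDl// mulrC ler_wpM2l ?(ltW e0)// lerDl.
apply: ler_sum => k _.
pose h := (y - x) 0 k.
have hn : `|h| <= `|y - x| by exact: coord_le_norm.
have zk : z k.+1 = z k + h *: delta_mx 0 k.
  apply/rowP => j; rewrite !mxE eqxx/= ltnS leq_eqVlt.
  have [jk|jk] := eqVneq j k; first by rewrite jk eqxx ltnn/= mulr1 /h !mxE addrC subrK.
  by rewrite -val_eqE in jk; rewrite (negbTE jk)/= mulr0 addr0.
have ballz s : `|s| <= `|h| -> `|z k + s *: delta_mx 0 k - x| < r.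
  move=> sh; apply: le_lt_trans yr; apply: norm_le_coord => // i j.
  rewrite (ord1 i) !mxE eqxx/=; have [jk|jk] := eqVneq j k.
    by rewrite jk ltnn mulr1 addrAC subrr add0r (le_trans sh).
  rewrite mulr0 addr0; case: ifP => _; last by rewrite subrr normr0.
  by have := coord_le_norm (y - x) 0 j; rewrite !mxE.
have zball s : `|s| <= `|h| -> U (z k + s *: delta_mx 0 k) /\
    `|'D_(delta_mx 0 k) f (z k + s *: delta_mx 0 k) - 'D_(delta_mx 0 k) f x| <= e / (m%:R + 1).
  move=> /ballz sr; have [|? ?] := Hr (z k + s *: delta_mx 0 k); last by split.
  by rewrite -ball_normE /= distrC.
have := @mvt_le (fun s => f (z k + s *: delta_mx 0 k))
  (fun s => 'D_(delta_mx 0 k) f (z k + s *: delta_mx 0 k)) h ('D_(delta_mx 0 k) f x) (e / (m%:R + 1)).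
rewrite scale0r addr0 -zk => /(_ _ _)/le_trans; apply.
- by move=> s /zball[Us _]; exact: is_derive_line.
- by move=> s /zball[_].
- by rewrite ler_wpM2l// ltW.
Unshelve. all: by end_near. Qed.

End TotalDerivative.

Section CkGeneral.
Context {R : realType} {V W : normedModType R}.
Implicit Types (U : set V) (f g : V -> W).

Lemma Ck_on_sub k U U' f : U' `<=` U -> Ck_on k U f -> Ck_on k U' f.
Proof.
move=> U'U; elim: k f => [|k IH] f [cf df]; split => //; try by move=> x /U'U; exact: cf.
by move=> v; have [d1 d2] := df v; split; [move=> x /U'U; exact: d1|exact: IH].
Qed.

(** Derivatives are taken in the ambient space and only their conditions are restricted to [U], so
    each point may be treated separately, for instance with a chart of its own. *)
Lemma Ck_on_pointwise k U f : (forall x, U x -> Ck_on k [set x] f) -> Ck_on k U f.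
Proof.
elim: k f => [|k IH] f H; split => //; try by move=> x /H[+ _]; apply.
move=> v; split; first by move=> x /H[_ /(_ v)[+ _]]; apply.
by apply: IH => x /H[_ /(_ v)[_]].
Qed.

Lemma Ck_on_eq k U f g : open U -> (forall x, U x -> f x = g x) ->
  Ck_on k U f -> Ck_on k U g.
Proof.
move=> Uo; have nearU x : U x -> \forall y \near x, U y by move=> Ux; exact: open_nbhs_nbhs.
elim: k f g => [|k IH] f g fg [cf df].
  split => // x Ux; rewrite /prop_for /continuous_at -fg//.
  apply: cvg_trans (cf x Ux); apply: near_eq_cvg.
  by apply: filterS (nearU x Ux) => y; exact: fg.
have nfg x : U x -> \forall y \near x, f y = g y.
  by move=> Ux; apply: filterS (nearU x Ux) => y; exact: fg.
split.
  move=> x Ux; rewrite /prop_for /continuous_at -fg//.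
  by apply: cvg_trans (cf x Ux); apply: near_eq_cvg; exact: nfg.
move=> v; have [d1 d2] := df v; split.
  by move=> x Ux; apply: near_eq_derivable (d1 x Ux); exact: nfg.
by apply: (IH ('D_v f)) => // x Ux; apply: near_eq_derive; exact: nfg.
Qed.

Lemma Ck_onS k U f : Ck_on k.+1 U f -> Ck_on k U f.
Proof.
elim: k f => [|k IH] f [cf df]; split => //.
by move=> v; have [d1 d2] := df v; split => //; exact: IH.
Qed.

Lemma Ck_onZ k U f (c : R) : open U -> Ck_on k U f -> Ck_on k U (fun x => c *: f x).
Proof.
move=> Uo; elim: k f => [|k IH] f [cf df].
  by split => // x Ux; apply: continuousZl_tmp; exact: cf.
split; first by move=> x Ux; apply: continuousZl_tmp; exact: cf.
move=> v; have [d1 d2] := df v; split; first by move=> x Ux; apply: derivableZ; exact: d1.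
apply: Ck_on_eq (IH _ d2) => // x Ux.
by apply/esym; exact: (deriveZ c (d1 x Ux)).
Qed.

End CkGeneral.

Section CkCurve.
Context {R : realType} {W : normedModType R}.
Implicit Types (U : set R) (f g : R -> W).

Lemma derive1_scale f (x v : R) (df : W) : is_derive x (1 : R) f df -> is_derive x v f (v *: df).
Proof.
move=> [/derivable1_diffP d <-]; apply: DeriveDef; first exact: diff_derivable.
by rewrite !deriveE// -[v in LHS]mulr1 -[v * 1]/(v *: (1 : R^o)) linearZ.
Qed.

(** In dimension one the derivative in direction [v] is [v] times the ordinary one, so the recursion
    over all directions reduces to a single derivative. *)
Lemma Ck_on_derive k U f (df : R -> W) : open U ->
  (forall x, U x -> is_derive x (1 : R) f (df x)) -> Ck_on k U df -> Ck_on k.+1 U f.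
Proof.
move=> Uo H Hk; split; first by move=> x /H; exact: is_derive_continuous.
move=> v; have Hv x : U x -> is_derive x v f (v *: df x) by move=> /H; exact: derive1_scale.
split; first by move=> x /Hv[].
by apply: Ck_on_eq (Ck_onZ v Uo Hk) => // x /Hv[_ ->].
Qed.

Lemma Ck_on_is_derive k U f : Ck_on k.+1 U f ->
  (forall x, U x -> is_derive x (1 : R) f ('D_1 f x)) /\ Ck_on k U ('D_1 f).
Proof. by move=> [_ /(_ 1)[d1 d2]]; split => // x Ux; apply: derivableP; exact: d1. Qed.

Lemma Ck_on_cst k U (c : W) : open U -> Ck_on k U (fun=> c).
Proof.
move=> Uo; elim: k c => [|k IH] c; first by split => // x _; exact: cvg_cst.
by apply: (Ck_on_derive (df := fun=> 0)) => // x _; exact: is_derive_cst.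
Qed.

Lemma Ck_onD k U f g : open U -> Ck_on k U f -> Ck_on k U g -> Ck_on k U (fun x => f x + g x).
Proof.
move=> Uo; elim: k f g => [|k IH] f g.
  by move=> [cf _] [cg _]; split => // x Ux; apply: cvgD; [exact: cf|exact: cg].
move=> /Ck_on_is_derive[f1 f2] /Ck_on_is_derive[g1 g2].
apply: (Ck_on_derive (df := fun x => 'D_1 f x + 'D_1 g x) Uo); last exact: IH.
by move=> x Ux; apply: is_deriveD_pt; [exact: f1|exact: g1].
Qed.

Lemma Ck_on_sum k U m (h : 'I_m -> R -> W) : open U -> (forall i, Ck_on k U (h i)) ->
  Ck_on k U (fun x => \sum_i h i x).
Proof.
move=> Uo H; elim: m h H => [|m IH] h H.
  by apply: (Ck_on_eq Uo) (Ck_on_cst k 0 Uo) => x _; rewrite big_ord0.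
apply: (Ck_on_eq Uo) (Ck_onD Uo (IH _ (fun i => H (widen_ord (leqnSn m) i))) (H ord_max)) => x _.
by rewrite big_ord_recr.
Qed.

End CkCurve.

Section CkReal.
Context {R : realType}.
Implicit Types (U : set R) (f g : R -> R).

Lemma Ck_onM k U f g : open U -> Ck_on k U f -> Ck_on k U g -> Ck_on k U (fun x => f x * g x).
Proof.
move=> Uo; elim: k f g => [|k IH] f g.
  by move=> [cf _] [cg _]; split => // x Ux; apply: cvgM; [exact: cf|exact: cg].
move=> Hf Hg; have [f1 f2] := Ck_on_is_derive Hf; have [g1 g2] := Ck_on_is_derive Hg.
have H1 x : U x -> is_derive x (1 : R) (fun x => f x * g x) ('D_1 f x * g x + f x * 'D_1 g x).
  by move=> Ux; apply: is_deriveM_pt; [exact: f1|exact: g1].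
have H2 : Ck_on k U (fun x => 'D_1 f x * g x + f x * 'D_1 g x).
  by apply: Ck_onD => //; apply: IH => //; exact: Ck_onS.
exact: (Ck_on_derive Uo H1 H2).
Qed.

Lemma Ck_onV k U f : open U -> (forall x, U x -> f x != 0) -> Ck_on k U f ->
  Ck_on k U (fun x => (f x)^-1).
Proof.
move=> Uo f0; elim: k f f0 => [|k IH] f f0.
  by move=> [cf _]; split => // x Ux; apply: cvgV; [exact: f0|exact: cf].
move=> Hf; have [f1 f2] := Ck_on_is_derive Hf.
have H1 x : U x -> is_derive x (1 : R) (fun x => (f x)^-1) (- 1 * ('D_1 f x * ((f x)^-1 * (f x)^-1))).
  move=> Ux; apply: is_derive_eq (is_deriveV_pt (f0 x Ux) (f1 x Ux)) _.
  by rewrite mulN1r expr2 invfM.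
have H2 : Ck_on k U (fun x => - 1 * ('D_1 f x * ((f x)^-1 * (f x)^-1))).
  apply: Ck_onM => //; first exact: Ck_on_cst.
  apply: Ck_onM => //.
  by apply: Ck_onM => //; apply: IH => //; exact: Ck_onS.
exact: (Ck_on_derive Uo H1 H2).
Qed.

Lemma Ck_on_comp k U U' (g f : R -> R) : open U -> open U' -> (forall x, U x -> U' (f x)) ->
  Ck_on k U' g -> Ck_on k U f -> Ck_on k U (fun x => g (f x)).
Proof.
move=> Uo U'o UU'; elim: k g f UU' => [|k IH] g f UU'.
  move=> [cg _] [cf _]; split => // x Ux.
  by apply: (@continuous_comp _ _ _ f g); [exact: cf|apply: cg; exact: UU'].
move=> Hg Hf; have [f1 f2] := Ck_on_is_derive Hf; have [g1 g2] := Ck_on_is_derive Hg.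
have H1 x : U x -> is_derive x (1 : R) (fun x => g (f x)) ('D_1 f x * 'D_1 g (f x)).
  move=> Ux; have dg := g1 _ (UU' x Ux); have df := f1 x Ux.
  by apply: is_derive_eq (@is_derive1_comp _ g f x _ _ _ _) _; rewrite mulrC.
have H2 : Ck_on k U (fun x => 'D_1 f x * 'D_1 g (f x)).
  by apply: Ck_onM => //; apply: (IH ('D_1 g) f) => //; exact: Ck_onS.
exact: (Ck_on_derive Uo H1 H2).
Qed.

End CkReal.

Section CkMatrix.
Context {R : realType} {m n : nat}.

Lemma Ck_on_mxP k (U : set R) (M : R -> 'M[R]_(m, n)) : open U ->
  Ck_on k U M <-> forall i j, Ck_on k U (fun t => M t i j).
Proof.
move=> Uo; elim: k M => [|k IH] M.
  split=> [[cM _] i j|H]; split => // x Ux.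
    by apply: cvg_coord; exact: cM.
  by apply: cvg_mx => i j; have [cM _] := H i j; exact: cM.
split=> [HM i j|H].
  have [d1 d2] := Ck_on_is_derive HM.
  apply: (Ck_on_derive (df := fun t => ('D_1 M t) i j)) => //; last by have [+ _] := IH ('D_1 M); apply.
  by move=> x /d1/is_derive_mxP; exact.
have Hd i j := Ck_on_is_derive (H i j).
apply: (Ck_on_derive (df := fun t => \matrix_(i, j) 'D_1 (fun t => M t i j) t)) => //.
  by move=> x Ux; apply/is_derive_mxP => i j; rewrite mxE; have [+ _] := Hd i j; apply.
apply/IH => i j; have [_] := Hd i j.
by apply: Ck_on_eq => // x _; rewrite mxE.
Qed.

End CkMatrix.

Section Bootstrap.
Context {R : realType} (n : nat) (J I : set R) (Jo : open J) (Io : open I).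
Variables (D q : 'I_n -> R) (phi phi' : 'I_n -> R -> R) (tau p : R -> R) (u : 'I_n -> R -> R).
Hypothesis sphi : forall i, smooth_on I (phi i).
Hypothesis sphi' : forall i, smooth_on I (phi' i).
Hypothesis tauI : forall t, J t -> I (tau t).
Hypothesis dtau : forall t, J t -> is_derive t (1 : R) tau (p t).
Hypothesis dp : forall t, J t -> is_derive t (1 : R) p (force D phi' q (tau t)).
Hypothesis du : forall i t, J t -> is_derive t (1 : R) (u i) (q i * phi i (tau t)).

(** Bootstrapping: [tau] and its velocity gain one derivative together from the system they
    solve. *)
Lemma smooth_tau : smooth_on J tau.
Proof.
suff H k : Ck_on k J tau /\ Ck_on k J p by move=> k; have [] := H k.
elim: k => [|k [IHt IHp]].
  by split; split => // x Jx; [exact: is_derive_continuous (dtau Jx)|exact: is_derive_continuous (dp Jx)].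
split; first exact: Ck_on_derive dtau IHp.
have H2 : Ck_on k J (fun t => force D phi' q (tau t)).
  apply: Ck_onM => //; first exact: Ck_on_cst.
  apply: Ck_on_sum => // i; apply: Ck_onM => //; first exact: Ck_on_cst.
  exact: Ck_on_comp (sphi' i k) IHt.
exact: (Ck_on_derive Jo dp H2).
Qed.

Lemma smooth_u i : smooth_on J (u i).
Proof.
move=> k; apply: Ck_onS.
have H2 : Ck_on k J (fun t => q i * phi i (tau t)).
  apply: Ck_onM => //; first exact: Ck_on_cst.
  exact: Ck_on_comp (sphi i k) (smooth_tau k).
exact: (Ck_on_derive Jo (@du i) H2).
Qed.

End Bootstrap.

(** * Geodesics in coordinates *)

Lemma differentiable_flat {R : realType} {V W : normedModType R} (h : V -> W) (x : V) :
  (forall e : R, 0 < e -> \forall y \near x, `|h y - h x| <= e * `|y - x|) ->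
  differentiable h x.
Proof.
move=> H; pose L : {linear V -> W} := \0.
have Lc : continuous L by exact: (@cst_continuous _ _ (0 : W)).
have Lo : h \o shift x = cst (h x) + L +o_ 0 id.
  apply/eqaddoP => e e0.
  have Hs : y + x @[y --> (0 : V)] --> x.
    by rewrite -[X in _ --> X]add0r; apply: cvgD; [exact: cvg_id|exact: cvg_cst].
  have : \forall y \near (0 : V), `|h (y + x) - h x| <= e * `|y + x - x|.
    exact: (Hs _ (H e e0)).
  by apply: filterS => y; rewrite addrK /= !fctE /= addr0.
by apply/diff_locallyP; rewrite (diff_unique Lc Lo).
Qed.

Section Differentiable.
Context {R : realType} {m : nat}.

(** Subtracting the candidate linear part leaves a function with zero differential. *)
Lemma differentiable_approx (f : 'rV[R]_m -> R) (x : 'rV[R]_m) (g : 'I_m -> R) :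
  (forall e : R, 0 < e -> \forall y \near x,
    `|f y - f x - \sum_j (y - x) 0 j * g j| <= e * `|y - x|) ->
  differentiable f x.
Proof.
move=> H.
pose h : 'rV[R]_m -> R := fun y => f y - \sum_j g j * y 0 j.
have dh : differentiable h x.
  apply: differentiable_flat => e e0.
  apply: filterS (H e e0) => y; congr (`|_| <= _); rewrite /h.
  have -> : \sum_j (y - x) 0 j * g j = \sum_j g j * y 0 j - \sum_j g j * x 0 j.
    by rewrite -sumrB/=; apply: eq_bigr => j _; rewrite !mxE; ring.
  ring.
have -> : f = h + \sum_j (fun y : 'rV[R]_m => g j * y 0 j).
  by apply/funext => y; rewrite !fctE fct_sumE /h subrK.
apply: differentiableD => //; apply: differentiable_sum => j.
exact: (differentiableZ (g j) (differentiable_coord _ _ _)).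
Qed.

Lemma Ck_on_differentiable (U : set 'rV[R]_m) (f : 'rV[R]_m -> R) (x : 'rV[R]_m) :
  open U -> Ck_on 1 U f -> U x -> differentiable f x.
Proof.
move=> Uo [_ df] Ux; apply: differentiable_approx; apply: (partial_approx Uo) => // v y Uy.
  by have [d1 _] := df v; exact: d1.
by have [_ [d2 _]] := df v; exact: d2.
Qed.

Lemma Ck_on_mx_differentiable {p q : nat} (U : set 'rV[R]_m)
    (f : 'rV[R]_m -> 'M[R]_(p, q)) (x : 'rV[R]_m) i j :
  open U -> Ck_on 1 U f -> U x -> differentiable (fun y => f y i j) x.
Proof.
move=> Uo [cf df] Ux; apply: (Ck_on_differentiable Uo) => //; split.
  by move=> y Uy; apply: (cvg_coord (F := nbhs y)); exact: (cf y Uy).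
move=> v; have [d1 [d2 _]] := df v; split.
  by move=> y Uy; exact: (derivable_mxP _ _ _).1 (d1 y Uy) i j.
have E y : U y -> 'D_v f y i j = 'D_v (fun z => f z i j) y.
  by move=> Uy; rewrite derive_mx ?mxE//; exact: d1.
apply: (@Ck_on_eq _ _ _ 0 U (fun y => 'D_v f y i j)) => //.
by split => // y Uy; apply: (cvg_coord (F := nbhs y)); exact: (d2 y Uy).
Qed.

Lemma is_derive_differentiable_curve (f : 'rV[R]_m -> R) (x : R -> 'rV[R]_m) t dx :
  differentiable f (x t) -> is_derive t (1 : R) x dx ->
  is_derive t (1 : R) (fun s => f (x s)) ('D_dx f (x t)).
Proof.
move=> df [/derivable1_diffP dxt <-].
have dc : differentiable (f \o x) t by exact: differentiable_comp.
apply: DeriveDef; first exact: diff_derivable.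
by rewrite -[LHS]/('D_1 (f \o x) t) deriveE// diff_comp//= -!deriveE.
Qed.

End Differentiable.

Section Bilin.
Context {R : realType} {m : nat}.
Implicit Types (G : 'M[R]_m) (u v w : 'rV[R]_m).

Lemma bilinE G v w : bilin G v w = \sum_i \sum_j v 0 i * G i j * w 0 j.
Proof.
rewrite /bilin mxE exchange_big/=; apply: eq_bigr => j _.
by rewrite !mxE mulr_suml; apply: eq_bigr => i _.
Qed.

Lemma bilinDl G u v w : bilin G (u + v) w = bilin G u w + bilin G v w.
Proof. by rewrite /bilin !mulmxDl mxE. Qed.

Lemma bilinZl G (a : R) v w : bilin G (a *: v) w = a * bilin G v w.
Proof. by rewrite /bilin -!scalemxAl mxE. Qed.

Lemma bilinZr G (a : R) v w : bilin G v (a *: w) = a * bilin G v w.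
Proof. by rewrite /bilin linearZ/= -scalemxAr mxE. Qed.

Lemma bilin_sym G v w : G^T = G -> bilin G v w = bilin G w v.
Proof.
move=> GT; rewrite /bilin -[in LHS](trmxK (v *m G *m w^T)) mxE.
by rewrite !trmx_mul trmxK GT mulmxA.
Qed.

Lemma bilin_delta G v k : bilin G v (delta_mx 0 k) = (v *m G) 0 k.
Proof.
rewrite /bilin trmx_delta -colE mxE; congr (_ _ _).
Qed.

Lemma bilin_delta2 G i j : bilin G (delta_mx 0 i) (delta_mx 0 j) = G i j.
Proof. by rewrite bilin_delta -rowE mxE. Qed.

Lemma bilin_sum_delta G v w : bilin G v w = \sum_k w 0 k * bilin G v (delta_mx 0 k).
Proof.
rewrite /bilin mxE; apply: eq_bigr => k _; rewrite [w^T _ _]mxE mulrC; congr (_ * _).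
by rewrite -/(bilin G v (delta_mx 0 k)) bilin_delta.
Qed.

Lemma bilin_nondegenerate G : (forall v, (forall w, bilin G v w = 0) -> v = 0) -> G \in unitmx.
Proof.
move=> H; rewrite -row_free_unit -kermx_eq0; apply/eqP/row_matrixP => i; rewrite row0.
apply: H => w; rewrite /bilin.
have -> : row i (kermx G) *m G = 0 by apply: sub_kermxP; exact: row_sub.
by rewrite mul0mx mxE.
Qed.

End Bilin.

Section LocalGeometry.
Context {R : realType} {m : nat} (G : 'rV[R]_m -> 'M[R]_m) (u : 'rV[R]_m).
Hypothesis Gdiff : forall i j, differentiable (fun y => G y i j) u.
Hypothesis Gsym : (G u)^T = G u.

Definition dgram (w : 'rV[R]_m) : 'M[R]_m := \matrix_(i, j) 'D_w (fun y => G y i j) u.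

Lemma dgram_sum w : dgram w = \sum_l w 0 l *: dgram (delta_mx 0 l).
Proof.
apply/matrixP => i j; rewrite summxE mxE.
under eq_bigr do rewrite !mxE deriveE//.
rewrite deriveE// {1}(row_sum_delta w) linear_sum; apply: eq_bigr => l _.
by rewrite linearZ.
Qed.

Lemma bilin_dgram_sum w a b : bilin (dgram w) a b = \sum_l w 0 l * bilin (dgram (delta_mx 0 l)) a b.
Proof.
rewrite {1}dgram_sum /bilin mulmx_sumr mulmx_suml summxE; apply: eq_bigr => l _.
by rewrite -scalemxAr -scalemxAl mxE.
Qed.

Lemma derive_bilin w a b : is_derive u w (fun y => bilin (G y) a b) (bilin (dgram w) a b).
Proof.
rewrite (_ : (fun y => bilin (G y) a b) = fun y => \sum_i \sum_j a 0 i * G y i j * b 0 j); last first.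
  by apply/funext => y; rewrite bilinE.
rewrite bilinE; apply: is_derive_sum_pt => i; apply: is_derive_sum_pt => j.
have dG : is_derive u w (fun y => G y i j) (dgram w i j).
  by rewrite mxE; apply: derivableP; exact: diff_derivable.
rewrite (_ : (fun y => _) = fun y => a 0 i * b 0 j * G y i j); last first.
  by apply/funext => y; ring.
by apply: is_derive_eq (is_deriveMl_pt (a 0 i * b 0 j) dG) _; ring.
Qed.

Lemma is_derive_bilin_curve (x a b : R -> 'rV[R]_m) t dx da db : x t = u ->
  is_derive t (1 : R) x dx -> is_derive t (1 : R) a da -> is_derive t (1 : R) b db ->
  is_derive t (1 : R) (fun s => bilin (G (x s)) (a s) (b s))
    (bilin (G u) da (b t) + bilin (G u) (a t) db + bilin (dgram dx) (a t) (b t)).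
Proof.
move=> xt dxt dat dbt.
rewrite (_ : (fun s => _) = fun s => \sum_i \sum_j a s 0 i * G (x s) i j * b s 0 j); last first.
  by apply/funext => y; rewrite bilinE.
rewrite !bilinE -!big_split/=.
apply: is_derive_sum_pt => i; rewrite -!big_split/=; apply: is_derive_sum_pt => j.
have dG : is_derive t (1 : R) (fun s => G (x s) i j) (dgram dx i j).
  by rewrite mxE -xt; apply: (is_derive_differentiable_curve (f := fun y => G y i j)) => //; rewrite xt.
have dai := (is_derive_mxP _ _ _ _).1 dat 0 i.
have dbj := (is_derive_mxP _ _ _ _).1 dbt 0 j.
apply: is_derive_eq (is_deriveM_pt (is_deriveM_pt dai dG) dbj) _.
by rewrite xt; ring.
Qed.

(** The expression of [christoffel] for an arbitrary matrix field, so that fibers and product are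
    treated alike. *)
Definition chris i j k : R := 2^-1 * \sum_l invmx (G u) k l *
    ('D_(delta_mx 0 i) (fun x => G x j l) u
     + 'D_(delta_mx 0 j) (fun x => G x i l) u
     - 'D_(delta_mx 0 l) (fun x => G x i j) u).

(* The metric at u applied to w and the Christoffel vector Gamma(v, v). *)
Definition geo_cov (v w : 'rV[R]_m) : R := bilin (dgram v) v w - 2^-1 * bilin (dgram w) v v.

Lemma geo_cov_sum v w : geo_cov v w = \sum_l w 0 l * geo_cov v (delta_mx 0 l).
Proof.
rewrite /geo_cov bilin_sum_delta (bilin_dgram_sum w) mulr_sumr -sumrB.
by apply: eq_bigr => l _; ring.
Qed.

Lemma geo_covZ (t : R) v w : geo_cov (t *: v) w = t ^+ 2 * geo_cov v w.
Proof.
have E x y : bilin (dgram (t *: v)) x y = t * bilin (dgram v) x y.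
  rewrite !(bilin_dgram_sum _ x y) mulr_sumr; apply: eq_bigr => l _.
  by rewrite mxE mulrA.
rewrite /geo_cov E !bilinZl bilinZr; ring.
Qed.

(** Contracted twice with the same vector, the first two derivative terms of the Christoffel symbols
    coincide; this produces the factor 1/2 in [geo_cov]. *)
Lemma sum_christoffel (v : 'rV[R]_m) k :
  \sum_i \sum_j chris i j k * v 0 i * v 0 j =
  ((\row_l geo_cov v (delta_mx 0 l)) *m invmx (G u)) 0 k.
Proof.
rewrite mxE.
have -> : \sum_l (\row_l geo_cov v (delta_mx 0 l)) 0 l * invmx (G u) l k =
   \sum_l invmx (G u) k l * geo_cov v (delta_mx 0 l).
  apply: eq_bigr => l _; rewrite mxE mulrC; congr (_ * _).
  by rewrite -[in LHS]Gsym -trmx_inv mxE.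
under eq_bigr do under eq_bigr => j _ do rewrite /chris mulr_sumr !mulr_suml.
under eq_bigr do rewrite exchange_big/=.
rewrite exchange_big/=; apply: eq_bigr => l _.
have E1 : bilin (dgram v) v (delta_mx 0 l) =
   \sum_i \sum_j v 0 i * v 0 j * 'D_(delta_mx 0 i) (fun x => G x j l) u.
  rewrite bilin_dgram_sum; apply: eq_bigr => i _.
  rewrite bilin_delta mxE mulr_sumr; apply: eq_bigr => j _.
  by rewrite mxE mulrA.
have E2 : bilin (dgram v) v (delta_mx 0 l) =
   \sum_i \sum_j v 0 i * v 0 j * 'D_(delta_mx 0 j) (fun x => G x i l) u.
  rewrite E1 exchange_big/=; apply: eq_bigr => i _; apply: eq_bigr => j _.
  by rewrite [v 0 j * _]mulrC.
have E3 : bilin (dgram (delta_mx 0 l)) v v =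
   \sum_i \sum_j v 0 i * v 0 j * 'D_(delta_mx 0 l) (fun x => G x i j) u.
  rewrite bilinE; apply: eq_bigr => i _; apply: eq_bigr => j _.
  by rewrite mxE mulrAC.
rewrite /geo_cov.
have -> : bilin (dgram v) v (delta_mx 0 l) - 2^-1 * bilin (dgram (delta_mx 0 l)) v v =
  2^-1 * (bilin (dgram v) v (delta_mx 0 l) + bilin (dgram v) v (delta_mx 0 l) -
    bilin (dgram (delta_mx 0 l)) v v) by field.
rewrite {1}E1 E2 E3 -big_split -sumrB/= !mulr_sumr; apply: eq_bigr => i _.
rewrite -big_split -sumrB/= !mulr_sumr; apply: eq_bigr => j _.
ring.
Qed.

(** Lowering the index removes the inverse matrix. In this form the equation of the product splits
    into those of the factors. *)
Lemma geodesic_eqP (v a : 'rV[R]_m) : G u \in unitmx ->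
  (forall k, a 0 k + \sum_i \sum_j chris i j k * v 0 i * v 0 j = 0) <->
  (forall w, bilin (G u) a w + geo_cov v w = 0).
Proof.
move=> Gu; pose Q := \row_l geo_cov v (delta_mx 0 l).
have E w : bilin (G u) a w + geo_cov v w = \sum_l w 0 l * ((a *m G u) 0 l + Q 0 l).
  rewrite bilin_sum_delta geo_cov_sum -big_split/=; apply: eq_bigr => l _.
  have QE : Q 0 l = geo_cov v (delta_mx 0 l) by rewrite mxE.
  by rewrite [in RHS]mulrDr bilin_delta QE.
split=> [H w|H k].
  have aQ : a = - (Q *m invmx (G u)).
    apply/rowP => k; apply/eqP; rewrite mxE -addr_eq0 -sum_christoffel.
    exact/eqP/H.
  rewrite E big1// => l _; rewrite aQ mulNmx mulmxKV// mxE.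
  by rewrite addNr mulr0.
rewrite sum_christoffel -/Q.
have -> : Q = - (a *m G u).
  apply/rowP => l; have := H (delta_mx 0 l); rewrite E (bigD1 l)//= big1 ?addr0.
    by rewrite mxE !eqxx mul1r => /eqP; rewrite addrC addr_eq0 [RHS]mxE => /eqP.
  by move=> j jl; rewrite mxE (negbTE jl) andbF mul0r.
by rewrite mulNmx mulmxK// mxE subrr.
Qed.

End LocalGeometry.

(** * Curves in Riemannian manifolds *)

Lemma open_itvoo {R : realType} (a b : R) : open [set` `]a, b[].
Proof. exact: itv_open. Qed.

Section RiemannianCurves.
Context {R : realType} (M : metric_manifold R).
Hypothesis hM : riemannian M.
Local Notation vec := 'rV[R]_(mdim M).

Definition chart_image (c : chart M) : set vec := chart_coord c @` chart_dom c.

Lemma chart_dom_open (c : chart M) : open (chart_dom c).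
Proof. by have [[_ _ _ /(_ c)[]]] := hM. Qed.

Lemma chart_image_open (c : chart M) : open (chart_image c).
Proof.
have [[_ _ _ hom _] _ _ _ _] := hM; have [_ _ _ H] := hom c.
by apply: H => //; exact: chart_dom_open.
Qed.

Lemma gram_differentiable (c : chart M) p i j : chart_dom c p ->
  differentiable (fun y => gram c y i j) (chart_coord c p).
Proof.
move=> cp; have [_ /(_ c i j 1%N) sg _ _ _] := hM.
by apply: (Ck_on_differentiable (@chart_image_open c) sg); exists p.
Qed.

Lemma gram_sym (c : chart M) p : chart_dom c p ->
  (gram c (chart_coord c p))^T = gram c (chart_coord c p).
Proof. by have [_ _ + _ _] := hM; exact. Qed.

Lemma gram_ge0 (c : chart M) p v : chart_dom c p -> 0 <= bilin (gram c (chart_coord c p)) v v.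
Proof.
move=> cp; have [->|v0] := eqVneq v 0; first by rewrite /bilin !mul0mx mxE.
by have [_ _ _ /(_ c p v cp v0)/ltW] := hM.
Qed.

Lemma gram_eq0 (c : chart M) p v : chart_dom c p ->
  bilin (gram c (chart_coord c p)) v v = 0 -> v = 0.
Proof.
move=> cp; apply: contra_eq => v0; rewrite gt_eqF//.
by have [_ _ _ H _] := hM; exact: H.
Qed.

Lemma gram_unit (c : chart M) p : chart_dom c p -> gram c (chart_coord c p) \in unitmx.
Proof.
move=> cp; apply: bilin_nondegenerate => v H; exact: gram_eq0 (H v).
Qed.

Lemma chart_at_dom (p : M) : chart_dom (chart_at p) p.
Proof. by have [[_ _ + _ _] _ _ _ _] := hM; exact. Qed.

Section Curve.
Variables (J : set R) (gamma : R -> M).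
Hypotheses (Jo : open J) (sgamma : smooth_curve J gamma).

Definition curve_dom (c : chart M) : set R := J `&` gamma @^-1` chart_dom c.

Lemma curve_dom_open c : open (curve_dom c).
Proof.
rewrite openE => t [Jt ct]; apply: filterI; first exact: open_nbhs_nbhs.
have [cg _] := sgamma; apply: cg => //.
by apply: open_nbhs_nbhs; split => //; exact: chart_dom_open.
Qed.

Lemma is_derive_coord c t : curve_dom c t ->
  is_derive t (1 : R) (chart_coord c \o gamma) (derive1 (chart_coord c \o gamma) t).
Proof.
by move=> ct; have [_ /(_ c 1%N)/Ck_on_is_derive[+ _]] := sgamma; rewrite derive1E; exact.
Qed.

Lemma is_derive2_coord c t : curve_dom c t ->
  is_derive t (1 : R) (derive1 (chart_coord c \o gamma)) (derive1n 2 (chart_coord c \o gamma) t).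
Proof.
move=> ct; have [_ /(_ c 2%N)/Ck_on_is_derive[_ /Ck_on_is_derive[+ _]]] := sgamma.
rewrite derive1nS derive1n1 derive1E.
have -> : derive1 (chart_coord c \o gamma) = 'D_1 (chart_coord c \o gamma).
  by apply/funext => s; rewrite derive1E.
exact.
Qed.

Definition speed2 (t : R) : R := metric (gamma t) (velocity gamma t) (velocity gamma t).

(** The preferred chart in [speed2] moves with [t], whereas differentiation requires one fixed
    chart. The chain rule for the transition map and the invariance of the metric bridge the gap. *)
Lemma speed2_chart c t : curve_dom c t -> let x := chart_coord c \o gamma in
  speed2 t = bilin (gram c (x t)) (derive1 x t) (derive1 x t).
Proof.
move=> ct x; rewrite /speed2 /metric.
set d := chart_at (gamma t); pose y := chart_coord d \o gamma.
have dt : curve_dom d t by split; [case: ct|exact: chart_at_dom].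
have [[_ _ _ hom /(_ c d)[psi psit]] _ _ _ Hinv] := hM.
pose W := chart_coord c @` (chart_dom c `&` chart_dom d).
have Wo : open W.
  have [_ _ _ H] := hom c; apply: H; last by move=> p [].
  by apply: openI; exact: chart_dom_open.
have Wt : W (x t) by exists (gamma t) => //; split; [case: ct|case: dt].
have [spsi epsi] := psit.
have dx := is_derive_coord ct; have dy := is_derive_coord dt.
have near_y : \forall s \near t, y s = psi (x s).
  have nc := open_nbhs_nbhs (conj (@curve_dom_open c) ct).
  have nd := open_nbhs_nbhs (conj (@curve_dom_open d) dt).
  near=> s; rewrite /y /x /= epsi//.
    by have [] : curve_dom c s by near: s.
  by have [] : curve_dom d s by near: s.
have dpsi : derivable psi (x t) (derive1 x t).
  by have [_ /(_ (derive1 x t))[+ _]] := spsi 1%N; exact.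
have dy2 : is_derive t (1 : R) (fun s => psi (x s)) ('D_(derive1 x t) psi (x t)).
  apply/is_derive_mxP => i j; rewrite derive_mx// mxE.
  apply: (is_derive_differentiable_curve (f := fun z => psi z i j)) => //.
  exact: (Ck_on_mx_differentiable i j Wo (spsi 1%N)).
have Ey : derive1 y t = 'D_(derive1 x t) psi (x t).
  rewrite [LHS]derive1E (near_eq_derive _ near_y).
  by case: dy2.
rewrite /velocity -/d -/y Ey; apply/esym; apply: Hinv => //; by [case: ct|case: dt].
Unshelve. all: by end_near. Qed.

Lemma speed2_ge0 t : J t -> 0 <= speed2 t.
Proof. by move=> Jt; apply: gram_ge0; exact: chart_at_dom. Qed.

Lemma speed2_continuous t : J t -> {for t, continuous speed2}.
Proof.
move=> Jt; pose c := chart_at (gamma t); pose x := chart_coord c \o gamma.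
have ct : curve_dom c t by split => //; exact: chart_at_dom.
have [_ ct'] := ct.
have ns : \forall s \near t, bilin (gram c (x s)) (derive1 x s) (derive1 x s) = speed2 s.
  have nc := open_nbhs_nbhs (conj (@curve_dom_open c) ct).
  by apply: filterS nc => s cs; rewrite (speed2_chart cs).
have Gd i j : differentiable (fun y => gram c y i j) (x t) by exact: gram_differentiable.
have H := is_derive_bilin_curve Gd erefl (is_derive_coord ct) (is_derive2_coord ct) (is_derive2_coord ct).
exact: is_derive_continuous (near_eq_is_derive ns H).
Qed.

Hypothesis geo : geodesic J gamma.

Lemma geodesic_covariant c t : curve_dom c t -> let x := chart_coord c \o gamma in
  forall w, bilin (gram c (x t)) (derive1n 2 x t) w + geo_cov (gram c) (x t) (derive1 x t) w = 0.
Proof.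
move=> ct x; have [Jt ct'] := ct; have [_ /(_ c t Jt ct') H] := geo.
apply: (proj1 (geodesic_eqP _ _ _ _ _)) => //.
- by move=> i j; exact: gram_differentiable.
- exact: gram_sym.
- exact: gram_unit.
Qed.

(** The derivative of g(x', x') is twice the covariant geodesic equation tested on x' itself. *)
Lemma geodesic_speed t : J t -> is_derive t (1 : R) speed2 0.
Proof.
move=> Jt; pose c := chart_at (gamma t); pose x := chart_coord c \o gamma.
have ct : curve_dom c t by split => //; exact: chart_at_dom.
have [_ ct'] := ct.
have ns : \forall s \near t, bilin (gram c (x s)) (derive1 x s) (derive1 x s) = speed2 s.
  have nc := open_nbhs_nbhs (conj (@curve_dom_open c) ct).
  by apply: filterS nc => s cs; rewrite (speed2_chart cs).
apply: near_eq_is_derive ns _.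
have Gd i j : differentiable (fun y => gram c y i j) (x t) by exact: gram_differentiable.
have := is_derive_bilin_curve Gd erefl (is_derive_coord ct) (is_derive2_coord ct) (is_derive2_coord ct).
move=> H; apply: is_derive_eq H _.
have := geodesic_covariant ct (derive1 x t); rewrite -/x /geo_cov.
rewrite [bilin _ (derive1 x t) (derive1n 2 x t)]bilin_sym; last exact: gram_sym.
by lra.
Qed.

End Curve.

(** The speed is constant and the parameter interval has length 1, so one number [L] is both length
    and speed. *)
Lemma joining_geodesic_length (p q : M) gamma : joining_geodesic p q gamma ->
  exists L e : R, [/\ 0 <= L, 0 < e, geodesic `]- e, 1 + e[ gamma,
    curve_length gamma = L%:E & forall t, t \in `]- e, 1 + e[ -> speed2 gamma t = L ^+ 2].
Proof.
move=> [[e e0 geo] _ _].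
have Jo := @open_itvoo R (- e) (1 + e).
have sg : smooth_curve `]- e, 1 + e[ gamma by case: geo.
have dsp t : t \in `]- e, 1 + e[ -> is_derive t (1 : R) (speed2 gamma) 0.
  by move=> te; apply: (geodesic_speed Jo sg geo).
have J0 : (0 : R) \in `]- e, 1 + e[ by rewrite in_itv/=; lra.
have cst t : t \in `]- e, 1 + e[ -> speed2 gamma t = speed2 gamma 0.
  move=> te; have [t0|t0|->//] := ltgtP t 0.
    have [|c _] := derive_mvt (f := speed2 gamma) (df := fun=> 0) t0.
      move=> s /andP[ts s0]; apply: dsp; move: te J0; rewrite !in_itv/=; lra.
    by rewrite mul0r => /subr0_eq/esym.
  have [|c _] := derive_mvt (f := speed2 gamma) (df := fun=> 0) t0.
    move=> s /andP[ts s0]; apply: dsp; move: te J0; rewrite !in_itv/=; lra.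
  by rewrite mul0r => /subr0_eq.
have s0 : 0 <= speed2 gamma 0 by apply: (@speed2_ge0 `]- e, 1 + e[).
exists (Num.sqrt (speed2 gamma 0)), e; split => //.
- rewrite /curve_length.
  under eq_integral.
    move=> t /set_mem/= t01; rewrite -/(speed2 gamma t) cst; last first.
      by move: t01; rewrite !in_itv/=; lra.
    over.
  rewrite integral_cst//= lebesgue_measure_itv/= lte_fin ltr01 -EFinB subr0 mule1//.
- by move=> t te; rewrite cst// sqr_sqrtr.
Qed.

End RiemannianCurves.

Lemma partition_ind {R : realType} (P : R -> R -> Prop) (a : R) (s : seq R) :
  (forall p, P p p) -> (forall p q r, p <= q -> q <= r -> P p q -> P q r -> P p r) ->
  path <%O a s ->
  (forall k, (k < size s)%N -> nth 0 (a :: s) k < nth 0 s k ->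
    P (nth 0 (a :: s) k) (nth 0 s k)) ->
  P a (last a s).
Proof.
move=> P0 PT; elim: s a => [|b s IH] a /=; first by [].
move=> /andP[ab bs] H.
apply: (PT a b) => //; first exact: ltW.
- by apply: (@itv_partition_le _ _ _ _ s); split.
- exact: (H 0%N).
- by apply: IH => // k ks; exact: (H k.+1).
Qed.

Section Pieces.
Context {R : realType} (n : nat) (phi : 'I_n -> R -> R) (c : 'I_n -> R) (K : R -> R).
Hypothesis phi0 : forall i x, 0 <= phi i x.

(* On [p, q] the curves of speeds phi_i have lengths l_i, and K pays for them
   with prices c_i. *)
Definition length_piece (p q : R) : Prop :=
  exists2 l : 'I_n -> R,
    forall i, measurable_fun `[p, q] (phi i) /\
      (\int[lebesgue_measure]_(x in `[p, q]) (phi i x)%:E = (l i)%:E)%E &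
    \sum_i c i * l i <= K q - K p.

Lemma length_piece_refl p : length_piece p p.
Proof.
exists (fun=> 0); last by rewrite big1 ?subrr// => i _; rewrite mulr0.
by move=> i; rewrite set_itv1 integral_set1; split => //; exact: measurable_fun_set1.
Qed.

Lemma length_piece_trans p q r : p <= q -> q <= r ->
  length_piece p q -> length_piece q r -> length_piece p r.
Proof.
move=> pq qr [l Hl Hc] [l' Hl' Hc'].
exists (fun i => l i + l' i); last first.
  under eq_bigr do rewrite mulrDr.
  by rewrite big_split/=; lra.
move=> i; have [m1 e1] := Hl i; have [m2 e2] := Hl' i.
have E : `[p, r]%classic = `[p, q]%classic `|` `]q, r]%classic.
  by rewrite -itv_bndbnd_setU// bnd_simp.
have m2' : measurable_fun `]q, r] (phi i).
  apply: measurable_funS m2 => //; apply: subset_itvr; by rewrite bnd_simp.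
have m : measurable_fun (`[p, q] `|` `]q, r]) (phi i) by apply/measurable_funU.
rewrite E; split => //.
rewrite ge0_integral_setU//=.
- by rewrite e1 integral_itv_obnd_cbnd ?e2//; exact/measurable_EFinP.
- exact/measurable_EFinP.
- by move=> x _; rewrite lee_fin.
- apply/disj_setPS => x /=; rewrite !in_itv/= => -[/andP[_ xq] /andP[qx _]].
  by have := lt_le_trans qx xq; rewrite ltxx.
Qed.

(** Agreement of [phi] with the continuous [v] is assumed inside ]p, q[ only, because the velocity
    of a piecewise smooth curve has no meaning at break points; integrals do not see end points. The
    margin [e] provides antiderivatives up to the end points. *)
Lemma length_piece_smooth (p q e : R) (v : 'I_n -> R -> R) (k : R -> R) : p < q -> 0 < e ->
  (forall i x, p - e < x < q + e -> {for x, continuous (v i)}) ->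
  (forall i x, p < x < q -> phi i x = v i x) ->
  (forall x, p <= x <= q -> is_derive x (1 : R) K (k x)) ->
  (forall x, p <= x <= q -> \sum_i c i * v i x <= k x) ->
  length_piece p q.
Proof.
move=> pq e0 cv pv dK vk.
have exV i : exists V : R -> R, forall x, p - e / 2 < x < q + e / 2 -> is_derive x (1 : R) V (v i x).
  apply: antiderivative_exists => x /andP[x1 x2]; apply: cv; apply/andP; split; lra.
have [V dV] := choice exV.
have cvw i : {within `[p, q], continuous (v i)}.
  apply: continuous_in_subspaceT => x /set_mem; rewrite /= in_itv/= => /andP[x1 x2].
  by apply: cv; apply/andP; split; lra.
have dV' i x : p <= x <= q -> is_derive x (1 : R) (V i) (v i x).
  by move=> /andP[x1 x2]; apply: dV; apply/andP; split; lra.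
have mv i : measurable_fun `[p, q] (v i).
  apply: subspace_continuous_measurable_fun; last exact: cvw.
  exact: measurable_itv.
have mvo i : measurable_fun `]p, q[ (v i).
  by apply: measurable_funS (mv i) => //; exact: subset_itv_oo_cc.
have mpo i : measurable_fun `]p, q[ (phi i).
  apply: eq_measurable_fun (mvo i) => x /set_mem; rewrite /= in_itv/= => xpq.
  by rewrite pv.
exists (fun i => V i q - V i p).
  move=> i; split; first exact: (@measurable_fun_itv_cc _ p q false true).
  rewrite (@eq_integral_itv_bounded _ p q (v i))//; last first.
    by move=> x; rewrite in_itv/= => xpq; exact: pv.
  rewrite (@continuous_FTC2 _ (v i) (V i))//.
    split.
    - move=> x; rewrite in_itv/= => /andP[x1 x2].
      by have [] := dV' i x (introT andP (conj (ltW x1) (ltW x2))).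
    - apply: cvg_at_right_filter; apply: is_derive_continuous (dV' i p _).
      by rewrite lexx ltW.
    - apply: cvg_at_left_filter; apply: is_derive_continuous (dV' i q _).
      by rewrite lexx ltW.
  move=> x; rewrite in_itv/= => /andP[x1 x2]; rewrite derive1E.
  by have [_ ->] := dV' i x (introT andP (conj (ltW x1) (ltW x2))).
have dD x : p <= x <= q -> is_derive x (1 : R) (fun x => K x - \sum_i c i * V i x) (k x - \sum_i c i * v i x).
  move=> xpq; apply: is_deriveB_pt; first exact: dK.
  by apply: is_derive_sum_pt => i; apply: is_deriveMl_pt; exact: dV'.
have : K p - \sum_i c i * V i p <= K q - \sum_i c i * V i q.
  by apply: (derive_ge0_le (ltW pq) dD) => x xpq; rewrite subr_ge0 vk.
under [X in _ -> X <= _]eq_bigr do rewrite mulrBr.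
by rewrite sumrB; lra.
Qed.

End Pieces.

(** * Causal curves in multiwarped products *)

Section MultiwarpedCurves.
Context {R : realType} (n : nat) (a b : \bar R) (F : 'I_n -> metric_manifold R)
  (f : 'I_n -> R -> R).
Hypothesis F_riemannian : forall i, riemannian (F i).
Local Notation N := (multiwarped a b F f).

Definition tau_comp (z : N) : R := val z.1.
Definition fiber_comp (i : 'I_n) (z : N) : F i := z.2 i.

Lemma fiber_comp_continuous i : continuous (fiber_comp i).
Proof.
move=> z; apply: (@continuous_comp _ _ _ (fun z : N => z.2) (fun y : fibers F => y i)).
  exact: cvg_snd.
exact: (@proj_continuous _ (fun i => F i : topologicalType) i).
Qed.

Lemma multiwarped_chart_dom_open (c : chart N) : open (chart_dom c).
Proof.
rewrite openE => z cz; apply: (filter_forall (F := nbhs z)) => i.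
have fc := @fiber_comp_continuous i z.
have : \forall x \near z, chart_dom (c i) (fiber_comp i x).
  by apply: fc; apply: open_nbhs_nbhs; split; [exact: chart_dom_open|exact: cz].
exact.
Qed.

Lemma tau_coordE (c : chart N) (z : N) : tau_comp z =
  lsubmx (chart_coord c z : 'rV[R]_(1 + \sum_i mdim (F i))) 0 0.
Proof. by rewrite /= /multiwarped_coord row_mxKl mxE eqxx mulr1n. Qed.

Lemma fiber_coordE (c : chart N) (z : N) i : chart_coord (c i) (fiber_comp i z) =
  submxrow (rsubmx (chart_coord c z : 'rV[R]_(1 + \sum_i mdim (F i)))) i.
Proof. by rewrite /= /multiwarped_coord row_mxKr mxrowK. Qed.

Lemma multiwarped_curve_dom_open (J : set R) (sigma : R -> N) (c : chart N) : open J ->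
  (forall t, J t -> {for t, continuous sigma}) -> open (J `&` sigma @^-1` chart_dom c).
Proof.
move=> Jo cs; rewrite openE => t [Jt ct]; apply: filterI; first exact: open_nbhs_nbhs.
apply: cs => //; apply: open_nbhs_nbhs; split => //; exact: multiwarped_chart_dom_open.
Qed.

Section Components.
Variables (J : set R) (sigma : R -> N).
Hypotheses (Jo : open J) (ss : smooth_curve J sigma).

Lemma smooth_fiber i : smooth_curve J (fiber_comp i \o sigma).
Proof.
have [cs sm] := ss; split.
  move=> t Jt; apply: (@continuous_comp _ _ _ sigma (fiber_comp i)); first exact: cs.
  exact: fiber_comp_continuous.
move=> d k; apply: Ck_on_pointwise => t [Jt dt].
(* The fiber chart [d] is completed to a chart of the product around [sigma t] by the preferred
   charts of the other components. *)
pose c : chart N := dfwith (fun j => chart_at (fiber_comp j (sigma t))) i d.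
have ci : c i = d by rewrite /c dfwithin.
have ct : (J `&` sigma @^-1` chart_dom c) t.
  split => // j; have [->|ji] := eqVneq j i; first by rewrite ci.
  by rewrite /c dfwithout; [exact: chart_at_dom|rewrite eq_sym].
apply: (@Ck_on_sub _ _ _ _ (J `&` sigma @^-1` chart_dom c)); first by move=> _ ->.
have -> : chart_coord d \o (fiber_comp i \o sigma) =
    fun s => submxrow (rsubmx ((chart_coord c \o sigma) s : 'rV[R]_(1 + \sum_i mdim (F i)))) i.
  by apply/funext => s; rewrite -ci /= fiber_coordE.
have Vo := @multiwarped_curve_dom_open J sigma c Jo cs.
apply/(Ck_on_mxP _ _ Vo) => i0 j.
have [+ _] := Ck_on_mxP k (chart_coord c \o sigma) Vo => /(_ (sm c k) i0 (rshift 1 (tagnat.Rank i j))).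
by congr Ck_on; apply/funext => s; rewrite !mxE.
Qed.

Lemma velocity_is_derive t : J t -> is_derive t (1 : R)
  (chart_coord (chart_at (sigma t)) \o sigma) (velocity sigma t).
Proof.
move=> Jt; have [_ /(_ (chart_at (sigma t)) 1%N)/Ck_on_is_derive[+ _]] := ss.
rewrite /velocity derive1E; apply; split => // i; exact: chart_at_dom.
Qed.

Lemma is_derive_tau t : J t -> is_derive t (1 : R) (tau_comp \o sigma)
  (lsubmx (velocity sigma t : 'rV[R]_(1 + \sum_i mdim (F i))) 0 0).
Proof.
move=> /velocity_is_derive/is_derive_mxP/(_ 0 (lshift _ 0)).
rewrite [lsubmx _ _ _]mxE.
rewrite (_ : (fun y => _) = tau_comp \o sigma)//.
by apply/funext => s; rewrite [RHS]/comp (tau_coordE (chart_at (sigma t))) [RHS]mxE.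
Qed.

Lemma velocity_fiber t i : J t ->
  submxrow (rsubmx (velocity sigma t : 'rV[R]_(1 + \sum_i mdim (F i)))) i =
  velocity (fiber_comp i \o sigma) t.
Proof.
move=> /velocity_is_derive/is_derive_mxP H.
have dv : is_derive t (1 : R) (chart_coord (chart_at (fiber_comp i (sigma t))) \o (fiber_comp i \o sigma))
    (submxrow (rsubmx (velocity sigma t : 'rV[R]_(1 + \sum_i mdim (F i)))) i).
  apply/is_derive_mxP => i0 j; rewrite !mxE.
  have := H i0 (rshift 1 (tagnat.Rank i j)).
  rewrite (_ : (fun y => _) = (fun y =>
    (chart_coord (chart_at (fiber_comp i (sigma t))) \o (fiber_comp i \o sigma)) y i0 j))//.
  apply/funext => s; rewrite /= (fiber_coordE (chart_at (sigma t)) (sigma s) i).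
  by rewrite !mxE.
by have [_ E] := dv; rewrite [RHS]/velocity derive1E; exact: esym E.
Qed.

End Components.
End MultiwarpedCurves.

(** By Lagrange's identity. *)
Lemma cauchy_schwarz_sum {R : realType} (n : nat) (x y : 'I_n -> R) :
  (\sum_i x i * y i) ^+ 2 <= (\sum_i x i ^+ 2) * (\sum_i y i ^+ 2).
Proof.
have H : 0 <= \sum_i \sum_j (x i * y j - x j * y i) ^+ 2.
  by apply: sumr_ge0 => i _; apply: sumr_ge0 => j _; exact: sqr_ge0.
have E : \sum_i \sum_j (x i * y j - x j * y i) ^+ 2 =
   2 * ((\sum_i x i ^+ 2) * (\sum_i y i ^+ 2) - (\sum_i x i * y i) ^+ 2).
  have E1 : (\sum_i x i ^+ 2) * (\sum_i y i ^+ 2) = \sum_i \sum_j x i ^+ 2 * y j ^+ 2.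
    by rewrite mulr_suml; apply: eq_bigr => i _; rewrite mulr_sumr.
  have E2 : (\sum_i x i ^+ 2) * (\sum_i y i ^+ 2) = \sum_i \sum_j x j ^+ 2 * y i ^+ 2.
    by rewrite E1 exchange_big.
  have E3 : (\sum_i x i * y i) ^+ 2 = \sum_i \sum_j (x i * y i) * (x j * y j).
    by rewrite expr2 mulr_suml; apply: eq_bigr => i _; rewrite mulr_sumr.
  have -> : 2 * ((\sum_i x i ^+ 2) * (\sum_i y i ^+ 2) - (\sum_i x i * y i) ^+ 2) =
    (\sum_i x i ^+ 2) * (\sum_i y i ^+ 2) +
    (\sum_i x i ^+ 2) * (\sum_i y i ^+ 2) - 2 * (\sum_i x i * y i) ^+ 2 by ring.
  rewrite {1}E1 E2 E3 mulr_sumr -big_split -sumrB/=; apply: eq_bigr => i _.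
  rewrite mulr_sumr -big_split -sumrB/=; apply: eq_bigr => j _; ring.
by move: H; rewrite E pmulr_rge0// subr_ge0.
Qed.

Section CausalTravel.
Context {R : realType} (n : nat) (a b : \bar R) (F : 'I_n -> metric_manifold R)
  (f : 'I_n -> R -> R).
Hypothesis F_riemannian : forall i, riemannian (F i).
Hypothesis f_gt0 : forall i t, open_interval a b t -> 0 < f i t.
Local Notation N := (multiwarped a b F f).
Local Notation tau := (@tau_comp R n a b F f).
Local Notation fib := (@fiber_comp R n a b F f).
Local Notation vtau v := (lsubmx (v : 'rV[R]_(1 + \sum_i mdim (F i))) 0 0).

Definition inv_sq (i : 'I_n) (y : R) : R := (f i y ^+ 2)^-1.

Lemma tau_in (z : N) : open_interval a b (tau z).
Proof. exact: set_mem (valP z.1). Qed.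

(* Cauchy-Schwarz, after writing c_i |x_i'| = (c_i / f_i) (f_i |x_i'|). *)
Lemma causal_speed_bound (J : set R) (sigma : R -> N) (c : 'I_n -> R) (s t : R) :
  open J -> smooth_curve J sigma -> J t -> (forall i, 0 <= c i) -> `|s| = 1 ->
  causal (sigma t) (velocity sigma t) -> 0 < s * vtau (velocity sigma t) ->
  \sum_i c i * Num.sqrt (speed2 (fib i \o sigma) t) <=
  s * (vtau (velocity sigma t) * Num.sqrt (\sum_i c i ^+ 2 * inv_sq i (tau (sigma t)))).
Proof.
move=> Jo ss Jt c0 s1 cv sv.
set v0 := vtau _ in sv *; set W := \sum_i _ * inv_sq i _.
have f0 i : 0 < f i (tau (sigma t)) by apply: f_gt0; exact: tau_in.
have W0 : 0 <= W by apply: sumr_ge0 => i _; rewrite mulr_ge0 ?sqr_ge0// invr_ge0 sqr_ge0.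
have m0 i : 0 <= speed2 (fib i \o sigma) t.
  exact: (speed2_ge0 (F_riemannian i) _ Jt).
(* This is the causality condition, with the fiber part moved to one side. *)
have le0 : \sum_i f i (tau (sigma t)) ^+ 2 * speed2 (fib i \o sigma) t <= v0 ^+ 2.
  have : metric (sigma t) (velocity sigma t) (velocity sigma t) <= 0.
    by case: cv => [/ltW//|[->]].
  rewrite (multiwarped_metricE (sigma t)) -/v0.
  have -> : \sum_i f i (tau (sigma t)) ^+ 2 * speed2 (fib i \o sigma) t =
      \sum_i f i (val (sigma t).1) ^+ 2 * metric ((sigma t).2 i)
        (submxrow (rsubmx (velocity sigma t : 'rV[R]_(1 + \sum_i mdim (F i)))) i)
        (submxrow (rsubmx (velocity sigma t : 'rV[R]_(1 + \sum_i mdim (F i)))) i).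
    apply: eq_bigr => i _; congr (_ * _).
    have E := velocity_fiber F_riemannian ss i Jt.
    exact: (congr1 (fun v => metric ((sigma t).2 i) v v) (esym E)).
  by rewrite addrC subr_le0 -expr2.
have sv0 : s * v0 = `|v0| by rewrite -[LHS]gtr0_norm// normrM s1 mul1r.
rewrite mulrA sv0 -sqrtr_sqr -sqrtrM ?sqr_ge0//.
set L := \sum_i _; have L0 : 0 <= L.
  by apply: sumr_ge0 => i _; rewrite mulr_ge0// sqrtr_ge0.
rewrite -[L]ger0_norm// -sqrtr_sqr ler_sqrt ?(mulr_ge0 (sqr_ge0 v0) W0)//.
have -> : L = \sum_i (c i * (f i (tau (sigma t)))^-1) *
    (f i (tau (sigma t)) * Num.sqrt (speed2 (fib i \o sigma) t)).
  by apply: eq_bigr => i _; field; rewrite gt_eqF.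
apply: (le_trans (cauchy_schwarz_sum _ _)); rewrite mulrC.
have -> : \sum_i (c i / f i (tau (sigma t))) ^+ 2 = W.
  by apply: eq_bigr => i _; rewrite exprMn exprVn.
rewrite ler_wpM2r// (le_trans _ le0)// le_eqVlt; apply/orP; left; apply/eqP.
by apply: eq_bigr => i _; rewrite exprMn sqr_sqrtr.
Qed.

Variables (s : R) (gamma : R -> N) (d : 'I_n -> R).
Hypothesis s1 : `|s| = 1.
Hypothesis pg : piecewise_smooth (fun (p : N) v => causal p v /\ 0 < s * vtau v) gamma.
Hypothesis dd : forall i, riemannian_dist (fib i (gamma 0)) (fib i (gamma 1)) = (d i)%:E.

(** It keeps the curve between the two extreme values of [tau], so that an antiderivative is
    required only there. *)
Lemma causal_tau_mono : forall t u, 0 <= t -> t <= u -> u <= 1 ->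
  s * tau (gamma t) <= s * tau (gamma u).
Proof.
have [l [pl /eqP ll] Hl] := pg.
pose P (p q : R) := forall t u, p <= t -> t <= u -> u <= q -> s * tau (gamma t) <= s * tau (gamma u).
suff : P 0 (last 0 l) by rewrite ll.
apply: partition_ind => //.
- by move=> p t u pt tu up; have -> : t = u by lra.
- move=> p q r pq qr H1 H2 t u pt tu ur.
  have [uq|qu] := leP u q; first exact: H1.
  have [tq|qt] := leP t q; last by apply: H2 => //; exact: ltW.
  by apply: (le_trans (H1 t q pt tq (lexx _))); apply: H2 => //; exact: ltW.
move=> k kl pq; have [e e0 [sigma ss Hs]] := Hl k kl.
set p := nth 0 (0 :: l) k in pq ss Hs *; set q := nth 0 l k in pq ss Hs *.
move=> t u pt tu uq.
have Jo := @open_itvoo R (p - e) (q + e).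
have [gt _] := Hs t (introT andP (conj pt (le_trans tu uq))).
have [gu _] := Hs u (introT andP (conj (le_trans pt tu) uq)).
rewrite gt gu.
apply: (@derive_ge0_le R (fun r => s * tau (sigma r)) (fun r => s * vtau (velocity sigma r))
  t u tu) => r /andP[tr ru].
  apply: is_deriveMl_pt; apply: (is_derive_tau F_riemannian ss).
  by rewrite /= in_itv/=; apply/andP; split; lra.
have [|_ [_ /ltW]] := Hs r; last by [].
by rewrite in_itv/= (le_trans pt tr) (le_trans ru uq).
Qed.

(** The pointwise speed bounds are integrated over the smooth pieces, and the fiber components are
    at least as long as the distances [d]. The sign [s] treats future (1) and past (-1) curves
    together. *)
Lemma causal_travel (c : 'I_n -> R) (G : R -> R) : (forall i, 0 <= c i) ->
  (forall y, s * tau (gamma 0) <= s * y <= s * tau (gamma 1) ->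
    is_derive y (1 : R) G (Num.sqrt (\sum_i c i ^+ 2 * inv_sq i y))) ->
  \sum_i d i * c i <= s * (G (tau (gamma 1)) - G (tau (gamma 0))).
Proof.
move=> c0 dG.
have [l [pl /eqP ll] Hl] := pg.
pose phi i t := Num.sqrt (speed2 (fib i \o gamma) t).
pose K t := s * G (tau (gamma t)).
have l01 p q k : (k < size l)%N -> p = nth 0 (0 :: l) k -> q = nth 0 l k -> 0 <= p /\ q <= 1.
  move=> kl -> ->; have itv : itv_partition 0 1 l by split => //; apply/eqP.
  have := itv_partition_nth_ge (leqW kl) itv; have := itv_partition_nth_le (m := k.+1) _ itv => /(_ kl)/=.
  rewrite (set_nth_default 0)// => ->; rewrite (set_nth_default 0)//=.
  exact: ltnW.
have : length_piece phi c K 0 (last 0 l).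
  apply: partition_ind => //.
  - exact: length_piece_refl.
  - by move=> p q r; apply: length_piece_trans => i x; exact: sqrtr_ge0.
  move=> k kl pq; have [e e0 [sigma ss Hs]] := Hl k kl.
  have [p0 q1] := l01 _ _ k kl erefl erefl.
  set p := nth 0 (0 :: l) k in pq ss Hs p0 *; set q := nth 0 l k in pq ss Hs q1 *.
  have Jo := @open_itvoo R (p - e) (q + e).
  have inJ x : p <= x <= q -> `]p - e, q + e[%classic x.
    by move=> /andP[px xq]; rewrite /= in_itv/=; apply/andP; split; lra.
  have gs x : p <= x <= q -> gamma x = sigma x.
    by move=> xpq; have [] := Hs x; rewrite ?in_itv.
  have [ll' Hll Hc] : length_piece phi c (fun t => s * G (tau (sigma t))) p q.
    apply: (@length_piece_smooth R n phi c _ p q e (fun i => fun t => Num.sqrt (speed2 (fib i \o sigma) t))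
      (fun t => s * (vtau (velocity sigma t) * Num.sqrt (\sum_i c i ^+ 2 * inv_sq i (tau (sigma t))))) pq e0).
    - move=> i x xpq; apply: (@continuous_comp _ _ _ (speed2 (fib i \o sigma)) Num.sqrt).
        apply: (speed2_continuous (F_riemannian i) Jo (smooth_fiber F_riemannian Jo ss i)).
        by rewrite /= in_itv.
      exact: sqrt_continuous.
    - move=> i x xpq; rewrite /phi; congr Num.sqrt.
      (* On the open piece the two curves agree in a neighborhood, hence have the same velocity; at
         the break points they need not. *)
      have ng : \forall y \near x, gamma y = sigma y.
        have : \forall y \near x, y \in `]p, q[.
          by apply: near_in_itvoo; rewrite in_itv.
        apply: filterS => y; rewrite in_itv/= => /andP[py yq]; apply: gs.
        by rewrite (ltW py) (ltW yq).
      have gx := nbhs_singleton ng.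
      have Ev : velocity (fib i \o gamma) x = velocity (fib i \o sigma) x.
        rewrite /velocity /= gx !derive1E; apply: near_eq_derive.
        by apply: filterS ng => y /= ->.
      by rewrite /speed2 Ev /= gx.
    - move=> x xpq; apply: is_deriveMl_pt.
      have dt := is_derive_tau F_riemannian ss (inJ x xpq).
      have xr : s * tau (gamma 0) <= s * tau (sigma x) <= s * tau (gamma 1).
        rewrite -gs//; move: xpq => /andP[px xq].
        by rewrite !causal_tau_mono//; lra.
      have dGx := dG _ xr.
      by apply: is_derive_eq (@is_derive1_comp _ G (tau \o sigma) x _ _ _ _) _; rewrite mulrC.
    - move=> x xpq; have [|_ [cv sv]] := Hs x; first by rewrite in_itv.
      exact: (causal_speed_bound Jo ss (inJ x xpq) c0 s1 cv sv).
  exists ll' => //; rewrite /K !gs ?lexx ?(ltW pq)//.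
rewrite ll => -[L HL Hc].
rewrite mulrBr (le_trans _ Hc)//; apply: ler_sum => i _; rewrite mulrC ler_wpM2l//.
rewrite -lee_fin -dd; have [_ <-] := HL i.
(* The projected curve is itself a competitor in the infimum defining the distance. *)
apply: ereal_inf_lbound; exists (fib i \o gamma) => //; split => //.
exists l; first by split => //; apply/eqP.
move=> k kl; have [e e0 [sigma ss Hs]] := Hl k kl.
exists e => //; exists (fib i \o sigma).
  by apply: (smooth_fiber F_riemannian _ ss); exact: open_itvoo.
by move=> t /Hs[/= -> _].
Qed.

End CausalTravel.

(** * Geodesics of multiwarped products *)

(** The difference quotients on both sides are literally equal, so [h] has to be derivable in a
    single direction only. *)
Lemma is_derive_comp_line {R : realType} {V W X : normedModType R} (pi : V -> W) (h : W -> X)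
    (u w : V) dh :
  (forall t : R, pi (t *: w + u) = t *: pi w + pi u) ->
  is_derive (pi u) (pi w) h dh -> is_derive u w (fun y => h (pi y)) dh.
Proof.
move=> piE [dv <-].
have E : (fun t : R => t^-1 *: (((fun y => h (pi y)) \o shift u) (t *: w) - h (pi u))) =
         (fun t : R => t^-1 *: ((h \o shift (pi u)) (t *: pi w) - h (pi u))).
  by apply/funext => t /=; rewrite piE.
by apply: DeriveDef; rewrite /derivable /derive E.
Qed.

Section MultiwarpedGram.
Context {R : realType} (n : nat) (a b : \bar R) (F : 'I_n -> metric_manifold R)
  (f : 'I_n -> R -> R).
Local Notation N := (multiwarped a b F f).
Local Notation vec := 'rV[R]_(multiwarped_dim F).

Definition tau_part (v : vec) : R := lsubmx (v : 'rV[R]_(1 + \sum_i mdim (F i))) 0 0.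
Definition fiber_part (i : 'I_n) (v : vec) : 'rV[R]_(mdim (F i)) :=
  submxrow (rsubmx (v : 'rV[R]_(1 + \sum_i mdim (F i)))) i.

Lemma tau_partP t (v w : vec) : tau_part (t *: v + w) = t * tau_part v + tau_part w.
Proof. by rewrite /tau_part !mxE. Qed.

Lemma fiber_partP i t (v w : vec) : fiber_part i (t *: v + w) = t *: fiber_part i v + fiber_part i w.
Proof. by apply/rowP => j; rewrite !mxE. Qed.

(** Here [y] is an arbitrary coordinate vector, not the image of a point, so that both sides can be
    differentiated in [y]. *)
Lemma multiwarped_bilinE (c : forall i, chart (F i)) (y v w : vec) :
  bilin (multiwarped_gram f c y) v w = - (tau_part v * tau_part w) +
  \sum_i f i (tau_part y) ^+ 2 *
    bilin (gram (c i) (fiber_part i y)) (fiber_part i v) (fiber_part i w).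
Proof.
rewrite /bilin /= /multiwarped_gram.
rewrite -[in LHS](hsubmxK (v : 'rV[R]_(1 + \sum_i mdim (F i)))).
rewrite -[in LHS](hsubmxK (w : 'rV[R]_(1 + \sum_i mdim (F i)))) tr_row_mx mul_row_block.
rewrite !mulmx0 !addr0 add0r mul_row_col mulmxN mulmx1 mulNmx.
rewrite mxE; congr (_ + _); first by rewrite !mxE big_ord1 /tau_part !mxE.
have E (A : 'rV[R]_(\sum_i mdim (F i))) : A = \mxrow_i submxrow A i.
  by rewrite submxrowK.
rewrite [in LHS](E (rsubmx (v : 'rV[R]_(1 + \sum_i mdim (F i))))).
rewrite [in LHS](E (rsubmx (w : 'rV[R]_(1 + \sum_i mdim (F i))))) mul_mxrow_mxdiag.
rewrite tr_mxrow mul_mxrow_mxcol summxE; apply: eq_bigr => i _.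
by rewrite -scalemxAr -scalemxAl mxE.
Qed.

Lemma is_derive_fiber_part i (h : 'rV[R]_(mdim (F i)) -> R) (y w : vec) dh :
  is_derive (fiber_part i y) (fiber_part i w) h dh ->
  is_derive y w (fun x => h (fiber_part i x)) dh.
Proof. by apply: is_derive_comp_line => t; exact: fiber_partP. Qed.

Lemma is_derive_tau_part (h : R -> R) (y w : vec) dh :
  is_derive (tau_part y) (1 : R) h dh ->
  is_derive y w (fun x => h (tau_part x)) (tau_part w * dh).
Proof.
move=> H; apply: is_derive_comp_line; first by move=> t; exact: tau_partP.
exact: derive1_scale.
Qed.

Lemma differentiable_tau_part (h : R -> R) (y : vec) :
  derivable h (tau_part y) 1 -> differentiable (fun x => h (tau_part x)) y.
Proof.
move=> dh; apply: (@differentiable_comp _ _ _ _ tau_part h); last exact/derivable1_diffP.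
rewrite (_ : tau_part = fun x => x 0 (lshift _ 0)); first exact: differentiable_coord.
by apply/funext => x; rewrite /tau_part mxE.
Qed.

Lemma differentiable_fiber_part i (h : 'rV[R]_(mdim (F i)) -> R) (y : vec) :
  differentiable h (fiber_part i y) -> differentiable (fun x => h (fiber_part i x)) y.
Proof.
apply: (@differentiable_comp _ _ _ _ (fiber_part i) h).
have E : fiber_part i = mxsub id (fun k => rshift 1 (tagnat.Rank i k)).
  by apply/funext => x; apply/rowP => k; rewrite !mxE.
rewrite E; apply: linear_differentiable => x.
apply: (@cvg_mx _ _ _ _ (nbhs x)) => j k; rewrite (ord1 j) mxE.
rewrite (_ : (fun z : vec => _) = (fun z : vec => z 0 (rshift 1 (tagnat.Rank i k)))).
  exact: coord_continuous.
by apply/funext => z; rewrite mxE.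
Qed.

Hypothesis F_riemannian : forall i, riemannian (F i).
Variables (c : forall i, chart (F i)) (z : N).
Hypothesis cz : forall i, chart_dom (c i) (fiber_comp i z).
Let x : vec := chart_coord (m := N) c z.
Let G : vec -> 'M[R]_(multiwarped_dim F) := multiwarped_gram f c.

Lemma tau_part_coord : tau_part x = tau_comp z.
Proof. by rewrite (tau_coordE c). Qed.

Lemma fiber_part_coord i : fiber_part i x = chart_coord (c i) (fiber_comp i z).
Proof. by rewrite (@fiber_coordE _ _ _ _ _ _ c). Qed.

Lemma multiwarped_gram_sym : (G x)^T = G x.
Proof.
apply/matrixP => i j; rewrite mxE -!bilin_delta2 /G !multiwarped_bilinE.
rewrite mulrC; congr (_ + _); apply: eq_bigr => k _.
by rewrite bilin_sym// fiber_part_coord; exact: gram_sym.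
Qed.

Hypothesis f_neq0 : forall i, f i (tau_comp z) != 0.

(** Pairing a vector with its time reflection turns the Lorentzian form into a sum of nonnegative
    terms, which vanishes only for the zero vector. *)
Lemma multiwarped_gram_unit : G x \in unitmx.
Proof.
apply: bilin_nondegenerate => v H.
pose w : vec := row_mx (- tau_part v)%:M (rsubmx (v : 'rV[R]_(1 + \sum_i mdim (F i)))).
have w0 : tau_part w = - tau_part v by rewrite /tau_part row_mxKl mxE eqxx mulr1n.
have wi i : fiber_part i w = fiber_part i v by rewrite /fiber_part row_mxKr.
have g0 i : 0 <= bilin (gram (c i) (fiber_part i x)) (fiber_part i v) (fiber_part i v).
  by rewrite fiber_part_coord; exact: gram_ge0.
have := H w; rewrite /G multiwarped_bilinE w0 mulrN opprK -expr2.
under eq_bigr do rewrite wi.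
have s0 i : 0 <= f i (tau_part x) ^+ 2 *
    bilin (gram (c i) (fiber_part i x)) (fiber_part i v) (fiber_part i v).
  by rewrite mulr_ge0 ?sqr_ge0.
move=> /eqP; rewrite paddr_eq0 ?sqr_ge0 ?sumr_ge0// => /andP[].
rewrite sqrf_eq0 => /eqP v0; rewrite psumr_eq0// => /allP vi.
have fv i : fiber_part i v = 0.
  have := vi i (mem_index_enum _); rewrite mulf_eq0 sqrf_eq0 tau_part_coord (negbTE (f_neq0 i))/=.
  rewrite fiber_part_coord => /eqP; exact: gram_eq0.
rewrite -[v](hsubmxK (v : 'rV[R]_(1 + \sum_i mdim (F i)))).
have -> : lsubmx (v : 'rV[R]_(1 + \sum_i mdim (F i))) = 0.
  by apply/rowP => j; rewrite (ord1 j) -/(tau_part v) v0 mxE.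
have -> : rsubmx (v : 'rV[R]_(1 + \sum_i mdim (F i))) = 0.
  by apply/mxrowP => i; rewrite submxrow0; exact: fv.
exact: row_mx0.
Qed.

Variable f' : 'I_n -> R.
Hypothesis df : forall i, is_derive (tau_comp z) (1 : R) (f i) (f' i).

Lemma multiwarped_gram_differentiable j k : differentiable (fun y => G y j k) x.
Proof.
(* Entries are read off as values of the form on basis vectors, which avoids a case analysis on the
   blocks. *)
rewrite (_ : (fun _ => _) = (cst (- (tau_part (delta_mx 0 j) * tau_part (delta_mx 0 k))) +
  \sum_i (fun y => f i (tau_part y)) * (fun y => f i (tau_part y)) *
   (\sum_l \sum_l' cst (fiber_part i (delta_mx 0 j) 0 l) * (fun y => gram (c i) (fiber_part i y) l l')
     * cst (fiber_part i (delta_mx 0 k) 0 l'))) :> (vec -> R)); last first.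
  apply/funext => y; rewrite -bilin_delta2 /G multiwarped_bilinE fctE; congr (_ + _).
  rewrite fct_sumE; apply: eq_bigr => i _; rewrite 2!fctE expr2; congr (_ * _).
  rewrite bilinE fct_sumE; apply: eq_bigr => l _.
  by rewrite fct_sumE; apply: eq_bigr => l' _.
apply: differentiableD; first exact: differentiable_cst.
apply: differentiable_sum => i.
have dfi : differentiable (fun y => f i (tau_part y)) x.
  by apply: differentiable_tau_part; rewrite tau_part_coord; case: (df i).
apply: differentiableM; first exact: differentiableM.
apply: differentiable_sum => l; apply: differentiable_sum => l'.
apply: differentiableM; last exact: differentiable_cst.
apply: differentiableM; first exact: differentiable_cst.
apply: (@differentiable_fiber_part i (fun u => gram (c i) u l l')).
by rewrite fiber_part_coord; exact: gram_differentiable.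
Qed.

Lemma multiwarped_dgramE w v v' : bilin (dgram G x w) v v' =
  \sum_i (tau_part w * (2 * f i (tau_comp z) * f' i) *
            bilin (gram (c i) (fiber_part i x)) (fiber_part i v) (fiber_part i v') +
          f i (tau_comp z) ^+ 2 *
            bilin (dgram (gram (c i)) (fiber_part i x) (fiber_part i w)) (fiber_part i v) (fiber_part i v')).
Proof.
have [_ <-] := derive_bilin multiwarped_gram_differentiable w v v'.
rewrite (_ : (fun y => _) = (fun y => - (tau_part v * tau_part v') + \sum_i f i (tau_part y) ^+ 2 *
    bilin (gram (c i) (fiber_part i y)) (fiber_part i v) (fiber_part i v'))); last first.
  by apply/funext => y; rewrite /G multiwarped_bilinE.
suff [] : is_derive x w (fun y => - (tau_part v * tau_part v') + \sum_i f i (tau_part y) ^+ 2 *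
    bilin (gram (c i) (fiber_part i y)) (fiber_part i v) (fiber_part i v'))
  (0 + \sum_i (tau_part w * (2 * f i (tau_comp z) * f' i) *
            bilin (gram (c i) (fiber_part i x)) (fiber_part i v) (fiber_part i v') +
          f i (tau_comp z) ^+ 2 *
            bilin (dgram (gram (c i)) (fiber_part i x) (fiber_part i w)) (fiber_part i v) (fiber_part i v'))).
  by move=> _ ->; rewrite add0r.
have d0 : is_derive x w (fun=> - (tau_part v * tau_part v')) 0 by exact: is_derive_cst.
apply: (is_deriveD_pt d0).
apply: is_derive_sum_pt => i.
rewrite -tau_part_coord.
apply: is_deriveM_pt.
  apply: (is_derive_tau_part (h := fun t => f i t ^+ 2)); apply: is_derive_sqr_pt.
  by rewrite tau_part_coord.
apply: (@is_derive_fiber_part i (fun u => bilin (gram (c i) u) (fiber_part i v) (fiber_part i v'))).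
by apply: derive_bilin => j k; rewrite fiber_part_coord; exact: gram_differentiable.
Qed.

(** Besides the fiber terms, the warping contributes a drag on the fiber velocities (the factor
    [tau_part v]) and a force on the time component (the factor [tau_part w]). *)
Lemma multiwarped_geo_covE v w : geo_cov G x v w =
  \sum_i (2 * f i (tau_comp z) * f' i *
     (tau_part v * bilin (gram (c i) (fiber_part i x)) (fiber_part i v) (fiber_part i w)
      - 2^-1 * tau_part w * bilin (gram (c i) (fiber_part i x)) (fiber_part i v) (fiber_part i v))
   + f i (tau_comp z) ^+ 2 * geo_cov (gram (c i)) (fiber_part i x) (fiber_part i v) (fiber_part i w)).
Proof.
have E1 := multiwarped_dgramE v v w; have E2 := multiwarped_dgramE w v v.
apply: (etrans (congr2 (fun s t => s - 2^-1 * t) E1 E2)).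
rewrite mulr_sumr -sumrB; apply: eq_bigr => i _.
rewrite /geo_cov; ring.
Qed.

End MultiwarpedGram.

Section MatrixCurves.
Context {R : realType} {m n : nat}.

Lemma is_derive_curve_comp (y : R -> 'M[R]_(m, n)) (u : R -> R) (t du : R) dy :
  is_derive (u t) (1 : R) y dy -> is_derive t (1 : R) u du ->
  is_derive t (1 : R) (fun s => y (u s)) (du *: dy).
Proof.
move=> /is_derive_mxP Hy Hu; apply/is_derive_mxP => i j; rewrite mxE mulrC.
exact: (@is_derive1_comp _ (fun s => y s i j) u).
Qed.

Lemma is_derive_scale_curve (g : R -> R) (y : R -> 'M[R]_(m, n)) (t dg : R) dy :
  is_derive t (1 : R) g dg -> is_derive t (1 : R) y dy ->
  is_derive t (1 : R) (fun s => g s *: y s) (dg *: y t + g t *: dy).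
Proof.
move=> Hg /is_derive_mxP Hy; apply/is_derive_mxP => i j; rewrite !mxE.
rewrite (_ : (fun s => _) = fun s => g s * y s i j); last by apply/funext => s; rewrite mxE.
exact: is_deriveM_pt.
Qed.

End MatrixCurves.

Section MultiwarpedGeodesic.
Context {R : realType} (n : nat) (a b : \bar R) (F : 'I_n -> metric_manifold R)
  (f : 'I_n -> R -> R).
Hypothesis F_riemannian : forall i, riemannian (F i).
Hypothesis f_gt0 : forall i t, open_interval a b t -> 0 < f i t.
Local Notation N := (multiwarped a b F f).
Local Notation vec := 'rV[R]_(multiwarped_dim F).

Definition join_parts (s : R) (v : forall i, 'rV[R]_(mdim (F i))) : vec :=
  row_mx s%:M (\mxrow_i v i).

Lemma tau_part_join s v : tau_part (join_parts s v) = s.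
Proof. by rewrite /tau_part row_mxKl mxE eqxx mulr1n. Qed.

Lemma fiber_part_join s v i : fiber_part i (join_parts s v) = v i.
Proof. by rewrite /fiber_part row_mxKr mxrowK. Qed.

Lemma multiwarped_coordE (c : chart N) (z : N) : chart_coord c z =
  join_parts (tau_comp z) (fun i => chart_coord (c i) (fiber_comp i z)).
Proof. by []. Qed.

Lemma is_derive_join (s : R -> R) (v : forall i, R -> 'rV[R]_(mdim (F i))) (t ds : R) dv :
  is_derive t (1 : R) s ds -> (forall i, is_derive t (1 : R) (v i) (dv i)) ->
  is_derive t (1 : R) (fun x => join_parts (s x) (fun i => v i x)) (join_parts ds dv).
Proof.
move=> Hs Hv; apply/is_derive_mxP => i0 j.
have [k ->|k ->] := split_ordP j.
  rewrite (_ : (fun x => _) = s); first by rewrite /join_parts row_mxEl mxE !ord1 eqxx mulr1n.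
  by apply/funext => x; rewrite /join_parts row_mxEl mxE !ord1 eqxx mulr1n.
have /is_derive_mxP/(_ i0 (tagnat.sig2 k)) := Hv (tagnat.sig1 k).
rewrite /join_parts row_mxEr mxE.
by congr is_derive; apply/funext => x; rewrite row_mxEr mxE.
Qed.

Variables (J : set R) (z : R -> N) (K : 'I_n -> set R) (gam : forall i, R -> F i).
Variables (d q : 'I_n -> R) (phi' : 'I_n -> R -> R) (tau p : R -> R) (u : 'I_n -> R -> R).
Local Notation phi := (inv_sq f).
Hypotheses (Jo : open J) (Ko : forall i, open (K i)).
Hypothesis zc : forall t, J t -> {for t, continuous z}.
Hypothesis ztau : forall t, J t -> tau_comp (z t) = tau t.
Hypothesis zfib : forall i t, J t -> fiber_comp i (z t) = gam i (u i t).
Hypothesis uK : forall i t, J t -> K i (u i t).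
Hypothesis geo : forall i, geodesic (K i) (gam i).
Hypothesis spd : forall i t, K i t -> speed2 (gam i) t = d i ^+ 2.
Hypothesis sphi : forall i, smooth_on (open_interval a b) (phi i).
Hypothesis sphi' : forall i, smooth_on (open_interval a b) (phi' i).
Hypothesis Io : open (open_interval a b).
Hypothesis dtau : forall t, J t -> is_derive t (1 : R) tau (p t).
Hypothesis dp : forall t, J t ->
  is_derive t (1 : R) p (force (fun i => d i ^+ 2) phi' q (tau t)).
Hypothesis du : forall i t, J t -> is_derive t (1 : R) (u i) (q i * phi i (tau t)).

Lemma tau_itv t : J t -> open_interval a b (tau t).
Proof. by move=> Jt; rewrite -ztau//; exact: tau_in. Qed.

Lemma multiwarped_smooth_curve : smooth_curve J z.
Proof.
split => // c k; set U := J `&` _.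
have Uo : open U by exact: multiwarped_curve_dom_open.
have UJ : U `<=` J by move=> t [].
have stau := smooth_tau Jo Io sphi' tau_itv dtau dp.
have su i := smooth_u Jo Io sphi sphi' tau_itv dtau dp du i.
apply: (@Ck_on_eq _ _ _ _ _ (fun t => join_parts (tau t) (fun i => chart_coord (c i) (gam i (u i t))))) => //.
  move=> t /UJ Jt; rewrite [RHS]/comp (multiwarped_coordE c) ztau//.
  by congr join_parts; apply: functional_extensionality_dep => i; rewrite zfib.
apply/Ck_on_mxP => // i0 j.
have [l ->|l ->] := split_ordP j.
  rewrite (_ : (fun x => _) = tau); first exact: Ck_on_sub (stau k).
  by apply/funext => x; rewrite /join_parts row_mxEl mxE !ord1 eqxx mulr1n.
pose i := tagnat.sig1 l.
rewrite (_ : (fun x => _) = (fun x => chart_coord (c i) (gam i (u i x)) i0 (tagnat.sig2 l))); last first.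
  by apply/funext => x; rewrite /join_parts row_mxEr mxE.
have [sg _] := geo i.
have Do := @curve_dom_open _ _ (F_riemannian i) _ _ (@Ko i) sg (c i).
apply: (@Ck_on_comp _ _ U _ (fun s => chart_coord (c i) (gam i s) i0 (tagnat.sig2 l)) (u i) Uo Do).
- move=> t [Jt ct]; split; first exact: uK.
  by rewrite /= -zfib//; exact: ct.
- by have [_ sg2] := sg; have [+ _] := Ck_on_mxP k (chart_coord (c i) \o gam i) Do; apply; exact: sg2.
- exact: Ck_on_sub (su i k).
Qed.

Hypothesis f' : 'I_n -> R -> R.
Hypothesis df : forall i y, open_interval a b y -> is_derive y (1 : R) (f i) (f' i y).
Hypothesis dphi : forall i y, open_interval a b y -> is_derive y (1 : R) (phi i) (phi' i y).

Lemma inv_sq_derivE i y : open_interval a b y ->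
  phi' i y = - (2 * f i y * f' i y / (f i y ^+ 2) ^+ 2).
Proof.
move=> Iy; have [_ <-] := dphi i Iy.
have f0 : f i y ^+ 2 != 0 by rewrite expf_neq0// gt_eqF// f_gt0.
by have [_ E] := @is_deriveV_pt _ _ (fun y => f i y ^+ 2) y 1 _ f0 (is_derive_sqr_pt (df i Iy)); exact: E.
Qed.

(** Tested against [w], the fiber accelerations cancel because each [gam i] is a geodesic and
    [geo_cov] is quadratic. The change of u_i' = q_i / f_i^2 compensates the drag of the warping,
    and the time component is the equation for [tau], with speed d_i on each fiber. *)
Lemma multiwarped_geodesic : geodesic J z.
Proof.
have ss := multiwarped_smooth_curve.
split => // c t Jt ct x.
pose y i := chart_coord (c i) \o gam i.
pose U := J `&` z @^-1` chart_dom c.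
have Uo : open U by exact: multiwarped_curve_dom_open.
have Ut : U t by [].
have sg i : smooth_curve (K i) (gam i) by case: (geo i).
have cu i s : U s -> curve_dom (K i) (gam i) (c i) (u i s).
  by move=> [Js cs]; split; [exact: uK|rewrite /= -zfib//; exact: cs].
have xE s : U s -> x s = join_parts (tau s) (fun i => y i (u i s)).
  move=> [Js _]; rewrite /x [LHS]/comp (multiwarped_coordE c) ztau//.
  by congr join_parts; apply: functional_extensionality_dep => i; rewrite zfib.
pose V s := join_parts (p s) (fun i => (q i * phi i (tau s)) *: derive1 (y i) (u i s)).
have dx s : U s -> is_derive s (1 : R) x (V s).
  move=> Us; have [Js _] := Us.
  have nU := open_nbhs_nbhs (conj Uo Us).
  apply: (@near_eq_is_derive _ _ _ (fun s => join_parts (tau s) (fun i => y i (u i s)))).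
    by apply: filterS nU => r Ur; rewrite xE.
  apply: (@is_derive_join tau (fun i s => y i (u i s))); first exact: dtau.
  move=> i; apply: is_derive_curve_comp; last exact: du.
  exact: (is_derive_coord (sg i) (cu i s Us)).
(* The acceleration in coordinates: time part, then reparametrization term and fiber
   acceleration. *)
pose A := join_parts (force (fun i => d i ^+ 2) phi' q (tau t)) (fun i =>
  (q i * (phi' i (tau t) * p t)) *: derive1 (y i) (u i t) +
  (q i * phi i (tau t)) *: ((q i * phi i (tau t)) *: derive1n 2 (y i) (u i t))).
have dV : is_derive t (1 : R) V A.
  apply: (@is_derive_join p (fun i s => (q i * phi i (tau s)) *: derive1 (y i) (u i s))); first exact: dp.
  move=> i; apply: is_derive_scale_curve.
    apply: is_deriveMl_pt; apply: (@is_derive1_comp _ (phi i) tau); last exact: dtau.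
    by apply: dphi; exact: tau_itv.
  apply: is_derive_curve_comp; last exact: du.
  exact: (is_derive2_coord (sg i) (cu i t Ut)).
have x1 s : U s -> derive1 x s = V s.
  by move=> /dx[_ <-]; rewrite derive1E.
have x2 : derive1n 2 x t = A.
  rewrite derive1nS derive1n1 derive1E.
  have [_ <-] := dV; apply: near_eq_derive.
  by apply: filterS (open_nbhs_nbhs (conj Uo Ut)) => s Us; exact: x1.
have f0 i : 0 < f i (tau_comp (z t)) by apply: f_gt0; exact: tau_in.
have f1 i : f i (tau_comp (z t)) != 0 by rewrite gt_eqF.
have df' i : is_derive (tau_comp (z t)) (1 : R) (f i) (f' i (tau_comp (z t))).
  by apply: df; exact: tau_in.
have cz i : chart_dom (c i) (fiber_comp i (z t)) by exact: ct.
apply: (proj2 (geodesic_eqP (G := multiwarped_gram f c) _ _ _ _ _)).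
- exact: (multiwarped_gram_differentiable F_riemannian cz df').
- exact: (multiwarped_gram_sym F_riemannian cz).
- exact: (multiwarped_gram_unit F_riemannian cz f1).
move=> w; rewrite x2 (x1 t Ut).
have -> : x t = chart_coord (m := N) c (z t) by [].
apply: (etrans (congr2 +%R (multiwarped_bilinE f c _ A w)
  (multiwarped_geo_covE F_riemannian cz df' (V t) w))).
rewrite !tau_part_join -addrA -big_split.
rewrite ztau// in f0 f1; rewrite -/(tau_comp (z t)) ztau//.
have It := tau_itv Jt.
have fibE i : fiber_part i (chart_coord (m := N) c (z t)) = y i (u i t).
  by rewrite fiber_part_coord /y /= zfib.
apply/eqP; rewrite addrC addr_eq0 opprK /force; apply/eqP.
rewrite mulr_sumr mulr_suml; apply: eq_bigr => i _.
rewrite /= fibE !fiber_part_join.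
set g := gram (c i) _; set v := derive1 _ _; set v2 := derive1n _ _ _; set wi := fiber_part i w.
have := geodesic_covariant (F_riemannian i) (geo i) (cu i t Ut) wi.
have := spd (uK i Jt); rewrite (speed2_chart (F_riemannian i) (@Ko i) (sg i) (cu i t Ut)).
rewrite -!/(y i) -/v -/v2 -/g.
(* With the derivative of f_i^(-2) expressed through f_i', the fiber equation and the constant speed
   turn the rest into an identity of rational functions. *)
rewrite (inv_sq_derivE i It).
have -> : phi i (tau t) = (f i (tau t) ^+ 2)^-1 by [].
move=> gvv /eqP; rewrite addr_eq0 => /eqP gv2.
rewrite geo_covZ; last first.
  move=> j k; apply: gram_differentiable => //.
  by have [_] := cu i t Ut.
rewrite bilinDl !bilinZl bilinZr gvv gv2.
field; exact: f1.
Qed.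

End MultiwarpedGeodesic.

(** * Assembly of the joining geodesic *)

Section OpenInterval.
Context {R : realType} (a b : \bar R).
Local Notation I := (open_interval a b).

Lemma open_interval_open : open I.
Proof.
rewrite (_ : I = [set t | (a < t%:E)%E] `&` [set t | (t%:E < b)%E])//.
apply: openI.
- case: a => [r| |]; [exact: open_gt| |].
    by rewrite (_ : [set t | _] = set0); [exact: open0|apply/seteqP; split].
  by rewrite (_ : [set t | _] = setT); [exact: openT|apply/seteqP; split => // t _; exact: ltNyr].
- case: b => [r| |]; [exact: open_lt| |].
    by rewrite (_ : [set t | _] = setT); [exact: openT|apply/seteqP; split => // t _; exact: ltry].
  by rewrite (_ : [set t | _] = set0); [exact: open0|apply/seteqP; split].
Qed.

Lemma open_interval_convex x y z : I x -> I z -> x <= y <= z -> I y.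
Proof.
move=> [ax _] [_ zb] /andP[xy yz]; split.
  by apply: lt_le_trans ax _; rewrite lee_fin.
by apply: le_lt_trans zb; rewrite lee_fin.
Qed.

Lemma open_interval_margin x y : I x -> I y ->
  exists2 e : R, 0 < e & forall t, x - e <= t <= y + e -> I t.
Proof.
move=> Ix Iy.
have E z : I z -> exists2 e : R, 0 < e & forall t, z - e <= t <= z + e -> I t.
  move=> Iz; have := open_interval_open; rewrite openE => /(_ z Iz) /nbhs_ballP[e /= e0 He].
  exists (e / 2); first lra.
  move=> t /andP[t1 t2]; apply: He; rewrite /ball/= ltr_norml; lra.
have [e1 e10 H1] := E x Ix; have [e2 e20 H2] := E y Iy.
exists (Num.min e1 e2); first by rewrite lt_min e10.
have m1 : Num.min e1 e2 <= e1 by rewrite ge_min lexx.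
have m2 : Num.min e1 e2 <= e2 by rewrite ge_min lexx orbT.
have m0 : 0 < Num.min e1 e2 by rewrite lt_min e10.
move=> t tb; apply: (@open_interval_convex (x - Num.min e1 e2) t (y + Num.min e1 e2)) => //.
  by apply: H1; lra.
by apply: H2; lra.
Qed.

End OpenInterval.

Lemma cvg_set_type {R : realType} (A : set R) (T : topologicalType) (g : T -> A) (x : T) :
  val (g y) @[y --> x] --> val (g x) -> g @ x --> g x.
Proof.
move=> cf U [/= _ [[W oW <-]]] /= Wx /filterS; apply; apply: cf.
exact: open_nbhs_nbhs.
Qed.

Lemma cvg_fibers {R : realType} (n : nat) (F : 'I_n -> metric_manifold R)
    (T : topologicalType) (g : T -> fibers F) (x : T) :
  (forall i, g y i @[y --> x] --> g x i) -> g @ x --> g x.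
Proof.
move=> cf; apply/cvg_sup => i U [/= _ [[W oW <-]]] /= Wx /filterS; apply; apply: cf.
exact: open_nbhs_nbhs.
Qed.

Lemma cvg_multiwarped {R : realType} (n : nat) (a b : \bar R) (F : 'I_n -> metric_manifold R)
    (f : 'I_n -> R -> R) (g : R -> multiwarped a b F f) (t : R) :
  {for t, continuous (@tau_comp _ _ _ _ _ _ \o g)} ->
  (forall i, {for t, continuous (@fiber_comp _ _ _ _ _ _ i \o g)}) ->
  {for t, continuous g}.
Proof.
move=> ct cf.
have c1 : (fun s => (g s).1) @ t --> (g t).1.
  exact: (@cvg_set_type _ (open_interval a b) R (fun s => (g s).1) t).
have c2 : (fun s => (g s).2) @ t --> (g t).2.
  exact: (@cvg_fibers _ _ F R (fun s => (g s).2) t).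
suff : (fun s => ((g s).1, (g s).2)) @ t --> ((g t).1, (g t).2).
  have -> : (fun s => ((g s).1, (g s).2)) = g by apply/funext => s; case: (g s).
  by rewrite -surjective_pairing.
exact: (@cvg_pair _ _ _ (nbhs t) (nbhs (g t).1) (nbhs (g t).2) _ _ _ _ _ c1 c2).
Qed.

Lemma piecewise_smooth_imply {R : realType} (M : metric_manifold R)
    (P Q : M -> 'rV[R]_(mdim M) -> Prop) gamma :
  (forall x v, P x v -> Q x v) -> piecewise_smooth P gamma -> piecewise_smooth Q gamma.
Proof.
move=> PQ [l pl H]; exists l => // k kl; have [e e0 [sigma ss Hs]] := H k kl.
by exists e => //; exists sigma => // t /Hs[-> /PQ].
Qed.

Section Assembly.
Context {R : realType} (n : nat) (a b : \bar R) (F : 'I_n -> metric_manifold R)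
  (f : 'I_n -> R -> R).
Hypothesis f_smooth : forall i, smooth_on (open_interval a b) (f i).
Hypothesis f_gt0 : forall i t, open_interval a b t -> 0 < f i t.
Local Notation I := (open_interval a b).

Lemma inv_sq_smooth i : smooth_on I (inv_sq f i).
Proof.
have Io := @open_interval_open R a b.
move=> k; apply: Ck_onV => //.
  by move=> t It; rewrite expf_neq0// gt_eqF// f_gt0.
rewrite (_ : (fun x => _) = fun x => f i x * f i x); last by apply/funext => x; rewrite expr2.
by apply: Ck_onM => //; exact: f_smooth.
Qed.

Lemma inv_sq_deriv_smooth i : smooth_on I ('D_1 (inv_sq f i)).
Proof. by move=> k; have [_ +] := Ck_on_is_derive (inv_sq_smooth i k.+1). Qed.

Lemma is_derive_inv_sq i t : I t -> is_derive t (1 : R) (inv_sq f i) ('D_1 (inv_sq f i) t).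
Proof. by have [+ _] := Ck_on_is_derive (inv_sq_smooth i 1%N); exact. Qed.

Hypothesis F_riemannian : forall i, riemannian (F i).
Local Notation N := (multiwarped a b F f).
Variables (z0 z1 : N) (gam : forall i, R -> F i) (d e q : 'I_n -> R).
Hypothesis e0 : forall i, 0 < e i.
Hypothesis geo : forall i, geodesic `]- e i, 1 + e i[ (gam i).
Hypothesis spd : forall i t, t \in `]- e i, 1 + e i[ -> speed2 (gam i) t = d i ^+ 2.
Hypothesis gam0 : forall i, gam i 0 = fiber_comp i z0.
Hypothesis gam1 : forall i, gam i 1 = fiber_comp i z1.
Variables (al be : R) (tau v : R -> R) (u : 'I_n -> R -> R).
Hypothesis I_al_be : forall t, al <= t <= be -> I t.
Hypothesis q_gt0 : forall i, 0 < q i.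
Hypotheses (tau0 : tau 0 = tau_comp z0) (tau1 : tau 1 = tau_comp z1).
Hypothesis u01 : forall i, u i 0 = 0 /\ u i 1 = 1.
Hypothesis tau_in_itv : forall t, 0 <= t <= 1 -> al < tau t < be.
Hypothesis dtau : forall t, is_derive t (1 : R) tau (v t).
Hypothesis dv : forall t, al <= tau t <= be ->
  is_derive t (1 : R) v (force (fun i => d i ^+ 2) (fun i => 'D_1 (inv_sq f i)) q (tau t)) /\
  forall i, is_derive t (1 : R) (u i) (q i * inv_sq f i (tau t)).

Lemma fiber_parameter_mono i s t : 0 <= s -> s <= t -> t <= 1 -> u i s <= u i t.
Proof.
move=> s0 st t1.
have inI r : s <= r <= t -> al <= tau r <= be.
  move=> /andP[sr rt]; have /andP[/ltW -> /ltW ->//] : al < tau r < be.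
  by apply: tau_in_itv; rewrite (le_trans s0 sr) (le_trans rt t1).
apply: (derive_ge0_le st (df := fun r => q i * inv_sq f i (tau r))) => r rst.
  by have [_] := dv (inI r rst); exact.
by rewrite /inv_sq mulr_ge0 ?invr_ge0 ?sqr_ge0// ltW.
Qed.

Lemma near_parameter_itv (t : R) : 0 <= t <= 1 ->
  \forall s \near t, al < tau s < be /\ (forall i, u i s \in `]- e i, 1 + e i[).
Proof.
move=> t01; have tt := tau_in_itv t01.
have ct : tau s @[s --> t] --> tau t := is_derive_continuous (dtau t).
have cu i : u i s @[s --> t] --> u i t.
  have [|_ H] := @dv t; first by move: tt => /andP[/ltW -> /ltW ->].
  exact: is_derive_continuous (H i).
have n1 : \forall s \near t, al < tau s < be.
  have : \forall y \near tau t, y \in `]al, be[ by apply: near_in_itvoo; rewrite in_itv.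
  by move/ct; apply: (@filterS _ (nbhs t)) => s /=; rewrite in_itv.
have n2 : \forall s \near t, forall i, u i s \in `]- e i, 1 + e i[.
  apply: (filter_forall (F := nbhs t)) => i.
  have : \forall y \near u i t, y \in `]- e i, 1 + e i[.
    apply: near_in_itvoo; rewrite in_itv/=.
    move: t01 => /andP[t0 t1]; have [ui0 ui1] := u01 i.
    have := fiber_parameter_mono i (lexx 0) t0 t1; have := fiber_parameter_mono i t0 t1 (lexx 1).
    by rewrite ui0 ui1; have := e0 i; lra.
  by move/cu.
by apply: filterS2 n1 n2.
Qed.

(** On [0, 1] the u_i increase from 0 to 1 and stay inside the open parameter intervals; continuity
    at 0 and 1 provides the extension. *)
Lemma parameter_margin : exists2 r : R, 0 < r & forall t, t \in `]- r, 1 + r[ ->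
  al < tau t < be /\ forall i, u i t \in `]- e i, 1 + e i[.
Proof.
have [r0 /= r00 H0] := (iffLR (nbhs_ballP _ _) (@near_parameter_itv 0 (introT andP (conj (lexx 0) ler01)))).
have [r1 /= r10 H1] := (iffLR (nbhs_ballP _ _) (@near_parameter_itv 1 (introT andP (conj ler01 (lexx 1))))).
exists (Num.min r0 r1); first by rewrite lt_min r00.
have m0 : Num.min r0 r1 <= r0 by rewrite ge_min lexx.
have m1 : Num.min r0 r1 <= r1 by rewrite ge_min lexx orbT.
move=> t; rewrite in_itv/= => /andP[t1 t2].
have [t0|t0] := ltP t 0; first by apply: H0; rewrite /ball/= ltr_norml; lra.
have [t1'|t1'] := ltP 1 t; first by apply: H1; rewrite /ball/= ltr_norml; lra.
by apply: (nbhs_singleton (near_parameter_itv _)); rewrite t0.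
Qed.

Lemma multiwarped_joining : exists gamma, joining_geodesic z0 z1 gamma.
Proof.
have [r r0 Hr] := parameter_margin.
(* The default [z0.1] is taken only where [tau] is outside the interval, which does not happen on
   the parameter interval [J]. *)
pose z t : N := (insubd z0.1 (tau t), fun i => gam i (u i t)).
have tauI t : al < tau t < be -> I (tau t).
  by move=> /andP[/ltW h1 /ltW h2]; apply: I_al_be; rewrite h1.
have ztau t : I (tau t) -> tau_comp (z t) = tau t.
  by move=> It; rewrite /tau_comp /z/= val_insubd mem_set.
pose J : set R := `]- r, 1 + r[%classic.
have Jo : open J by exact: open_itvoo.
have HJ t : J t -> al < tau t < be /\ forall i, u i t \in `]- e i, 1 + e i[ by exact: Hr.
have dvJ t : J t -> is_derive t (1 : R) v
      (force (fun i => d i ^+ 2) (fun i => 'D_1 (inv_sq f i)) q (tau t)) /\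
    forall i, is_derive t (1 : R) (u i) (q i * inv_sq f i (tau t)).
  by move=> /HJ[/andP[/ltW h1 /ltW h2] _]; apply: dv; rewrite h1.
have zc t : J t -> {for t, continuous z}.
  move=> Jt; apply: cvg_multiwarped.
    have nJ : \forall s \near t, tau s = tau_comp (z s).
      apply: filterS (open_nbhs_nbhs (conj Jo Jt)) => s /HJ[ts _].
      by rewrite ztau//; exact: tauI.
    have ct : tau s @[s --> t] --> tau t := is_derive_continuous (dtau t).
    have : tau_comp (z s) @[s --> t] --> tau t by apply: cvg_trans ct; exact: near_eq_cvg.
    by rewrite (nbhs_singleton nJ).
  move=> i; have [_ /(_ i) uit] := HJ t Jt; have [_ /(_ i) dui] := dvJ t Jt.
  have [[cg _] _] := geo i.
  apply: (@continuous_comp _ _ _ (u i) (gam i)); first exact: is_derive_continuous dui.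
  exact: cg.
exists z; split.
- exists r => //.
  apply: (@multiwarped_geodesic R n a b F f F_riemannian f_gt0 J z (fun i => `]- e i, 1 + e i[%classic)
    gam d q (fun i => 'D_1 (inv_sq f i)) tau v u Jo _ zc _ _ _ geo spd _ _ _ _ _ _ (fun i => 'D_1 (f i))).
  + by move=> i; exact: open_itvoo.
  + by move=> t /HJ[ts _]; apply: ztau; exact: tauI.
  + by [].
  + by move=> i t /HJ[_]; exact.
  + exact: inv_sq_smooth.
  + exact: inv_sq_deriv_smooth.
  + exact: open_interval_open.
  + by move=> t /dvJ[].
  + by move=> i t /dvJ[_]; exact.
  + by move=> i y Iy; have [+ _] := Ck_on_is_derive (f_smooth i 1%N); exact.
  + by move=> i y Iy; exact: is_derive_inv_sq.
- have E1 : insubd z0.1 (tau 0) = z0.1.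
    by apply: val_inj; rewrite val_insubd tau0 ifT//; exact: valP.
  have E2 : (fun i => gam i (u i 0)) = z0.2.
    by apply: functional_extensionality_dep => i; have [-> _] := u01 i; rewrite gam0.
  by rewrite /z E1 E2; case: (z0).
- have E1 : insubd z0.1 (tau 1) = z1.1.
    by apply: val_inj; rewrite val_insubd tau1 ifT//; exact: valP.
  have E2 : (fun i => gam i (u i 1)) = z1.2.
    by apply: functional_extensionality_dep => i; have [_ ->] := u01 i; rewrite gam1.
  by rewrite /z E1 E2; case: (z1).
Qed.

End Assembly.

Theorem theorem1 (R : realType) (n : nat) (a b : \bar R)
    (F : 'I_n -> metric_manifold R) (f : 'I_n -> R -> R)
    (n_gt0 : (0 < n)%N) (ab : (a < b)%E)
    (F_riemannian : forall i, riemannian (F i))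
    (F_weakly_convex : forall i, weakly_convex (F i))
    (f_smooth : forall i, smooth_on (open_interval a b) (f i))
    (f_gt0 : forall i t, open_interval a b t -> 0 < f i t)
    (joins_future : forall (z : multiwarped a b F f) (x : fibers F),
      exists gamma : R -> multiwarped a b F f,
        [/\ future_causal_curve (partial_tau a b F f) gamma,
            gamma 0 = z & line a b F f x (gamma 1)])
    (joins_past : forall (z : multiwarped a b F f) (x : fibers F),
      exists gamma : R -> multiwarped a b F f,
        [/\ past_causal_curve (partial_tau a b F f) gamma,
            gamma 0 = z & line a b F f x (gamma 1)]) :
  geodesically_connected (multiwarped a b F f).
Proof.
move=> z0 z1.
have [g [dg ed]] : exists g : forall i, R -> F i, exists de : 'I_n -> R * R,
  forall i, [/\ 0 <= (de i).1, 0 < (de i).2, geodesic `]- (de i).2, 1 + (de i).2[ (g i),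
   riemannian_dist (fiber_comp i z0) (fiber_comp i z1) = (de i).1%:E /\
   (g i 0 = fiber_comp i z0 /\ g i 1 = fiber_comp i z1) &
   forall t, t \in `]- (de i).2, 1 + (de i).2[ -> speed2 (g i) t = (de i).1 ^+ 2].
  have H i : exists ge : (R -> F i) * (R * R),
     [/\ 0 <= ge.2.1, 0 < ge.2.2, geodesic `]- ge.2.2, 1 + ge.2.2[ ge.1,
       riemannian_dist (fiber_comp i z0) (fiber_comp i z1) = ge.2.1%:E /\
       (ge.1 0 = fiber_comp i z0 /\ ge.1 1 = fiber_comp i z1) &
       forall t, t \in `]- ge.2.2, 1 + ge.2.2[ -> speed2 ge.1 t = ge.2.1 ^+ 2].
    have [g jg lg] := F_weakly_convex i (fiber_comp i z0) (fiber_comp i z1).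
    have [L [e [L0 e0 geo lL sp]]] := joining_geodesic_length (F_riemannian i) jg.
    by exists (g, (L, e)); split => //=; rewrite -lg lL; case: jg.
  (* The type of the curve depends on [i], so the choice is made through [cid]; the pair consists of
     length and parameter margin. *)
  exists (fun i => (projT1 (cid (H i))).1), (fun i => (projT1 (cid (H i))).2) => i.
  exact: (projT2 (cid (H i))).
pose d i := (dg i).1; pose e i := (dg i).2.
have d0 i : 0 <= d i by case: (ed i).
have dd i : riemannian_dist (fiber_comp i z0) (fiber_comp i z1) = (d i)%:E.
  by case: (ed i) => _ _ _ [].
have [gF [fF gF0 [tF _ gF1]]] := joins_future z0 z1.2.
have [gP [pP gP0 [tP _ gP1]]] := joins_past z0 z1.2.
have vtau (z : multiwarped a b F f) (v : 'rV[R]_(1 + \sum_i mdim (F i))) :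
  metric z (partial_tau a b F f z) v = - lsubmx v 0 0 by exact: metric_partial_tau.
have cF : piecewise_smooth (fun (p : multiwarped a b F f) v => causal p v /\
    0 < 1 * lsubmx (v : 'rV[R]_(1 + \sum_i mdim (F i))) 0 0) gF.
  by apply: piecewise_smooth_imply fF => x v [cv]; rewrite vtau oppr_lt0 mul1r.
have cP : piecewise_smooth (fun (p : multiwarped a b F f) v => causal p v /\
    0 < -1 * lsubmx (v : 'rV[R]_(1 + \sum_i mdim (F i))) 0 0) gP.
  by apply: piecewise_smooth_imply pP => x v [cv]; rewrite vtau mulN1r.
have dF i : riemannian_dist (fiber_comp i (gF 0)) (fiber_comp i (gF 1)) = (d i)%:E.
  by rewrite gF0 -gF1; exact: dd.
have dP i : riemannian_dist (fiber_comp i (gP 0)) (fiber_comp i (gP 1)) = (d i)%:E.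
  by rewrite gP0 -gP1; exact: dd.
pose t0 := tau_comp z0; pose t1 := tau_comp z1.
pose sF := tau_comp (gF 1); pose sP := tau_comp (gP 1).
have n11 : `|1 : R| = 1 by rewrite normr1.
have nN11 : `|-1 : R| = 1 by rewrite normrN1.
have t0F : t0 <= sF.
  have := causal_tau_mono F_riemannian cF (lexx 0) ler01 (lexx 1).
  by rewrite gF0 !mul1r.
have t0P : sP <= t0.
  have := causal_tau_mono F_riemannian cP (lexx 0) ler01 (lexx 1).
  by rewrite gP0 !mulN1r lerN2.
(* The causal curves reach the line of [z1] at times unrelated to [t1], so the compact interval has
   to include [t1] as well. *)
pose m := Num.min sP t1; pose M := Num.max sF t1.
have mP : m <= sP by rewrite ge_min lexx.
have mt1 : m <= t1 by rewrite ge_min lexx orbT.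
have MF : sF <= M by rewrite le_max lexx.
have Mt1 : t1 <= M by rewrite le_max lexx orbT.
have Im : open_interval a b m by rewrite /m minEle; case: ifP => _; exact: tau_in.
have IM : open_interval a b M by rewrite /M maxEle; case: ifP => _; exact: tau_in.
have [r r0 Hr] := open_interval_margin Im IM.
(* Half of the margin makes the inequalities with [al] and [be] strict, the other half leaves room
   for the cut-off. *)
pose al := m - r / 2; pose be := M + r / 2; pose h := r / 2.
have h0 : 0 < h by rewrite /h; lra.
have I_h y : al - h <= y <= be + h -> open_interval a b y.
  by rewrite /al /be /h => yb; apply: Hr; lra.
have t0ab : al < t0 < be by rewrite /al /be; lra.
have t1ab : al < t1 < be by rewrite /al /be; lra.
have [|||c c0 G dG|c c0 G dG|tau [v [u [q [q0 [tau0 tau1 u01] tab dtau dv]]]]] :=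
  @confined_bvp R n d (inv_sq f) (fun i => 'D_1 (inv_sq f i)) al be h t0 t1 d0 h0 t0ab t1ab.
- by move=> i x /I_h Ix; rewrite invr_gt0 exprn_gt0// f_gt0.
- by move=> i x /I_h Ix; exact: is_derive_inv_sq.
- move=> i x /I_h Ix; have [cx _] := inv_sq_deriv_smooth f_smooth f_gt0 i 0%N; exact: cx.
(* The curve pays for the passage from [t0] to [sF]; from there to [be] the antiderivative only
   increases. *)
- have := causal_travel F_riemannian f_gt0 n11 cF dF c0 (G := G).
  rewrite gF0 !mul1r -/t0 -/sF => /(_ _)/le_trans; apply.
    by move=> y; rewrite !mul1r => yb; apply: dG; rewrite /be; lra.
  rewrite lerD2r; apply: (derive_ge0_le _ (df := fun x => Num.sqrt (\sum_i c i ^+ 2 * inv_sq f i x))).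
  + by rewrite /be; lra.
  + by move=> x xb; apply: dG; lra.
  + by move=> x _; exact: sqrtr_ge0.
- have := causal_travel F_riemannian f_gt0 nN11 cP dP c0 (G := G).
  rewrite gP0 !mulN1r opprB -/t0 -/sP => /(_ _)/le_trans; apply.
    by move=> y; rewrite !mulN1r !lerN2 => yb; apply: dG; rewrite /al; lra.
  rewrite lerD2l lerN2; apply: (derive_ge0_le _ (df := fun x => Num.sqrt (\sum_i c i ^+ 2 * inv_sq f i x))).
  + by rewrite /al; lra.
  + by move=> x xb; apply: dG; lra.
  + by move=> x _; exact: sqrtr_ge0.
apply: (@multiwarped_joining R n a b F f f_smooth f_gt0 F_riemannian z0 z1 g d e q
  _ _ _ _ _ al be tau v u) => //.
- by move=> i; case: (ed i).
- by move=> i; case: (ed i).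
- by move=> i; case: (ed i).
- by move=> i; case: (ed i) => _ _ _ [_ []].
- by move=> i; case: (ed i) => _ _ _ [_ []].
- by move=> t tb; apply: I_h; lra.
Qed.
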